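(* Let $\mathbb K$ be a field, $n\ge 2$, and $r,s\in\mathbb K$ nonzero with $r\neq s$. Let $\widetilde U=U_{r,s}(\mathfrak{gl}_n)$, $U=U_{r,s}(\mathfrak{sl}_n)$, and let $\widetilde B,\widetilde B',B,B'$ and the Hopf pairings of $\widetilde B$ with $\widetilde B'$ and of $B$ with $B'$ be as defined in the context. Then the Drinfel'd double $D(\widetilde B,(\widetilde B')^{\mathrm{coop}})$ is isomorphic to $\widetilde U$ as a Hopf algebra, and $D(B,(B')^{\mathrm{coop}})$ is isomorphic to $U$ as a Hopf algebra.
   Context: Let $\epsilon_1,\dots,\epsilon_n$ be an orthonormal basis of $\mathbb R^n$ with inner product $\langle\,,\rangle$ and $\alpha_j=\epsilon_j-\epsilon_{j+1}$ for $1\le j<n$. The algebra $\widetilde U=U_{r,s}(\mathfrak{gl}_n)$ is the unital associative $\mathbb K$-algebra generated by $e_j,f_j$ ($1\le j<n$), $a_i^{\pm1},b_i^{\pm1}$ ($1\le i\le n$) with relations: (R1) the $a_i^{\pm1},b_j^{\pm1}$ all commute and $a_ia_i^{-1}=b_jb_j^{-1}=1$; (R2) $a_ie_j=r^{\langle\epsilon_i,\alpha_j\rangle}e_ja_i$, $a_if_j=r^{-\langle\epsilon_i,\alpha_j\rangle}f_ja_i$; (R3) $b_ie_j=s^{\langle\epsilon_i,\alpha_j\rangle}e_jb_i$, $b_if_j=s^{-\langle\epsilon_i,\alpha_j\rangle}f_jb_i$; (R4) $[e_i,f_j]=\frac{\delta_{i,j}}{r-s}(a_ib_{i+1}-a_{i+1}b_i)$;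 (R5) $[e_i,e_j]=[f_i,f_j]=0$ if $|i-j|>1$; (R6) $e_i^2e_{i+1}-(r+s)e_ie_{i+1}e_i+rs\,e_{i+1}e_i^2=0$, $e_ie_{i+1}^2-(r+s)e_{i+1}e_ie_{i+1}+rs\,e_{i+1}^2e_i=0$; (R7) $f_i^2f_{i+1}-(r^{-1}+s^{-1})f_if_{i+1}f_i+r^{-1}s^{-1}f_{i+1}f_i^2=0$, $f_if_{i+1}^2-(r^{-1}+s^{-1})f_{i+1}f_if_{i+1}+r^{-1}s^{-1}f_{i+1}^2f_i=0$. Put $\omega_j=a_jb_{j+1}$, $\omega_j'=a_{j+1}b_j$ ($1\le j<n$). $U=U_{r,s}(\mathfrak{sl}_n)$ is the subalgebra of $\widetilde U$ generated by $e_j,f_j,\omega_j^{\pm1},(\omega_j')^{\pm1}$ ($1\le j<n$). $\widetilde U$ and $U$ are Hopf algebras with $a_i^{\pm1},b_i^{\pm1}$ group-like, $\Delta(e_i)=e_i\otimes1+\omega_i\otimes e_i$, $\Delta(f_i)=1\otimes f_i+f_i\otimes\omega_i'$, $\varepsilon(e_i)=\varepsilon(f_i)=0$, $S(e_i)=-\omega_i^{-1}e_i$, $S(f_i)=-f_i(\omega_i')^{-1}$. A Hopf pairing of Hopf algebras $H,H'$ is a bilinear form $(\,,)$ on $H'\times H$ with $(1,h)=\varepsilon(h)$, $(h',1)=\varepsilon(h')$, $(h',hk)=\sum(h'_{(1)},h)(h'_{(2)},k)$, $(h'k',h)=\sum(h',h_{(1)})(k',h_{(2)})$. $\widetilde B$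 is the Hopf subalgebra of $\widetilde U$ generated by $e_j,\omega_j^{\pm1}$ ($1\le j<n$) and $a_n^{\pm1}$. $\widetilde B'$ is the subalgebra of $\widetilde U$ generated by $f_j,(\omega_j')^{\pm1}$ ($1\le j<n$) and $b_n^{\pm1}$, equipped with the coproduct opposite to that of $\widetilde U$; thus $(\widetilde B')^{\mathrm{coop}}$ (same algebra, opposite coproduct) carries the coproduct of $\widetilde U$. Similarly $B$ is generated by $e_j,\omega_j^{\pm1}$, and $B'$ by $f_j,(\omega_j')^{\pm1}$ ($1\le j<n$), with coproducts defined in the same way. The Hopf pairing on $\widetilde B'\times\widetilde B$ is the one determined by $(f_i,e_j)=\frac{\delta_{i,j}}{s-r}$, $(\omega_i',\omega_j)=r^{\langle\epsilon_j,\alpha_i\rangle}s^{\langle\epsilon_{j+1},\alpha_i\rangle}$, $(b_n,a_n)=1$, $(b_n,\omega_j)=s^{-\langle\epsilon_n,\alpha_j\rangle}$, $(\omega_i',a_n)=r^{\langle\epsilon_n,\alpha_i\rangle}$, with inverses of group-like generators giving inverse values, and $0$ on all other pairs of generators (this does extend to a Hopf pairing). The pairing on $B'\times B$ is its restriction. The Drinfel'd double $D(\widetilde B,(\widetilde B')^{\mathrm{coop}})$ is $\widetilde B\otimes(\widetilde B')^{\mathrm{coop}}$ with the tensor product coalgebra structure, and multiplication such that $a\mapsto a\otimes1$ and $b\mapsto1\otimes b$ are algebra embeddings of $\widetilde B$ and $\widetilde B'$, $(a\otimes1)(1\otimes b)=a\otimes b$, and $(1\otimes b)(a\otimes1)=\sum(S^{\mathrm{coop}}(b_{(1)}),a_{(1)})\,(b_{(3)},a_{(3)})\,a_{(2)}\otimes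 b_{(2)}$, where Sweedler components of $b$ are taken in $(\widetilde B')^{\mathrm{coop}}$ and $S^{\mathrm{coop}}$ is the antipode of $(\widetilde B')^{\mathrm{coop}}$. $D(B,(B')^{\mathrm{coop}})$ is defined in the same way. *)

(* Defs.v *)
From HB Require Import structures.
From mathcomp Require Import all_boot all_order all_algebra.
From mathcomp Require Import boolp classical_sets.

Set Implicit Arguments.
Unset Strict Implicit.
Unset Printing Implicit Defensive.

Import GRing.Theory.

Local Open Scope ring_scope.
Local Open Scope quotient_scope.

Section Tensor.
Variables (K : fieldType) (V W : lmodType K).
Implicit Types (s t : seq (V * W)).

(* A sequence [:: (v1, w1); ...; (vk, wk)] stands for the formal sum
   v1 (x) w1 + ... + vk (x) wk. *)
Inductive tens_eq : seq (V * W) -> seq (V * W) -> Prop :=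
| te_refl s : tens_eq s s
| te_sym s t : tens_eq s t -> tens_eq t s
| te_trans s t u : tens_eq s t -> tens_eq t u -> tens_eq s u
| te_cat s s' t t' : tens_eq s s' -> tens_eq t t' -> tens_eq (s ++ t) (s' ++ t')
| te_catC s t : tens_eq (s ++ t) (t ++ s)
| te_zerol w : tens_eq [:: (0, w)] [::]
| te_addl v v' w : tens_eq [:: (v + v', w)] [:: (v, w); (v', w)]
| te_addr v w w' : tens_eq [:: (v, w + w')] [:: (v, w); (v, w')]
| te_scale k v w : tens_eq [:: (k *: v, w)] [:: (v, k *: w)].

Definition tens_eqb : rel (seq (V * W)) := fun s t => `[< tens_eq s t >].

Lemma tens_eqb_equiv : equiv_class_of tens_eqb.
Proof.
split=> [s|s t|t s u].
- exact/asboolP/te_refl.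
- by apply/asboolP/asboolP; apply: te_sym.
- by move=> /asboolP st /asboolP tu; apply/asboolP/(te_trans st tu).
Qed.

Canonical tens_equiv := EquivRelPack tens_eqb_equiv.

Definition tensor : Type := {eq_quot tens_equiv}.

HB.instance Definition _ := Choice.on tensor.
HB.instance Definition _ := EqQuotient.on tensor.

Definition tcls (s : seq (V * W)) : tensor := \pi_tensor s.
Definition trep (x : tensor) : seq (V * W) := repr x.

Lemma tclsK x : tcls (trep x) = x.
Proof. exact: reprK. Qed.

Lemma tclsP s t : tcls s = tcls t <-> tens_eq s t.
Proof. by split=> [/eqmodP/asboolP|st]; last apply/eqmodP/asboolP. Qed.

Lemma trepP s : tens_eq (trep (tcls s)) s.
Proof. by apply/tclsP; rewrite tclsK. Qed.

Lemma tens_ind (P : tensor -> Prop) : (forall s, P (tcls s)) -> forall x, P x.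
Proof. by move=> Pcls x; rewrite -[x]tclsK. Qed.

Definition tens_zero : tensor := tcls [::].
Definition tens_add (x y : tensor) : tensor := tcls (trep x ++ trep y).
Definition tens_scale (k : K) (x : tensor) : tensor :=
  tcls [seq (k *: p.1, p.2) | p <- trep x].
Definition tens_opp (x : tensor) : tensor := tens_scale (-1) x.

Lemma tens_addE s t : tens_add (tcls s) (tcls t) = tcls (s ++ t).
Proof. by apply/tclsP/te_cat; apply: trepP. Qed.

Lemma tens_eq_scale k s t : tens_eq s t ->
  tens_eq [seq (k *: p.1, p.2) | p <- s] [seq (k *: p.1, p.2) | p <- t].
Proof.
elim=> //= {s t} [s|s t _|s t u _ + _|s s' t t' _ ? _ ?|s t|w|v v' w|v w w'|l v w].
- exact: te_refl.
- exact: te_sym.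
- exact: te_trans.
- by rewrite !map_cat; apply: te_cat.
- by rewrite !map_cat; apply: te_catC.
- by rewrite scaler0; apply: te_zerol.
- by rewrite scalerDr; apply: te_addl.
- exact: te_addr.
- by rewrite scalerA mulrC -scalerA; apply: te_scale.
Qed.

Lemma tens_scaleE k s :
  tens_scale k (tcls s) = tcls [seq (k *: p.1, p.2) | p <- s].
Proof. by apply/tclsP/tens_eq_scale; apply: trepP. Qed.

Lemma tens_addA : associative tens_add.
Proof.
elim/tens_ind=> s; elim/tens_ind=> t; elim/tens_ind=> u.
by rewrite !tens_addE catA.
Qed.

Lemma tens_addC : commutative tens_add.
Proof.
elim/tens_ind=> s; elim/tens_ind=> t; rewrite !tens_addE.
by apply/tclsP; apply: te_catC.
Qed.

Lemma tens_add0 : left_id tens_zero tens_add.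
Proof. by elim/tens_ind=> s; rewrite tens_addE. Qed.

HB.instance Definition _ :=
  GRing.isNmodule.Build tensor tens_addA tens_addC tens_add0.

Definition pure (v : V) (w : W) : tensor := tcls [:: (v, w)].

Lemma tcls_cat s t :
  tcls (s ++ t) = tcls s + tcls t :> tensor.
Proof. by rewrite /GRing.add /= tens_addE. Qed.

Lemma tcls_cons v w s :
  tcls ((v, w) :: s) = pure v w + tcls s :> tensor.
Proof. by rewrite -cat1s tcls_cat. Qed.

Lemma tcls_sum s : tcls s = \sum_(p <- s) pure p.1 p.2 :> tensor.
Proof.
elim: s => [|[v w] s IHs]; first by rewrite big_nil.
by rewrite tcls_cons big_cons IHs.
Qed.

Lemma tens_sumE (x : tensor) : x = \sum_(p <- trep x) pure p.1 p.2.
Proof. by rewrite -tcls_sum tclsK. Qed.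

Lemma pureDl v v' w : pure (v + v') w = pure v w + pure v' w.
Proof. by rewrite -tcls_cons; apply/tclsP/te_addl. Qed.

Lemma pureDr v w w' : pure v (w + w') = pure v w + pure v w'.
Proof. by rewrite -tcls_cons; apply/tclsP/te_addr. Qed.

Lemma pure0l w : pure 0 w = 0.
Proof. by apply/tclsP; apply: te_zerol. Qed.

Lemma pure_scale k v w : pure (k *: v) w = pure v (k *: w).
Proof. by apply/tclsP; apply: te_scale. Qed.

Lemma tens_scale_cons k v w s :
  tens_scale k (tcls ((v, w) :: s)) =
  pure (k *: v) w + tens_scale k (tcls s) :> tensor.
Proof. by rewrite !tens_scaleE tcls_cons. Qed.

Lemma tens_oppK (x : tensor) : tens_opp x + x = 0.
Proof.
elim/tens_ind: x; rewrite /tens_opp; elim=> [|[v w] s IHs].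
  by rewrite tens_scaleE -tcls_cat.
rewrite tens_scale_cons tcls_cons addrACA IHs addr0 -pureDl.
by rewrite scaleN1r addNr pure0l.
Qed.

HB.instance Definition _ := GRing.Nmodule_isZmodule.Build tensor tens_oppK.

Lemma tens_scaleA k l (x : tensor) :
  tens_scale k (tens_scale l x) = tens_scale (k * l) x.
Proof.
elim/tens_ind: x => s; rewrite !tens_scaleE -map_comp; congr (tcls _).
by apply: eq_map => p /=; rewrite scalerA.
Qed.

Lemma tens_scale1 : left_id 1 tens_scale.
Proof.
elim/tens_ind=> s; rewrite tens_scaleE; congr (tcls _).
by rewrite -[RHS]map_id; apply: eq_map => -[v w] /=; rewrite scale1r.
Qed.

Lemma tens_scaleDr : right_distributive tens_scale +%R.
Proof.
move=> k; elim/tens_ind=> s; elim/tens_ind=> t; rewrite -tcls_cat !tens_scaleE.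
by rewrite map_cat tcls_cat.
Qed.

Lemma tens_scaleDl x : {morph tens_scale^~ x : k l / k + l}.
Proof.
move=> k l; elim/tens_ind: x; elim=> [|[v w] s IHs].
  by rewrite !tens_scaleE -tcls_cat.
by rewrite !tens_scale_cons IHs scalerDl pureDl addrACA.
Qed.

HB.instance Definition _ := GRing.Zmodule_isLmodule.Build K tensor
  tens_scaleA tens_scale1 tens_scaleDr tens_scaleDl.

Lemma pureZl k v w : pure (k *: v) w = k *: pure v w.
Proof. by rewrite /GRing.scale /= tens_scaleE. Qed.

Lemma pureZr k v w : pure v (k *: w) = k *: pure v w.
Proof. by rewrite -pure_scale pureZl. Qed.

(* The linear map on V (x) W induced by [beta], computed on an arbitrary
   decomposition into pure tensors; by [tens_lift_sum] the result does not
   depend on that decomposition when [beta] is bilinear. *)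
Definition tens_lift (M : zmodType) (beta : V -> W -> M) (x : tensor) : M :=
  \sum_(p <- trep x) beta p.1 p.2.

Definition balanced (M : zmodType) (beta : V -> W -> M) : Prop :=
  [/\ forall v v' w, beta (v + v') w = beta v w + beta v' w,
      forall v w w', beta v (w + w') = beta v w + beta v w'
    & forall k v w, beta (k *: v) w = beta v (k *: w)].

Lemma tens_lift_sum (M : zmodType) (beta : V -> W -> M) s : balanced beta ->
  tens_lift beta (\sum_(p <- s) pure p.1 p.2) = \sum_(p <- s) beta p.1 p.2.
Proof.
case=> bDl bDr bZ; rewrite -tcls_sum /tens_lift.
suff lift_eq t u : tens_eq t u ->
    \sum_(p <- t) beta p.1 p.2 = \sum_(p <- u) beta p.1 p.2.
  exact/lift_eq/trepP.
elim=> // {s t u}.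
- by move=> s t u _ -> _ ->.
- by move=> s s' t t' _ IHs _ IHt; rewrite !big_cat /= IHs IHt.
- by move=> s t; rewrite !big_cat /= addrC.
- move=> w; rewrite big_seq1 big_nil /=; apply: (addIr (beta 0 w)).
  by rewrite -bDl !add0r.
- by move=> v v' w; rewrite !big_cons !big_nil !addr0 /= bDl.
- by move=> v w w'; rewrite !big_cons !big_nil !addr0 /= bDr.
- by move=> k v w; rewrite !big_seq1 /= bZ.
Qed.

Lemma tens_lift_pure (M : zmodType) (beta : V -> W -> M) v w :
  balanced beta -> tens_lift beta (pure v w) = beta v w.
Proof.
by move=> /(@tens_lift_sum _ _ [:: (v, w)]); rewrite !big_seq1.
Qed.

End Tensor.

Notation "v ⊗ w" := (pure v w) (at level 40, left associativity) : ring_scope.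

Definition tens_map (K : fieldType) (V V' W W' : lmodType K)
    (f : V -> V') (g : W -> W') : tensor V W -> tensor V' W' :=
  tens_lift (fun v w => f v ⊗ g w).

Definition tens_flip (K : fieldType) (V W : lmodType K) :
    tensor V W -> tensor W V :=
  tens_lift (fun v w => w ⊗ v).

(* Operations only; the axioms are [is_bialgebra] and [is_hopf].  The
   multiplication is a field of the record, not the canonical one of an
   [algType], because the Drinfel'd double puts a twisted multiplication on a
   tensor product. *)
Record bialg_data (K : fieldType) := BialgData {
  bcarrier :> lmodType K;
  bmul : bcarrier -> bcarrier -> bcarrier;
  bone : bcarrier;
  bcomul : bcarrier -> tensor bcarrier bcarrier;
  bcounit : bcarrier -> K }.

Arguments bone {K} b.

Section Hopf.
Variable K : fieldType.
Implicit Types H Hc : bialg_data K.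

(* Sweedler sums: [sweedler2 beta x] is the sum of beta x_(1) x_(2) and
   [sweedler3 gamma x] the sum of gamma x_(1) x_(2) x_(3). *)
Definition sweedler2 H (M : zmodType) (beta : H -> H -> M) (x : H) : M :=
  tens_lift beta (bcomul x).

Definition sweedler3 H (M : zmodType) (gamma : H -> H -> H -> M) (x : H) : M :=
  sweedler2 (fun x1 y => sweedler2 (gamma x1) y) x.

Definition is_bialgebra H : Prop :=
  [/\ [/\ forall x, linear (fun y : H => bmul x y),
          forall y, linear (fun x : H => bmul x y),
          associative (@bmul K H),
          left_id (bone H) (@bmul K H)
        & right_id (bone H) (@bmul K H)],
      [/\ linear (@bcomul K H),
          scalar (@bcounit K H),
          forall x : H, sweedler2 (fun u v => tens_lift
              (fun u1 u2 => u1 ⊗ (u2 ⊗ v)) (bcomul u)) x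
            = sweedler2 (fun u v => u ⊗ bcomul v) x,
          forall x : H, sweedler2 (fun u v => bcounit u *: v) x = x
        & forall x : H, sweedler2 (fun u v => bcounit v *: u) x = x]
    & [/\ forall x y : H, bcomul (bmul x y)
            = sweedler2 (fun x1 x2 =>
                sweedler2 (fun y1 y2 => bmul x1 y1 ⊗ bmul x2 y2) y) x,
          bcomul (bone H) = bone H ⊗ bone H,
          forall x y : H, bcounit (bmul x y) = bcounit x * bcounit y
        & bcounit (bone H) = 1]].

Definition is_antipode H (S : H -> H) : Prop :=
  [/\ linear S,
      forall x, sweedler2 (fun u v => bmul (S u) v) x = bcounit x *: bone H
    & forall x, sweedler2 (fun u v => bmul u (S v)) x = bcounit x *: bone H].

Definition is_hopf H : Prop :=
  is_bialgebra H /\ exists S : H -> H, is_antipode S.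

(* In a bialgebra the antipode is unique when it exists. *)
Definition antipode H : H -> H := xget (fun=> 0) [set S | @is_antipode H S].

Definition is_hopf_iso H H' (phi : H -> H') : Prop :=
  [/\ linear phi /\ bijective phi,
      forall x y, phi (bmul x y) = bmul (phi x) (phi y),
      phi (bone H) = bone H',
      forall x, bcomul (phi x) = tens_map phi phi (bcomul x)
    & (forall x, bcounit (phi x) = bcounit x) /\
      (forall x, phi (antipode x) = antipode (phi x))].

Definition hopf_isomorphic H H' : Prop :=
  [/\ is_hopf H, is_hopf H' & exists phi : H -> H', is_hopf_iso phi].

Definition coop H : bialg_data K :=
  @BialgData K H (@bmul K H) (bone H) (fun x => tens_flip (bcomul x))
    (@bcounit K H).

Definition is_hopf_pairing H' H (p : H' -> H -> K) : Prop :=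
  [/\ (forall x', scalar (p x')) /\ (forall x, scalar (p^~ x)),
      forall x, p (bone H') x = bcounit x,
      forall x', p x' (bone H) = bcounit x',
      forall x' x y, p x' (bmul x y) = sweedler2 (fun u v => p u x * p v y) x'
    & forall x' y' x, p (bmul x' y') x = sweedler2 (fun u v => p x' u * p y' v) x].

(* The Drinfel'd double D(H, Hc), where Hc = (H')^coop and p is a Hopf pairing
   on H' x H; the coproduct, hence the Sweedler components, and the antipode
   used for b are those of Hc.  The multiplication is
     (a ⊗ b)(a' ⊗ b') = (a ⊗ 1) ((1 ⊗ b)(a' ⊗ 1)) (1 ⊗ b')
   with (1 ⊗ b)(a' ⊗ 1) expanded by the cross relation. *)
Definition double_mul H Hc (p : Hc -> H -> K) (x y : tensor H Hc) : tensor H Hc :=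
  tens_lift (fun a b => tens_lift (fun a' b' =>
    sweedler3 (fun b1 b2 b3 => sweedler3 (fun a1 a2 a3 =>
      (p (antipode b1) a1 * p b3 a3) *: (bmul a a2 ⊗ bmul b2 b')) a') b) y) x.

Definition double_comul H Hc (x : tensor H Hc) :
    tensor (tensor H Hc) (tensor H Hc) :=
  tens_lift (fun a b => sweedler2 (fun a1 a2 =>
    sweedler2 (fun b1 b2 => (a1 ⊗ b1) ⊗ (a2 ⊗ b2)) b) a) x.

Definition drinfeld_double H Hc (p : Hc -> H -> K) : bialg_data K :=
  @BialgData K (tensor H Hc) (double_mul p) (bone H ⊗ bone Hc)
    (@double_comul H Hc) (tens_lift (fun a b => bcounit a * bcounit b)).

End Hopf.

Arguments drinfeld_double {K} H Hc p.

Section Subalgebra.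
Variables (K : fieldType) (A : algType K).

Inductive generated (X : set A) : A -> Prop :=
| gen_in x : X x -> generated X x
| gen_one : generated X 1
| gen_lin k x y : generated X x -> generated X y -> generated X (k *: x + y)
| gen_mul x y : generated X x -> generated X y -> generated X (x * y).

Definition subalg_pred (X : set A) : {pred A} := fun x => `[< generated X x >].

Lemma subalg_closed X : GRing.subalg_closed (subalg_pred X).
Proof.
split=> [|k x y /asboolP gx /asboolP gy|x y /asboolP gx /asboolP gy].
- exact/asboolP/gen_one.
- exact/asboolP/gen_lin.
- exact/asboolP/gen_mul.
Qed.

HB.instance Definition _ X :=
  GRing.isSubalgClosed.Build K A (subalg_pred X) (subalg_closed X).

Definition subalg (X : set A) : Type := {x : A | x \in subalg_pred X}.

HB.instance Definition _ X := SubChoice.on (subalg X).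
HB.instance Definition _ X :=
  [SubChoice_isSubAlgebra of subalg X by <:].

Lemma generated_sub (X Y : set A) (x : A) :
  (X `<=` Y)%classic -> generated X x -> generated Y x.
Proof.
move=> XY; elim=> {x}.
- by move=> x /XY; apply: gen_in.
- exact: gen_one.
- by move=> k x y _ gx _ gy; apply: gen_lin.
- by move=> x y _ gx _ gy; apply: gen_mul.
Qed.

Definition subalg_incl (X Y : set A) (XY : (X `<=` Y)%classic) (x : subalg X) :
    subalg Y :=
  exist _ (\val x)
    (introT (asboolP _) (generated_sub XY (elimT (asboolP _) (valP x)))).

End Subalgebra.

Definition alg_bialg (K : fieldType) (A : algType K)
    (D : A -> tensor A A) (eps : A -> K) : bialg_data K :=
  @BialgData K A *%R 1 D eps.

(* The structure induced by (A, D, eps) on the subalgebra generated by X; the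
   coproduct of x is the preimage of D x under the injection of
   (subalg X) (x) (subalg X) into A (x) A, provided D x lies in its image. *)
Definition sub_bialg (K : fieldType) (A : algType K)
    (D : A -> tensor A A) (eps : A -> K) (X : set A) : bialg_data K :=
  @alg_bialg K (subalg X)
    (fun x => xget 0 [set t : tensor (subalg X) (subalg X) |
                       tens_map \val \val t = D (\val x)])
    (fun x => eps (\val x)).

Section Presentation.
Variables (K : fieldType) (G : Type).

Inductive term :=
| TGen of G
| TConst of K
| TAdd of term & term
| TMul of term & term.

(* The least congruence that makes terms a unital associative K-algebra and
   contains [R]. *)
Inductive pres_eq (R : term -> term -> Prop) : term -> term -> Prop :=
| pe_rel t u : R t u -> pres_eq R t u
| pe_refl t : pres_eq R t t
| pe_sym t u : pres_eq R t u -> pres_eq R u t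
| pe_trans t u v : pres_eq R t u -> pres_eq R u v -> pres_eq R t v
| pe_add t t' u u' :
    pres_eq R t t' -> pres_eq R u u' -> pres_eq R (TAdd t u) (TAdd t' u')
| pe_mul t t' u u' :
    pres_eq R t t' -> pres_eq R u u' -> pres_eq R (TMul t u) (TMul t' u')
| pe_addA t u v : pres_eq R (TAdd t (TAdd u v)) (TAdd (TAdd t u) v)
| pe_addC t u : pres_eq R (TAdd t u) (TAdd u t)
| pe_add0 t : pres_eq R (TAdd (TConst 0) t) t
| pe_mulA t u v : pres_eq R (TMul t (TMul u v)) (TMul (TMul t u) v)
| pe_mul1 t : pres_eq R (TMul (TConst 1) t) t
| pe_mul0 t : pres_eq R (TMul (TConst 0) t) (TConst 0)
| pe_mulDl t u v : pres_eq R (TMul (TAdd t u) v) (TAdd (TMul t v) (TMul u v))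
| pe_mulDr t u v : pres_eq R (TMul t (TAdd u v)) (TAdd (TMul t u) (TMul t v))
| pe_constC k t : pres_eq R (TMul (TConst k) t) (TMul t (TConst k))
| pe_constD k l : pres_eq R (TConst (k + l)) (TAdd (TConst k) (TConst l))
| pe_constM k l : pres_eq R (TConst (k * l)) (TMul (TConst k) (TConst l)).

HB.instance Definition _ := gen_eqMixin term.
HB.instance Definition _ := gen_choiceMixin term.

Variable R : term -> term -> Prop.

Definition pres_eqb : rel term := fun t u => `[< pres_eq R t u >].

Lemma pres_eqb_equiv : equiv_class_of pres_eqb.
Proof.
split=> [t|t u|u t v].
- exact/asboolP/pe_refl.
- by apply/asboolP/asboolP; apply: pe_sym.
- by move=> /asboolP tu /asboolP uv; apply/asboolP/(pe_trans tu uv).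
Qed.

Canonical pres_equiv := EquivRelPack pres_eqb_equiv.

Definition pres_alg : Type := {eq_quot pres_equiv}.

HB.instance Definition _ := Choice.on pres_alg.
HB.instance Definition _ := EqQuotient.on pres_alg.

Definition pcls (t : term) : pres_alg := \pi_pres_alg t.
Definition prep (x : pres_alg) : term := repr x.

Lemma pclsK x : pcls (prep x) = x.
Proof. exact: reprK. Qed.

Lemma pclsP t u : pcls t = pcls u <-> pres_eq R t u.
Proof. by split=> [/eqmodP/asboolP|tu]; last apply/eqmodP/asboolP. Qed.

Lemma prepP t : pres_eq R (prep (pcls t)) t.
Proof. by apply/pclsP; rewrite pclsK. Qed.

Lemma pres_ind (P : pres_alg -> Prop) : (forall t, P (pcls t)) -> forall x, P x.
Proof. by move=> Pcls x; rewrite -[x]pclsK. Qed.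

Definition pres_add (x y : pres_alg) : pres_alg := pcls (TAdd (prep x) (prep y)).
Definition pres_mul (x y : pres_alg) : pres_alg := pcls (TMul (prep x) (prep y)).
Definition pres_opp (x : pres_alg) : pres_alg := pres_mul (pcls (TConst (-1))) x.
Definition pres_scale (k : K) (x : pres_alg) : pres_alg :=
  pres_mul (pcls (TConst k)) x.

Lemma pres_addE t u : pres_add (pcls t) (pcls u) = pcls (TAdd t u).
Proof. by apply/pclsP/pe_add; apply: prepP. Qed.

Lemma pres_mulE t u : pres_mul (pcls t) (pcls u) = pcls (TMul t u).
Proof. by apply/pclsP/pe_mul; apply: prepP. Qed.

Lemma pres_addA : associative pres_add.
Proof.
elim/pres_ind=> t; elim/pres_ind=> u; elim/pres_ind=> v.
by rewrite !pres_addE; apply/pclsP/pe_addA.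
Qed.

Lemma pres_addC : commutative pres_add.
Proof.
elim/pres_ind=> t; elim/pres_ind=> u.
by rewrite !pres_addE; apply/pclsP/pe_addC.
Qed.

Lemma pres_add0 : left_id (pcls (TConst 0)) pres_add.
Proof. by elim/pres_ind=> t; rewrite pres_addE; apply/pclsP/pe_add0. Qed.

Lemma pres_mulA : associative pres_mul.
Proof.
elim/pres_ind=> t; elim/pres_ind=> u; elim/pres_ind=> v.
by rewrite !pres_mulE; apply/pclsP/pe_mulA.
Qed.

Lemma pres_mul1 : left_id (pcls (TConst 1)) pres_mul.
Proof. by elim/pres_ind=> t; rewrite pres_mulE; apply/pclsP/pe_mul1. Qed.

Lemma pres_constC k x : pres_mul (pcls (TConst k)) x = pres_mul x (pcls (TConst k)).
Proof. by elim/pres_ind: x => t; rewrite !pres_mulE; apply/pclsP/pe_constC. Qed.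

Lemma pres_mulr1 : right_id (pcls (TConst 1)) pres_mul.
Proof. by move=> x; rewrite -pres_constC pres_mul1. Qed.

Lemma pres_mulDl : left_distributive pres_mul pres_add.
Proof.
elim/pres_ind=> t; elim/pres_ind=> u; elim/pres_ind=> v.
by rewrite !(pres_addE, pres_mulE); apply/pclsP/pe_mulDl.
Qed.

Lemma pres_mulDr : right_distributive pres_mul pres_add.
Proof.
elim/pres_ind=> t; elim/pres_ind=> u; elim/pres_ind=> v.
by rewrite !(pres_addE, pres_mulE); apply/pclsP/pe_mulDr.
Qed.

Lemma pres_constD k l :
  pcls (TConst (k + l)) = pres_add (pcls (TConst k)) (pcls (TConst l)).
Proof. by rewrite pres_addE; apply/pclsP/pe_constD. Qed.

Lemma pres_constM k l :
  pcls (TConst (k * l)) = pres_mul (pcls (TConst k)) (pcls (TConst l)).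
Proof. by rewrite pres_mulE; apply/pclsP/pe_constM. Qed.

Lemma pres_addN : left_inverse (pcls (TConst 0)) pres_opp pres_add.
Proof.
move=> x; rewrite -{2}[x]pres_mul1 -pres_mulDl -pres_constD addNr.
by elim/pres_ind: x => t; rewrite pres_mulE; apply/pclsP/pe_mul0.
Qed.

HB.instance Definition _ :=
  GRing.isZmodule.Build pres_alg pres_addA pres_addC pres_add0 pres_addN.

HB.instance Definition _ := GRing.Zmodule_isPzRing.Build pres_alg
  pres_mulA pres_mul1 pres_mulr1 pres_mulDl pres_mulDr.

Lemma pres_scaleA k l x : pres_scale k (pres_scale l x) = pres_scale (k * l) x.
Proof. by rewrite /pres_scale pres_mulA -pres_constM. Qed.

Lemma pres_scaleDl x : {morph pres_scale^~ x : k l / k + l >-> k + l}.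
Proof. by move=> k l; rewrite /pres_scale pres_constD pres_mulDl. Qed.

HB.instance Definition _ := GRing.Zmodule_isLmodule.Build K pres_alg
  pres_scaleA pres_mul1 (fun k => pres_mulDr (pcls (TConst k))) pres_scaleDl.

Lemma pres_scaleAl (k : K) (x y : pres_alg) : k *: (x * y) = k *: x * y.
Proof. exact: pres_mulA. Qed.

Lemma pres_scaleAr (k : K) (x y : pres_alg) : k *: (x * y) = x * (k *: y).
Proof.
by rewrite pres_scaleAl [LHS]/GRing.mul /= /GRing.scale /= /pres_scale
  pres_constC -pres_mulA.
Qed.

(* The value of a term in K when each generator takes the value [ev]. *)
Fixpoint term_char (ev : G -> K) (t : term) : K :=
  match t with
  | TGen g => ev g
  | TConst k => k
  | TAdd t u => term_char ev t + term_char ev u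
  | TMul t u => term_char ev t * term_char ev u
  end.

Lemma pres_eq_char (ev : G -> K) :
    (forall t u, R t u -> term_char ev t = term_char ev u) ->
  forall t u, pres_eq R t u -> term_char ev t = term_char ev u.
Proof.
move=> evR t u; elim=> //= {t u}.
- by move=> t u v _ -> _ ->.
- by move=> t t' u u' _ -> _ ->.
- by move=> t t' u u' _ -> _ ->.
- by move=> t u v; rewrite addrA.
- by move=> t u; rewrite addrC.
- by move=> t; rewrite add0r.
- by move=> t u v; rewrite mulrA.
- by move=> t; rewrite mul1r.
- by move=> t; rewrite mul0r.
- by move=> t u v; rewrite mulrDl.
- by move=> t u v; rewrite mulrDr.
- by move=> k t; rewrite mulrC.
Qed.

Lemma pres_alg_neq0 (ev : G -> K) :
    (forall t u, R t u -> term_char ev t = term_char ev u) ->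
  (1 : pres_alg) != 0.
Proof.
move=> evR; apply/eqP => /pclsP /(pres_eq_char evR) /= /eqP.
by rewrite oner_eq0.
Qed.

End Presentation.

Arguments TGen {K G}.
Arguments TConst {K G}.

(* Everything below is indexed by N = n - 1 >= 0, the rank of sl_n.  The index
   sets {1, ..., n - 1} and {1, ..., n} become 'I_N and 'I_N.+1 (shifted to
   start at 0); for j : 'I_N, [lo j] and [hi j] are j and j + 1 seen in 'I_N.+1,
   and the index n is [ord_max]. *)
Definition lo N (j : 'I_N) : 'I_N.+1 := widen_ord (leqnSn N) j.
Definition hi N (j : 'I_N) : 'I_N.+1 := lift ord0 j.

(* The weights involved lie in the lattice Z^n of R^n, on which the inner
   product is integral. *)
Definition inner n (u v : 'rV[int]_n) : int := (u *m v^T) 0 0.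
Definition epsilon n (i : 'I_n) : 'rV[int]_n := delta_mx 0 i.
Definition alpha N (j : 'I_N) : 'rV[int]_N.+1 := epsilon (lo j) - epsilon (hi j).

(* The boolean argument selects the generator ([false]) or its inverse
   ([true]). *)
Inductive ugen N :=
| GE of 'I_N
| GF of 'I_N
| GA of 'I_N.+1 & bool
| GB of 'I_N.+1 & bool.

Section Relations.
Variables (K : fieldType) (N : nat) (r s : K).

Local Notation term := (term K (ugen N)).
Local Notation e j := (TGen (GE j) : term).
Local Notation f j := (TGen (GF j) : term).
Local Notation a i u := (TGen (GA i u) : term).
Local Notation b i u := (TGen (GB i u) : term).
Declare Scope pres_scope.
Delimit Scope pres_scope with pres.
Local Notation "t + u" := (TAdd t u) : pres_scope.
Local Notation "t * u" := (TMul t u) : pres_scope.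
Local Notation "k *: t" := (TMul (TConst k) t) : pres_scope.
Local Notation "t - u" := (TAdd t (TMul (TConst (-1)) u)) : pres_scope.
Local Notation zero := (TConst 0 : term).
Local Notation one := (TConst 1 : term).

Definition serre_l (p q : K) (x y : term) : term :=
  (x * x * y - p *: (x * y * x) + q *: (y * x * x))%pres.

Definition serre_r (p q : K) (x y : term) : term :=
  (x * y * y - p *: (y * x * y) + q *: (y * y * x))%pres.

Inductive ugl_rel : term -> term -> Prop :=
| rel_aa i j u v : ugl_rel (a i u * a j v)%pres (a j v * a i u)%pres
| rel_ab i j u v : ugl_rel (a i u * b j v)%pres (b j v * a i u)%pres
| rel_bb i j u v : ugl_rel (b i u * b j v)%pres (b j v * b i u)%pres
| rel_ainv i : ugl_rel (a i false * a i true)%pres one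
| rel_binv i : ugl_rel (b i false * b i true)%pres one
| rel_ae i j : ugl_rel (a i false * e j)%pres
    ((r ^ inner (epsilon i) (alpha j))%R *: (e j * a i false))%pres
| rel_af i j : ugl_rel (a i false * f j)%pres
    ((r ^ (- inner (epsilon i) (alpha j)))%R *: (f j * a i false))%pres
| rel_be i j : ugl_rel (b i false * e j)%pres
    ((s ^ inner (epsilon i) (alpha j))%R *: (e j * b i false))%pres
| rel_bf i j : ugl_rel (b i false * f j)%pres
    ((s ^ (- inner (epsilon i) (alpha j)))%R *: (f j * b i false))%pres
| rel_ef i j : ugl_rel (e i * f j - f j * e i)%pres
    (((i == j)%:R / (r - s))%R *:
       (a (lo i) false * b (hi i) false - a (hi i) false * b (lo i) false))%pres
| rel_ee (i j : 'I_N) : (i.+1 < j)%N || (j.+1 < i)%N ->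
    ugl_rel (e i * e j - e j * e i)%pres zero
| rel_ff (i j : 'I_N) : (i.+1 < j)%N || (j.+1 < i)%N ->
    ugl_rel (f i * f j - f j * f i)%pres zero
| rel_eel (i j : 'I_N) : j = i.+1 :> nat ->
    ugl_rel (serre_l (r + s) (r * s) (e i) (e j)) zero
| rel_eer (i j : 'I_N) : j = i.+1 :> nat ->
    ugl_rel (serre_r (r + s) (r * s) (e i) (e j)) zero
| rel_ffl (i j : 'I_N) : j = i.+1 :> nat ->
    ugl_rel (serre_l (r^-1 + s^-1) (r^-1 * s^-1) (f i) (f j)) zero
| rel_ffr (i j : 'I_N) : j = i.+1 :> nat ->
    ugl_rel (serre_r (r^-1 + s^-1) (r^-1 * s^-1) (f i) (f j)) zero.

Local Notation ev0 :=
  (fun g : ugen N => match g with GE _ | GF _ => 0 | _ => 1 end : K).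

Lemma ugl_rel_char t u : ugl_rel t u -> term_char ev0 t = term_char ev0 u.
Proof.
by case=> * /=; rewrite !(mul0r, mulr0, mulr1, mul1r, addr0, subrr, mulN1r, oppr0).
Qed.

Definition Ugl : Type := pres_alg ugl_rel.

HB.instance Definition _ := GRing.PzRing.on Ugl.
HB.instance Definition _ := GRing.Lmodule.on Ugl.
HB.instance Definition _ :=
  GRing.PzSemiRing_isNonZero.Build Ugl (pres_alg_neq0 ugl_rel_char).
HB.instance Definition _ :=
  GRing.Lmodule_isLalgebra.Build K Ugl (@pres_scaleAl _ _ ugl_rel).
HB.instance Definition _ :=
  GRing.Lalgebra_isAlgebra.Build K Ugl (@pres_scaleAr _ _ ugl_rel).

End Relations.

Section Ugl.
Variables (K : fieldType) (N : nat) (r s : K).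

Local Notation U := (Ugl N r s).

Definition ue (j : 'I_N) : U := pcls _ (TGen (GE j)).
Definition uf (j : 'I_N) : U := pcls _ (TGen (GF j)).
Definition ua (i : 'I_N.+1) (u : bool) : U := pcls _ (TGen (GA i u)).
Definition ub (i : 'I_N.+1) (u : bool) : U := pcls _ (TGen (GB i u)).

Definition omega (j : 'I_N) (u : bool) : U := ua (lo j) u * ub (hi j) u.
Definition omega' (j : 'I_N) (u : bool) : U := ua (hi j) u * ub (lo j) u.

(* (D, eps) is the coproduct and counit of the Hopf algebra U_{r,s}(gl_n). *)
Definition is_ugl_hopf (D : U -> tensor U U) (eps : U -> K) : Prop :=
  let H := alg_bialg D eps in
  [/\ is_hopf H,
      forall i u, D (ua i u) = ua i u ⊗ ua i u /\ D (ub i u) = ub i u ⊗ ub i u,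
      forall j, D (ue j) = ue j ⊗ 1 + omega j false ⊗ ue j /\
                D (uf j) = 1 ⊗ uf j + uf j ⊗ omega' j false,
      (forall i u, eps (ua i u) = 1 /\ eps (ub i u) = 1) /\
      (forall j, eps (ue j) = 0 /\ eps (uf j) = 0)
    & forall j, @antipode K H (ue j) = - (omega j true * ue j) /\
                @antipode K H (uf j) = - (uf j * omega' j true)].

Definition sl_gens : set U :=
  [set x | exists j, x = ue j \/ x = uf j \/
     exists u, x = omega j u \/ x = omega' j u].

Definition borel_sl_gens : set U :=
  [set x | exists j, x = ue j \/ exists u, x = omega j u].
Definition borel_sl_gens' : set U :=
  [set x | exists j, x = uf j \/ exists u, x = omega' j u].

Definition borel_gl_gens : set U :=
  (borel_sl_gens `|` [set x | exists u, x = ua ord_max u])%classic.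
Definition borel_gl_gens' : set U :=
  (borel_sl_gens' `|` [set x | exists u, x = ub ord_max u])%classic.

Definition borel_incl : subalg borel_sl_gens -> subalg borel_gl_gens :=
  subalg_incl (@subsetUl _ _ _).
Definition borel_incl' : subalg borel_sl_gens' -> subalg borel_gl_gens' :=
  subalg_incl (@subsetUl _ _ _).

(* Group-like generators of the two Borel subalgebras of U_{r,s}(gl_n):
   [Some j] stands for omega_j (resp. omega'_j), [None] for a_n (resp. b_n). *)
Definition grp (g : option 'I_N) (u : bool) : U :=
  if g is Some j then omega j u else ua ord_max u.
Definition grp' (g : option 'I_N) (u : bool) : U :=
  if g is Some j then omega' j u else ub ord_max u.

Definition grp_pairing (g' g : option 'I_N) : K :=
  match g', g with
  | Some i, Some j => r ^ inner (epsilon (lo j)) (alpha i)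
                      * s ^ inner (epsilon (hi j)) (alpha i)
  | None, None => 1
  | None, Some j => s ^ (- inner (epsilon ord_max) (alpha j))
  | Some i, None => r ^ inner (epsilon ord_max) (alpha i)
  end.

Definition pairing_values (p : subalg borel_gl_gens' -> subalg borel_gl_gens -> K) :
    Prop :=
  forall (x : subalg borel_gl_gens') (y : subalg borel_gl_gens),
  [/\ forall i j, \val x = uf i -> \val y = ue j -> p x y = (i == j)%:R / (s - r),
      forall g' u' g u, \val x = grp' g' u' -> \val y = grp g u ->
        p x y = if u' == u then grp_pairing g' g else (grp_pairing g' g)^-1,
      forall i g u, \val x = uf i -> \val y = grp g u -> p x y = 0
    & forall g' u' j, \val x = grp' g' u' -> \val y = ue j -> p x y = 0].

End Ugl.

Arguments sl_gens {K} N r s.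
Arguments borel_sl_gens {K} N r s.
Arguments borel_sl_gens' {K} N r s.
Arguments borel_gl_gens {K} N r s.
Arguments borel_gl_gens' {K} N r s.
Arguments borel_incl {K N r s}.
Arguments borel_incl' {K N r s}.

(* Main.v *)
Require Import Defs.
From mathcomp Require Import all_boot all_order all_algebra.
From mathcomp Require Import boolp classical_sets.
Import GRing.Theory.
Local Open Scope ring_scope.

Set Implicit Arguments.
Unset Strict Implicit.
Unset Printing Implicit Defensive.

(** Multiplication gives a map from B (x) B' to U. It respects products because,
for a in B and b in B', the antipode-free cross relation
  sum (b_1, a_1) b_2 a_2 = sum a_1 b_1 (b_2, a_2)
holds in U: it passes to products in either argument, and on generators it is
(R2)-(R4). It is surjective since B and B' contain the generators of U.

For gl_n injectivity needs no PBW basis: U acts on B (x) B', with B acting by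
left multiplication on the first factor and b in B' by
  b (a (x) c) = sum (b_3 . a . S(b_1)) (x) b_2 c,
where h . a and a . h are the left and right actions of B' on B given by the
pairing, and u |-> u (1 (x) 1) is a left inverse of the multiplication map.
For sl_n injectivity follows by restriction, because tensor products of
injective linear maps over a field are injective. Finally the Hopf algebra
structure is transported along the bijection. *)

(** * Linear maps and tensor products *)

(** No axiom of the double is ever verified on its twisted product. What shapes the proof is that B
    and B' are only subalgebras of U, generated inside it and without presentations of their own, so
    no map out of them can be defined on generators. Only U has a presentation; the left inverse is
    therefore obtained by evaluating an action of U. On B (x) B' the relations between operators of
    one factor hold because that factor is a subalgebra of U, and the pairing enters only in the
    relations that mix the two factors. The formula for the action of b is what the product of 1 (x)
    b and a (x) c in the double dictates. The algebra for sl_n is again a mere subalgebra, which is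
    why its injectivity comes from that for gl_n and not from an action of its own. The antipode is
    kept out of the cross relation so that both sides extend from generators by the coproduct alone;
    it is brought back once, by cancelling S(b_1) against b_2. *)

Definition Lin (K : fieldType) (V W : lmodType K) (f : V -> W) : Prop :=
  forall k u v, f (k *: u + v) = k *: f u + f v.

(** Forms with values in K are kept apart from [Lin] because their target is the field with its
    product, not a module with [*:]. *)
Definition Sca (K : fieldType) (V : lmodType K) (f : V -> K) : Prop :=
  forall k u v, f (k *: u + v) = k * f u + f v.

Definition Bil (K : fieldType) (V W M : lmodType K) (f : V -> W -> M) : Prop :=
  (forall v, Lin (f v)) /\ (forall w, Lin (f^~ w)).

Section LinTheory.
Variable K : fieldType.
Implicit Types V W M : lmodType K.

Section Basic.
Variables (V W : lmodType K) (f : V -> W).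
Hypothesis fL : Lin f.
Lemma lin0 : f 0 = 0.
Proof. by have := fL (-1) 0 0; rewrite scaler0 addr0 scaleN1r addNr. Qed.
Lemma linD u v : f (u + v) = f u + f v.
Proof. by have := fL 1 u v; rewrite !scale1r. Qed.
Lemma linZ k u : f (k *: u) = k *: f u.
Proof. by have := fL k u 0; rewrite !addr0 lin0 addr0. Qed.
Lemma linN u : f (- u) = - f u.
Proof. by rewrite -!scaleN1r linZ. Qed.
Lemma lin_suml (I : Type) (s : seq I) (F : I -> V) :
  f (\sum_(i <- s) F i) = \sum_(i <- s) f (F i).
Proof.
elim: s => [|i s IH]; first by rewrite !big_nil lin0.
by rewrite !big_cons linD IH.
Qed.
End Basic.

Section BasicS.
Variables (V : lmodType K) (f : V -> K).
Hypothesis fL : Sca f.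
Lemma sca0 : f 0 = 0.
Proof. by have := fL (-1) 0 0; rewrite scaler0 addr0 mulN1r addNr. Qed.
Lemma scaD u v : f (u + v) = f u + f v.
Proof. by have := fL 1 u v; rewrite scale1r mul1r. Qed.
Lemma scaZ k u : f (k *: u) = k * f u.
Proof. by have := fL k u 0; rewrite !addr0 sca0 addr0. Qed.
Lemma sca_suml (I : Type) (s : seq I) (F : I -> V) :
  f (\sum_(i <- s) F i) = \sum_(i <- s) f (F i).
Proof.
elim: s => [|i s IH]; first by rewrite !big_nil sca0.
by rewrite !big_cons scaD IH.
Qed.
End BasicS.

Lemma lin_id V : Lin (fun x : V => x). Proof. by []. Qed.
Lemma lin_cst0 V W : Lin (fun x : V => 0 : W).
Proof. by move=> k u v; rewrite scaler0 addr0. Qed.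
Lemma lin_add V W (f g : V -> W) : Lin f -> Lin g -> Lin (fun x => f x + g x).
Proof. by move=> fL gL k u v; rewrite fL gL scalerDr addrACA. Qed.
Lemma lin_opp V W (f : V -> W) : Lin f -> Lin (fun x => - f x).
Proof. by move=> fL k u v; rewrite fL opprD scalerN. Qed.
Lemma lin_scale V W k (f : V -> W) : Lin f -> Lin (fun x => k *: f x).
Proof. by move=> fL l u v; rewrite fL scalerDr !scalerA mulrC. Qed.
Lemma lin_scalel V W (f : V -> K) (w : W) : Sca f -> Lin (fun x => f x *: w).
Proof. by move=> fL l u v; rewrite fL scalerDl scalerA. Qed.
Lemma lin_sum V W (I : Type) (s : seq I) (F : I -> V -> W) :
  (forall i, Lin (F i)) -> Lin (fun x => \sum_(i <- s) F i x).
Proof.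
move=> FL k u v; rewrite scaler_sumr -big_split.
by apply: eq_bigr => i _; rewrite FL.
Qed.
Lemma lin_comp V W M (h : W -> M) (f : V -> W) :
  Lin h -> Lin f -> Lin (fun x => h (f x)).
Proof. by move=> hL fL k u v; rewrite fL hL. Qed.
Lemma bil_l V W M (op : V -> W -> M) V' (f : V' -> V) w :
  Bil op -> Lin f -> Lin (fun x => op (f x) w).
Proof. by move=> [_ hL] fL k u v; rewrite fL (hL w). Qed.
Lemma bil_r V W M (op : V -> W -> M) V' (f : V' -> W) v :
  Bil op -> Lin f -> Lin (fun x => op v (f x)).
Proof. by move=> [hL _] fL; apply: lin_comp. Qed.
Lemma sca_mull V k (f : V -> K) : Sca f -> Sca (fun x => f x * k).
Proof. by move=> fL l u v; rewrite fL mulrDl mulrA. Qed.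
Lemma sca_mulr V k (f : V -> K) : Sca f -> Sca (fun x => k * f x).
Proof. by move=> fL l u v; rewrite fL mulrDr mulrCA. Qed.
Lemma sca_comp V W (h : W -> K) (f : V -> W) :
  Sca h -> Lin f -> Sca (fun x => h (f x)).
Proof. by move=> hL fL k u v; rewrite fL hL. Qed.

Lemma bil_pure V W : Bil (@pure K V W).
Proof.
split=> [v k w w'|w k v v']; first by rewrite pureDr pureZr.
by rewrite pureDl pureZl.
Qed.

Lemma bil_mul (A : algType K) : Bil (@GRing.mul A).
Proof.
split=> [v k w w'|w k v v']; first by rewrite mulrDr scalerAr.
by rewrite mulrDl scalerAl.
Qed.

Lemma bil_balanced V W M (f : V -> W -> M) : Bil f -> balanced f.
Proof.
move=> [fr fl]; split=> [v v' w|v w w'|k v w].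
- exact: (linD (fl w)).
- exact: (linD (fr v)).
- by rewrite (linZ (fl w)) (linZ (fr v)).
Qed.

Lemma tens_lift_lin V W M (f : V -> W -> M) : Bil f -> Lin (tens_lift f).
Proof.
move=> fB k x y; have fb := bil_balanced fB.
rewrite [x]tens_sumE [y]tens_sumE scaler_sumr.
under eq_bigr => q _ do rewrite -pureZl.
rewrite -(big_map (fun q : V * W => (k *: q.1, q.2)) xpredT
  (fun q : V * W => q.1 ⊗ q.2)) -big_cat !tens_lift_sum //.
rewrite big_cat big_map scaler_sumr; congr (_ + _).
by apply: eq_bigr => q _ /=; rewrite (linZ (fB.2 _)).
Qed.

Lemma tens_ext V W M (f g : tensor V W -> M) : Lin f -> Lin g ->
  (forall v w, f (v ⊗ w) = g (v ⊗ w)) -> f =1 g.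
Proof.
move=> fL gL fg x; rewrite [x]tens_sumE (lin_suml fL) (lin_suml gL).
exact: eq_bigr.
Qed.

Lemma tens_lift_comp V W M M' (f : V -> W -> M) (h : M -> M') x : Lin h ->
  h (tens_lift f x) = tens_lift (fun v w => h (f v w)) x.
Proof. by move=> hL; rewrite (lin_suml hL). Qed.

Lemma eq_tens_lift V W (M : zmodType) (f g : V -> W -> M) x :
  (forall v w, f v w = g v w) -> tens_lift f x = tens_lift g x.
Proof. by move=> fg; apply: eq_bigr => q _; apply: fg. Qed.

Lemma tens_lift_id V W (x : tensor V W) : tens_lift (fun v w => v ⊗ w) x = x.
Proof. by rewrite [RHS]tens_sumE. Qed.

Lemma tens_mapE V V' W W' (f : V -> V') (g : W -> W') v w :
  Lin f -> Lin g -> tens_map f g (v ⊗ w) = f v ⊗ g w.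
Proof.
move=> fL gL; apply: tens_lift_pure; apply: bil_balanced; split=> [z|z].
  by apply: bil_r => //; apply: bil_pure.
by apply: bil_l => //; apply: bil_pure.
Qed.

Lemma tens_map_lin V V' W W' (f : V -> V') (g : W -> W') :
  Lin f -> Lin g -> Lin (tens_map f g).
Proof.
move=> fL gL; apply: tens_lift_lin; split=> [z|z].
  by apply: bil_r => //; apply: bil_pure.
by apply: bil_l => //; apply: bil_pure.
Qed.

End LinTheory.
#[local] Hint Resolve bil_pure bil_mul tens_map_lin : lin.

(* [match] and not [lazymatch]: a pattern variable can be instantiated with a
   context variable that has the name of the bound one, and the branch must then
   be abandoned. *)
Ltac lin :=
  cbv beta;
  match goal with
  | |- Bil _ => solve [auto with lin | split=> ?; lin]
  | |- Lin (fun x => x) => exact: lin_id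
  | |- Lin (fun x => 0) => exact: lin_cst0
  | |- Lin (fun x => @GRing.add _ (@?f x) (@?g x)) => apply: (@lin_add _ _ _ f g); lin
  | |- Lin (fun x => @GRing.opp _ (@?f x)) => apply: (@lin_opp _ _ _ f); lin
  | |- Lin (fun x => @GRing.scale _ _ ?k (@?f x)) => apply: (@lin_scale _ _ _ k f); lin
  | |- Lin (fun x => @GRing.scale _ _ (@?f x) ?w) => apply: (@lin_scalel _ _ _ f w); lin
  | |- Lin (fun x => @bigop.body _ _ _ _ _) => apply: lin_sum => ?; lin
  | |- Lin (fun x => @tens_map ?K ?V ?V' ?W ?W' ?f ?g (@?h x)) =>
      apply: (@lin_comp K _ _ _ (@tens_map K V V' W W' f g) h);
        [apply: tens_map_lin; lin | lin]
  | |- Lin (fun x => @tens_lift ?K ?V ?W ?M (@?B x) ?y) =>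
      unfold tens_lift; apply: lin_sum => ?; lin
  | |- Lin (fun x => @tens_lift ?K ?V ?W ?M ?B (@?h x)) =>
      apply: (@lin_comp K _ _ _ (@tens_lift K V W M B) h); [apply: tens_lift_lin; lin | lin]
  | |- Lin (fun x => @sweedler2 ?K ?H ?M (@?B x) ?y) =>
      unfold sweedler2, tens_lift; apply: lin_sum => ?; lin
  | |- Lin (fun x => @sweedler2 ?K ?H ?M ?B (@?h x)) =>
      unfold sweedler2; lin
  | |- Lin (fun x => ?op (@?f x) ?w) =>
      first [apply: (@bil_l _ _ _ _ op _ f w); [solve [auto with lin] | lin]
            | solve [auto with lin]]
  | |- Lin (fun x => ?op ?w (@?f x)) =>
      first [apply: (@bil_r _ _ _ _ op _ f w); [solve [auto with lin] | lin]
            | apply: (@lin_comp _ _ _ _ (op w) f); [solve [auto with lin] | lin]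
            | solve [auto with lin]]
  | |- Lin (fun x => ?h x) => solve [auto with lin]
  | |- Lin (fun x => ?h (@?f x)) =>
      first [apply: (@lin_comp _ _ _ _ h f); [solve [auto with lin] | lin]
            | solve [auto with lin]]
  | |- Sca (fun x => @GRing.mul _ (@?f x) ?k) => apply: (@sca_mull _ _ k f); lin
  | |- Sca (fun x => @GRing.mul _ ?k (@?f x)) => apply: (@sca_mulr _ _ k f); lin
  | |- Sca (fun x => ?p (@?f x) ?k) => 
      apply: (@sca_comp _ _ _ (fun z => p z k) f); [solve [auto with lin] | lin]
  | |- Sca (fun x => ?p (@?f x)) => apply: (@sca_comp _ _ _ p f); [solve [auto with lin] | lin]
  | |- Sca _ => solve [auto with lin]
  | |- Lin _ => solve [auto with lin]
  end.

(** A maximal subspace T of W that meets the image of f trivially is a complement of it, and g x is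
    the v with x - f v in T. Such retractions make tensor products of injective maps injective
    without choosing bases. *)
Lemma lin_section (K : fieldType) (V W : lmodType K) (f : V -> W) :
  Lin f -> injective f -> exists2 g : W -> V, Lin g & cancel f g.
Proof.
move=> fL fI.
pose disj (T : set W) := (forall k u v, T u -> T v -> T (k *: u + v)) /\
                         (forall v, T (f v) -> v = 0).
have [F Fd Ftot|T [dT Tmax]] := @Zorn_bigcup W disj.
  split=> [k u v [T FT Tu] [T' FT' T'v]|v [T FT Tv]]; last exact: (Fd T FT).2.
  have [TT'|T'T] := Ftot _ _ FT FT'.
    by exists T' => //; apply: (Fd T' FT').1 => //; apply: TT'.
  by exists T => //; apply: (Fd T FT).1 => //; apply: T'T.
case: (dT) => dTl dTf.
(* [disj] also admits the empty set, so that 0 belongs to T has to come from maximality: an empty T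
   would be properly contained in {0}. *)
have dT0 : T 0.
  have [[u Tu]|T0] := pselect (exists u, T u).
    by have := dTl (-1) u u Tu Tu; rewrite scaleN1r addNr.
  case: (Tmax [set 0]%classic).
    split=> [u Tu|T1]; first by case: T0; exists u.
    by case: T0; exists 0; apply: T1.
  split=> [k u v -> ->|v] /=; first by rewrite scaler0 addr0.
  by rewrite -(lin0 fL) => /fI.
have dTZ k u : T u -> T (k *: u).
  by move=> Tu; rewrite -[_ *: _]addr0; apply: dTl.
have dTD u v : T u -> T v -> T (u + v).
  by move=> Tu Tv; rewrite -[u]scale1r; apply: dTl.
have spl x : exists v : V, T (x - f v).
  have [//|nx] := pselect (exists v : V, T (x - f v)).
  (* [T'] is T + Kx. It still meets the image of f trivially: f v - k x in T with k nonzero would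
     put x - f(v/k) in T. *)
  pose T' : set W := [set y | exists k, T (y - k *: x)]%classic.
  have dT' : disj T'.
    split.
    + move=> k u v [l Tu] [m Tv]; exists (k * l + m).
      have -> : k *: u + v - (k * l + m) *: x = k *: (u - l *: x) + (v - m *: x).
        by rewrite scalerDl scalerBr scalerA opprD addrACA.
      exact: dTl.
    + move=> v [k Tk]; have [k0|kn0] := eqVneq k 0.
        by move: Tk; rewrite k0 scale0r subr0; apply: dTf.
      case: nx; exists (k^-1 *: v); rewrite (linZ fL).
      have -> : x - k^-1 *: f v = (- k^-1) *: (f v - k *: x).
        by rewrite scalerBr !scaleNr scalerA mulVf // scale1r opprK addrC.
      exact: dTZ.
  case: (Tmax T') => //; split=> [y Ty|T'T].
    by exists 0; rewrite scale0r subr0.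
  case: nx; exists 0; rewrite (lin0 fL) subr0; apply: T'T.
  by exists 1; rewrite scale1r subrr.
have [g gP] := choice spl; exists g => [k u v|v].
  apply: subr0_eq; apply: dTf.
  have -> : f (g (k *: u + v) - (k *: g u + g v)) =
      k *: (u - f (g u)) + (v - f (g v)) +
      (-1) *: (k *: u + v - f (g (k *: u + v))).
    rewrite (linD fL) (linN fL) fL scaleN1r opprB scalerBr [X in _ = X + _]addrACA -opprD.
    by rewrite [RHS]addrC addrA subrK.
  by apply: dTD; [apply: dTl|apply: dTZ].
by apply: subr0_eq; apply: dTf; rewrite (linD fL) (linN fL) -opprB -scaleN1r; apply: dTZ.
Qed.

(** * Sweedler calculus in a bialgebra *)

Local Notation "x ** y" := (bmul x y) (at level 40, left associativity).

Section Bialgebra.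
Variables (K : fieldType) (H : bialg_data K).

Lemma eq_sw2 (M : zmodType) (f g : H -> H -> M) x :
  (forall u v, f u v = g u v) -> sweedler2 f x = sweedler2 g x.
Proof. exact: eq_tens_lift. Qed.

Lemma sw2_comp (M M' : lmodType K) (f : H -> H -> M) (h : M -> M') x : Lin h ->
  h (sweedler2 f x) = sweedler2 (fun u v => h (f u v)) x.
Proof. exact: tens_lift_comp. Qed.

Lemma sw2_exch (H' : bialg_data K) (M : zmodType)
    (f : H -> H -> H' -> H' -> M) x y :
  sweedler2 (fun u v => sweedler2 (f u v) y) x =
  sweedler2 (fun w z => sweedler2 (fun u v => f u v w z) x) y.
Proof. exact: exchange_big. Qed.

Lemma sw2_scalel (M : lmodType K) (f : H -> H -> K) (w : M) x :
  sweedler2 f x *: w = sweedler2 (fun u v => f u v *: w) x.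
Proof. exact: scaler_suml. Qed.

Lemma sw2_scaler (M : lmodType K) (f : H -> H -> M) k x :
  k *: sweedler2 f x = sweedler2 (fun u v => k *: f u v) x.
Proof. exact: scaler_sumr. Qed.

Lemma sw2_sumE (M : zmodType) (f : H -> H -> M) x s : balanced f ->
  bcomul x = \sum_(q <- s) q.1 ⊗ q.2 ->
  sweedler2 f x = \sum_(q <- s) f q.1 q.2.
Proof. by rewrite /sweedler2 => fb ->; apply: tens_lift_sum. Qed.

Lemma sw2_pure (M : zmodType) (f : H -> H -> M) x y z : balanced f ->
  bcomul x = y ⊗ z -> sweedler2 f x = f y z.
Proof. by rewrite /sweedler2 => fb ->; apply: tens_lift_pure. Qed.

Lemma sw2_pure2 (M : lmodType K) (f : H -> H -> M) x y z y' z' : Bil f ->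
  bcomul x = y ⊗ z + y' ⊗ z' -> sweedler2 f x = f y z + f y' z'.
Proof.
rewrite /sweedler2 => fB ->; rewrite (linD (tens_lift_lin fB)).
by rewrite !tens_lift_pure //; apply: bil_balanced.
Qed.

Hypothesis HB : is_bialgebra H.

Lemma bil_bmul : Bil (@bmul K H).
Proof. by case: HB => -[h1 h2 _ _ _] _ _; split. Qed.
Lemma bmulA (x y z : H) : x ** (y ** z) = x ** y ** z.
Proof. by case: HB => -[_ _ h _ _] _ _; apply: h. Qed.
Lemma bmul1 (x : H) : bone H ** x = x.
Proof. by case: HB => -[_ _ _ h _] _ _; apply: h. Qed.
Lemma bmulr1 (x : H) : x ** bone H = x.
Proof. by case: HB => -[_ _ _ _ h] _ _; apply: h. Qed.
Lemma lin_bcomul : Lin (@bcomul K H).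
Proof. by case: HB => _ [h _ _ _ _] _; apply: h. Qed.
Lemma sca_bcounit : Sca (@bcounit K H).
Proof. by case: HB => _ [_ h _ _ _] _; apply: h. Qed.
Lemma bcomul1 : bcomul (bone H) = bone H ⊗ bone H.
Proof. by case: HB => _ _ []. Qed.
Lemma bcounit1 : bcounit (bone H) = 1.
Proof. by case: HB => _ _ []. Qed.
Lemma bcounitM (x y : H) : bcounit (x ** y) = bcounit x * bcounit y.
Proof. by case: HB => _ _ [_ _ h _]; apply: h. Qed.

#[local] Hint Resolve bil_bmul lin_bcomul sca_bcounit : lin.

Lemma lin_sw2 (M : lmodType K) (f : H -> H -> M) : Bil f -> Lin (sweedler2 f).
Proof. move=> fB; rewrite /sweedler2; exact: lin_comp (tens_lift_lin fB) lin_bcomul. Qed.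

Lemma sw2_mul (M : lmodType K) (f : H -> H -> M) x y : Bil f ->
  sweedler2 f (x ** y) = sweedler2 (fun x1 x2 =>
    sweedler2 (fun y1 y2 => f (x1 ** y1) (x2 ** y2)) y) x.
Proof.
move=> fB; have [_ _ [Dm _ _ _]] := HB.
rewrite {1}/sweedler2 Dm (sw2_comp _ _ (tens_lift_lin fB)); apply: eq_sw2 => u v.
rewrite (sw2_comp _ _ (tens_lift_lin fB)); apply: eq_sw2 => w z.
by apply: tens_lift_pure; apply: bil_balanced.
Qed.

Lemma sw2_coassoc (M : lmodType K) (f : H -> H -> H -> M) x :
  (forall v w, Lin (fun u => f u v w)) -> (forall u, Bil (f u)) ->
  sweedler2 (fun u v => sweedler2 (fun u1 u2 => f u1 u2 v) u) x =
  sweedler2 (fun u v => sweedler2 (fun v1 v2 => f u v1 v2) v) x.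
Proof.
move=> f1 f2; have [_ [_ _ co _ _] _] := HB.
have fB : Bil (fun u => tens_lift (f u)).
  by split=> [u|w]; [exact: tens_lift_lin|lin].
have TL := tens_lift_lin fB.
have := congr1 (tens_lift (fun u => tens_lift (f u))) (co x).
rewrite !(sw2_comp _ _ TL) => E.
transitivity (sweedler2 (fun u v => tens_lift (fun u => tens_lift (f u))
    (tens_lift (fun u1 u2 => u1 ⊗ (u2 ⊗ v)) (bcomul u))) x).
  apply: eq_sw2 => u v; rewrite (tens_lift_comp _ _ TL); apply: eq_tens_lift => u1 u2.
  rewrite (tens_lift_pure _ _ (bil_balanced fB)) tens_lift_pure //.
  exact: bil_balanced.
rewrite E; apply: eq_sw2 => u v.
by rewrite (tens_lift_pure _ _ (bil_balanced fB)).
Qed.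

Lemma sw2_counitl (M : lmodType K) (f : H -> M) x : Lin f ->
  sweedler2 (fun u v => bcounit u *: f v) x = f x.
Proof.
move=> fL; have [_ [_ _ _ h _] _] := HB.
rewrite -[x in RHS]h (sw2_comp _ _ fL); apply: eq_sw2 => u v.
by rewrite (linZ fL).
Qed.

Lemma sw2_counitr (M : lmodType K) (f : H -> M) x : Lin f ->
  sweedler2 (fun u v => bcounit v *: f u) x = f x.
Proof.
move=> fL; have [_ [_ _ _ _ h] _] := HB.
rewrite -[x in RHS]h (sw2_comp _ _ fL); apply: eq_sw2 => u v.
by rewrite (linZ fL).
Qed.

Section Antipode.
Variable S : H -> H.
Hypothesis HS : is_antipode S.

Lemma antip_lin : Lin S.
Proof. by case: HS. Qed.
#[local] Hint Resolve antip_lin : lin.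
Lemma antip_l (M : lmodType K) (f : H -> M) x : Lin f ->
  sweedler2 (fun u v => f (S u ** v)) x = bcounit x *: f (bone H).
Proof.
by move=> fL; have [_ h _] := HS; rewrite -(linZ fL) -h (sw2_comp _ _ fL).
Qed.
Lemma antip_r (M : lmodType K) (f : H -> M) x : Lin f ->
  sweedler2 (fun u v => f (u ** S v)) x = bcounit x *: f (bone H).
Proof.
by move=> fL; have [_ _ h] := HS; rewrite -(linZ fL) -h (sw2_comp _ _ fL).
Qed.

Lemma antip_group x y : bcomul x = x ⊗ x -> bcounit x = 1 -> x ** y = bone H ->
  S x = y.
Proof.
move=> Dx ex xy; have := antip_l x (@lin_id _ _).
rewrite (sw2_pure _ Dx); last by apply: bil_balanced; lin.
by rewrite ex scale1r => E; rewrite -[S x]bmulr1 -xy bmulA E bmul1.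
Qed.

Lemma antip1 : S (bone H) = bone H.
Proof. by apply: antip_group; [exact: bcomul1|exact: bcounit1|exact: bmul1]. Qed.

(* Both sides are convolution inverse to the multiplication of H (x) H -> H. *)
Lemma antipM x y : S (x ** y) = S y ** S x.
Proof.
(* [T] is S(x_1 y_1) x_2 y_2 S(y_3) S(x_3). Cancelling x_2 y_2 against S(y_3) S(x_3) leaves the left
   side; cancelling S(x_1 y_1) against x_2 y_2 leaves the right side. *)
pose T := sweedler2 (fun x1 x2 => sweedler2 (fun y1 y2 =>
  sweedler2 (fun x21 x22 => sweedler2 (fun y21 y22 =>
     S (x1 ** y1) ** (x21 ** y21 ** (S y22 ** S x22))) y2) x2) y) x.
transitivity T.
  transitivity (sweedler2 (fun x1 x2 => bcounit x2 *: sweedler2 (fun y1 y2 =>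
      bcounit y2 *: (S (x1 ** y1) ** bone H)) y) x).
    rewrite (sw2_counitr (f := fun x1 => sweedler2 (fun y1 y2 =>
      bcounit y2 *: (S (x1 ** y1) ** bone H)) y)); last by lin.
    rewrite (sw2_counitr (f := fun y1 => S (x ** y1) ** bone H)); last by lin.
    by rewrite bmulr1.
  apply: eq_sw2 => x1 x2; rewrite sw2_scaler; apply: eq_sw2 => y1 y2.
  rewrite -(antip_r (f := fun z => bcounit y2 *: (S (x1 ** y1) ** z))); last by lin.
  apply: eq_sw2 => x21 x22.
  rewrite -[x21 in LHS]bmulr1.
  rewrite -(antip_r (f := fun z => S (x1 ** y1) ** (x21 ** z ** S x22))); last by lin.
  by apply: eq_sw2 => y21 y22; rewrite !bmulA.
transitivity (sweedler2 (fun x1 x2 => bcounit x1 *: sweedler2 (fun y1 y2 =>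
      bcounit y1 *: (S y2 ** S x2)) y) x); last first.
  rewrite (sw2_counitl (f := fun x2 => sweedler2 (fun y1 y2 =>
      bcounit y1 *: (S y2 ** S x2)) y)); last by lin.
  by rewrite (sw2_counitl (f := fun y2 => S y2 ** S x)); last by lin.
rewrite /T.
transitivity (sweedler2 (fun x1 x2 => sweedler2 (fun x21 x22 =>
    sweedler2 (fun y1 y2 => sweedler2 (fun y21 y22 =>
     S (x1 ** y1) ** (x21 ** y21 ** (S y22 ** S x22))) y2) y) x2) x).
  by apply: eq_sw2 => x1 x2; rewrite sw2_exch.
rewrite -sw2_coassoc; [|by move=> *; lin|by move=> *; lin].
apply: eq_sw2 => x1 x2.
transitivity (sweedler2 (fun y1 y2 => sweedler2 (fun x11 x12 =>
    sweedler2 (fun y11 y12 => S (x11 ** y11) ** (x12 ** y12 ** (S y2 ** S x2))) y1) x1) y).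
  rewrite [RHS]sw2_exch; apply: eq_sw2 => x11 x12.
  by rewrite -sw2_coassoc //; move=> *; lin.
rewrite sw2_scaler; apply: eq_sw2 => y1 y2.
rewrite -(sw2_mul (f := fun u v => S u ** (v ** (S y2 ** S x2)))); last by lin.
under eq_sw2 => u v do rewrite bmulA.
rewrite (antip_l (f := fun z => z ** (S y2 ** S x2))); last by lin.
by rewrite bmul1 bcounitM scalerA.
Qed.

End Antipode.

(** The sum of S(x_1) x_2 S'(x_3) collapses to S(x) or to S'(x), depending on which two factors are
    cancelled. *)
Lemma antip_uniq (S S' : H -> H) : is_antipode S -> is_antipode S' -> S =1 S'.
Proof.
move=> HS HS' x; have SL := antip_lin HS; have SL' := antip_lin HS'.
have h1 := sw2_counitr x SL; have h2 := sw2_counitl x SL'.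
rewrite -h1 -h2.
transitivity (sweedler2 (fun u v => sweedler2 (fun v1 v2 => S u ** (v1 ** S' v2)) v) x).
  apply: eq_sw2 => u v; rewrite (antip_r HS' (f := fun z => S u ** z)); last by lin.
  by rewrite bmulr1.
rewrite -sw2_coassoc; [|by move=> *; lin|by move=> *; lin].
apply: eq_sw2 => u v; under eq_sw2 => u1 u2 do rewrite bmulA.
rewrite (antip_l HS (f := fun z => z ** S' v)); last by lin.
by rewrite bmul1.
Qed.

Lemma antipodeP : (exists S : H -> H, is_antipode S) -> is_antipode (@antipode K H).
Proof.
by move=> [S HS]; rewrite /antipode; case: xgetP => [T _ //|/(_ S)].
Qed.

Lemma antipodeE (S : H -> H) : is_antipode S -> @antipode K H = S.
Proof.
move=> HS; apply/funext; apply: antip_uniq => //; apply: antipodeP.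
by exists S.
Qed.

End Bialgebra.

#[local] Hint Resolve bil_bmul lin_bcomul sca_bcounit antip_lin : lin.

(** * Hopf pairings and the multiplication map of a double *)

Section Pairing.
Variables (K : fieldType) (H Hc : bialg_data K).
Hypotheses (HB : is_bialgebra H) (HcB : is_bialgebra Hc).
Variable p : Hc -> H -> K.
Hypothesis Hp : @is_hopf_pairing K (coop Hc) H p.

Lemma pair_scal b : Sca (p b). Proof. by case: Hp => -[h _] _ _ _ _; apply: h. Qed.
Lemma pair_scar a : Sca (p^~ a). Proof. by case: Hp => -[_ h] _ _ _ _; apply: h. Qed.
#[local] Hint Resolve pair_scal pair_scar : lin.
Lemma pair1 a : p (bone Hc) a = bcounit a. Proof. by case: Hp => _ h _ _ _; apply: h. Qed.
Lemma pairr1 b : p b (bone H) = bcounit b. Proof. by case: Hp => _ _ h _ _; apply: h. Qed.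
Lemma pairM b b' a : p (b ** b') a = sweedler2 (fun u v => p b u * p b' v) a.
Proof. by case: Hp => _ _ _ _ h; apply: h. Qed.
(** The factors of b come in reverse order because the pairing refers to the coproduct of [coop Hc],
    while the Sweedler sum is taken in [Hc]. The same reversal appears in [hitl_mul] and
    [hitr_mul]. *)
Lemma pairrM b a a' : p b (a ** a') = sweedler2 (fun u v => p v a * p u a') b.
Proof.
case: Hp => _ _ _ h _; rewrite (h b a a') {h} /sweedler2 /= /tens_flip.
rewrite [bcomul b]tens_sumE.
rewrite (lin_suml (tens_lift_lin _)); last by split=> z; lin.
rewrite (eq_bigr (fun q : Hc * Hc => q.2 ⊗ q.1)) => [|q _]; last first.
  by rewrite tens_lift_pure //; apply: bil_balanced; split=> z; lin.
have fb (g : Hc -> Hc -> K) : (forall u, Sca (g u)) -> (forall u, Sca (g^~ u)) -> balanced g.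
  move=> g1 g2; split=> [v v' w|v w w'|k v w]; first exact: (scaD (g2 w)).
    exact: (scaD (g1 v)).
  by rewrite (scaZ (g2 w)) (scaZ (g1 v)).
rewrite -(big_map (fun q : Hc * Hc => (q.2, q.1)) xpredT (fun q : Hc * Hc => q.1 ⊗ q.2)).
rewrite !tens_lift_sum; first by rewrite big_map.
  by apply: fb => u; lin.
by apply: fb => u; lin.
Qed.

(* The left and right actions of Hc on H by transposed multiplication. *)
Definition hitl (b : Hc) (a : H) : H := sweedler2 (fun u v => p b v *: u) a.
Definition hitr (b : Hc) (a : H) : H := sweedler2 (fun u v => p b u *: v) a.

Lemma bil_hitl : Bil hitl.
Proof.
split=> [b|a]; rewrite /hitl; last by lin.
by apply: lin_sw2 => //; split=> v; lin.
Qed.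
Lemma bil_hitr : Bil hitr.
Proof.
split=> [b|a]; rewrite /hitr; last by lin.
by apply: lin_sw2 => //; split=> v; lin.
Qed.
#[local] Hint Resolve bil_hitl bil_hitr : lin.

Lemma hitl1 a : hitl (bone Hc) a = a.
Proof.
rewrite /hitl -[RHS](sw2_counitr HB a (@lin_id _ _)).
by apply: eq_sw2 => u v; rewrite pair1.
Qed.
Lemma hitr1 a : hitr (bone Hc) a = a.
Proof.
rewrite /hitr -[RHS](sw2_counitl HB a (@lin_id _ _)).
by apply: eq_sw2 => u v; rewrite pair1.
Qed.

Lemma hitlM b b' a : hitl (b ** b') a = hitl b (hitl b' a).
Proof.
rewrite {3}/hitl (sw2_comp _ _ (bil_hitl.1 b)) {1}/hitl.
under eq_sw2 => u v do rewrite pairM sw2_scalel.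
rewrite -(sw2_coassoc HB (f := fun u v1 v2 => (p b v1 * p b' v2) *: u)).
- apply: eq_sw2 => u v; rewrite (linZ (bil_hitl.1 b)) sw2_scaler.
  by apply: eq_sw2 => u1 u2; rewrite scalerA mulrC.
- by move=> *; lin.
- by move=> *; lin.
Qed.

Lemma hitrM b b' a : hitr (b ** b') a = hitr b' (hitr b a).
Proof.
rewrite {3}/hitr (sw2_comp _ _ (bil_hitr.1 b')) {1}/hitr.
under eq_sw2 => u v do rewrite pairM sw2_scalel.
rewrite (sw2_coassoc HB (f := fun u1 u2 v => (p b u1 * p b' u2) *: v)).
- apply: eq_sw2 => u v; rewrite (linZ (bil_hitr.1 b')) sw2_scaler; apply: eq_sw2 => v1 v2.
  by rewrite scalerA.
- by move=> *; lin.
- by move=> *; lin.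
Qed.

Lemma hitlr b b' a : hitl b (hitr b' a) = hitr b' (hitl b a).
Proof.
rewrite [hitr b' a]/hitr [hitl b a]/hitl (sw2_comp _ _ (bil_hitl.1 b)).
rewrite (sw2_comp _ _ (bil_hitr.1 b')).
transitivity (sweedler2 (fun u v => sweedler2 (fun v1 v2 =>
    (p b' u * p b v2) *: v1) v) a).
  apply: eq_sw2 => u v; rewrite (linZ (bil_hitl.1 b)) sw2_scaler.
  by apply: eq_sw2 => v1 v2; rewrite scalerA.
rewrite -sw2_coassoc //; [|by move=> *; lin|by move=> *; lin].
apply: eq_sw2 => u v; rewrite (linZ (bil_hitr.1 b')) sw2_scaler.
by apply: eq_sw2 => v1 v2; rewrite scalerA mulrC.
Qed.

Lemma hitl_one b : hitl b (bone H) = bcounit b *: bone H.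
Proof.
rewrite /hitl (sw2_pure _ (bcomul1 HB)) ?pairr1 //.
by apply: bil_balanced; lin.
Qed.
Lemma hitr_one b : hitr b (bone H) = bcounit b *: bone H.
Proof.
rewrite /hitr (sw2_pure _ (bcomul1 HB)) ?pairr1 //.
by apply: bil_balanced; lin.
Qed.

Lemma hitl_mul b a a' :
  hitl b (a ** a') = sweedler2 (fun u v => hitl v a ** hitl u a') b.
Proof.
rewrite /hitl sw2_mul //; last by lin.
have bm := bil_bmul HB.
under [RHS]eq_sw2 => b1 b2.
  rewrite (sw2_comp _ _ (bm.2 _)).
  under eq_sw2 => u v do rewrite (linZ (bm.2 _)) (sw2_comp _ _ (bm.1 _)) sw2_scaler.
  over.
rewrite [RHS]sw2_exch; apply: eq_sw2 => a1 a2.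
rewrite [RHS]sw2_exch; apply: eq_sw2 => a1' a2'.
rewrite pairrM sw2_scalel; apply: eq_sw2 => u v.
by rewrite (linZ (bm.1 _)) scalerA.
Qed.

Lemma hitr_mul b a a' :
  hitr b (a ** a') = sweedler2 (fun u v => hitr v a ** hitr u a') b.
Proof.
rewrite /hitr sw2_mul //; last by lin.
have bm := bil_bmul HB.
under [RHS]eq_sw2 => b1 b2.
  rewrite (sw2_comp _ _ (bm.2 _)).
  under eq_sw2 => u v do rewrite (linZ (bm.2 _)) (sw2_comp _ _ (bm.1 _)) sw2_scaler.
  over.
rewrite [RHS]sw2_exch; apply: eq_sw2 => a1 a2.
rewrite [RHS]sw2_exch; apply: eq_sw2 => a1' a2'.
rewrite pairrM sw2_scalel; apply: eq_sw2 => u v.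
by rewrite (linZ (bm.1 _)) scalerA.
Qed.

Section Embedding.
Variables (U : bialg_data K) (UB : is_bialgebra U) (i : H -> U) (j : Hc -> U).
Hypotheses (iL : Lin i) (jL : Lin j).
Hypotheses (iM : forall x y, i (x ** y) = i x ** i y)
           (jM : forall x y, j (x ** y) = j x ** j y).
#[local] Hint Resolve iL jL : lin.

(* An antipode-free form of the cross relation of the double. *)
Definition cross (b : Hc) (a : H) :=
  sweedler2 (fun b1 b2 => j b2 ** i (hitr b1 a)) b =
  sweedler2 (fun b1 b2 => i (hitl b2 a) ** j b1) b.

(** First b' is moved past [hitr p b1 a]; then, the left and right actions commuting, the relation
    for b applies at [hitl p b2' a]. Since both arguments are shifted, each relation is required for
    every a. *)
Lemma crossM b b' : (forall a, cross b a) -> (forall a, cross b' a) ->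
  forall a, cross (b ** b') a.
Proof.
move=> cb cb' a; rewrite /cross !sw2_mul //; [|by lin|by lin].
have bm := bil_bmul UB.
transitivity (sweedler2 (fun b1 b2 => sweedler2 (fun b1' b2' =>
    j b2 ** (i (hitl b2' (hitr b1 a)) ** j b1')) b') b).
  apply: eq_sw2 => b1 b2.
  rewrite -(sw2_comp (fun b1' b2' => i (hitl b2' (hitr b1 a)) ** j b1') _ (bm.1 (j b2))).
  rewrite -cb' (sw2_comp _ _ (bm.1 _)); apply: eq_sw2 => b1' b2'.
  by rewrite jM hitrM bmulA.
rewrite sw2_exch [RHS]sw2_exch; apply: eq_sw2 => b1' b2'.
transitivity (sweedler2 (fun b1 b2 => j b2 ** i (hitr b1 (hitl b2' a))) b ** j b1').
  rewrite (sw2_comp _ _ (bm.2 _)); apply: eq_sw2 => b1 b2.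
  by rewrite hitlr bmulA.
rewrite cb (sw2_comp _ _ (bm.2 _)); apply: eq_sw2 => b1 b2.
by rewrite jM hitlM bmulA.
Qed.

Lemma cross_lin k b b' a : cross b a -> cross b' a -> cross (k *: b + b') a.
Proof.
rewrite /cross => cb cb'.
have L1 : Lin (sweedler2 (fun b1 b2 => j b2 ** i (hitr b1 a))).
  by apply: lin_sw2 => //; lin.
have L2 : Lin (sweedler2 (fun b1 b2 => i (hitl b2 a) ** j b1)).
  by apply: lin_sw2 => //; lin.
by rewrite (L1 k b b') (L2 k b b') cb cb'.
Qed.

Lemma cross_lin2 k a a' b : cross b a -> cross b a' -> cross b (k *: a + a').
Proof.
rewrite /cross => ca ca'.
have L1 : Lin (fun a => sweedler2 (fun b1 b2 => j b2 ** i (hitr b1 a)) b) by lin.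
have L2 : Lin (fun a => sweedler2 (fun b1 b2 => i (hitl b2 a) ** j b1) b) by lin.
by rewrite (L1 k a a') (L2 k a a') ca ca'.
Qed.

Definition dmap : tensor H Hc -> U := tens_lift (fun a b => i a ** j b).

Lemma bil_dmap : Bil (fun a b => i a ** j b). Proof. by lin. Qed.
Lemma dmap_lin : Lin dmap.
Proof. exact: tens_lift_lin bil_dmap. Qed.
Lemma dmapE a b : dmap (a ⊗ b) = i a ** j b.
Proof. by apply: tens_lift_pure; apply: bil_balanced bil_dmap. Qed.

Hypothesis Hcr : forall b a, cross b a.
Hypothesis HcS : exists S : Hc -> Hc, is_antipode S.

(** The antipode-free relation, applied to the last two factors of b at [hitr p (antipode b1) a],
    brings the antipode next to b_2 inside one right action, where S(b_1) b_2 collapses to the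
    counit. *)
Lemma dmap_cross b a :
  sweedler3 (fun b1 b2 b3 => sweedler3 (fun a1 a2 a3 =>
      (p (antipode b1) a1 * p b3 a3) *: (i a2 ** j b2)) a) b = j b ** i a.
Proof.
have SP := antipodeP HcS; have SL := antip_lin SP; have bm := bil_bmul UB.
transitivity (sweedler2 (fun b1 y => sweedler2 (fun b2 b3 =>
    i (hitl b3 (hitr (antipode b1) a)) ** j b2) y) b).
  apply: eq_sw2 => b1 y; apply: eq_sw2 => b2 b3.
  rewrite [in RHS]/hitr (sw2_comp _ _ (bil_hitl.1 b3)) (sw2_comp _ _ iL) (sw2_comp _ _ (bm.2 _)).
  apply: eq_sw2 => a1 y'.
  rewrite (linZ (bil_hitl.1 _)) (linZ iL) (linZ (bm.2 _)).
  rewrite [in RHS]/hitl (sw2_comp _ _ iL) (sw2_comp _ _ (bm.2 _)) sw2_scaler.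
  apply: eq_sw2 => a2 a3.
  by rewrite (linZ iL) (linZ (bm.2 _)) scalerA.
transitivity (sweedler2 (fun b1 y => sweedler2 (fun b2 b3 =>
    j b3 ** i (hitr (antipode b1 ** b2) a)) y) b).
  apply: eq_sw2 => b1 y; rewrite -Hcr; apply: eq_sw2 => b2 b3.
  by rewrite hitrM.
rewrite -sw2_coassoc //; [|by move=> *; lin|by move=> *; lin].
transitivity (sweedler2 (fun u v => bcounit u *: (j v ** i a)) b).
  apply: eq_sw2 => u v.
  rewrite (antip_l SP (f := fun z => j v ** i (hitr z a))); last by lin.
  by rewrite hitr1.
by rewrite (sw2_counitl HcB (f := fun v => j v ** i a)); last by lin.
Qed.

Lemma dmapM x y : dmap (double_mul p x y) = dmap x ** dmap y.
Proof.
have bm := bil_bmul UB.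
rewrite /double_mul (tens_lift_comp _ _ dmap_lin).
rewrite [in RHS]/dmap (tens_lift_comp _ x (bm.2 _)); apply: eq_tens_lift => a b.
rewrite (tens_lift_comp _ _ dmap_lin) (tens_lift_comp _ y (bm.1 _)).
apply: eq_tens_lift => a' b'.
rewrite [RHS]bmulA // -[_ ** i a']bmulA // -dmap_cross.
rewrite (sw2_comp _ _ dmap_lin) (sw2_comp _ _ (bm.1 _)) (sw2_comp _ _ (bm.2 _)).
apply: eq_sw2 => b1 y1.
rewrite (sw2_comp _ _ dmap_lin) (sw2_comp _ _ (bm.1 _)) (sw2_comp _ _ (bm.2 _)).
apply: eq_sw2 => b2 b3.
rewrite (sw2_comp _ _ dmap_lin) (sw2_comp _ _ (bm.1 _)) (sw2_comp _ _ (bm.2 _)).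
apply: eq_sw2 => a1 x1.
rewrite (sw2_comp _ _ dmap_lin) (sw2_comp _ _ (bm.1 _)) (sw2_comp _ _ (bm.2 _)).
apply: eq_sw2 => a2 a3.
rewrite (linZ dmap_lin) (linZ (bm.1 _)) (linZ (bm.2 _)) dmapE iM jM.
by rewrite !bmulA.
Qed.

Hypotheses (i1 : i (bone H) = bone U) (j1 : j (bone Hc) = bone U).
Hypotheses (iD : forall x, bcomul (i x) = tens_map i i (bcomul x))
           (jD : forall x, bcomul (j x) = tens_map j j (bcomul x)).
Hypotheses (ie : forall x, bcounit (i x) = bcounit x)
           (je : forall x, bcounit (j x) = bcounit x).

Lemma dmap1 : dmap (bone H ⊗ bone Hc) = bone U.
Proof. by rewrite dmapE i1 j1 bmul1. Qed.

Lemma dmap_comul x : bcomul (dmap x) = tens_map dmap dmap (double_comul x).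
Proof.
have dL := dmap_lin; have TL := tens_map_lin dL dL; have [_ _ [Dm _ _ _]] := UB.
rewrite /dmap (tens_lift_comp _ _ (lin_bcomul UB)) /double_comul (tens_lift_comp _ _ TL).
apply: eq_tens_lift => a b; rewrite Dm (sw2_comp _ _ TL).
have sm (h : bialg_data K) (f : h -> U) z (M : lmodType K) (g : U -> U -> M) : Lin f -> Bil g ->
   bcomul (f z) = tens_map f f (bcomul z) ->
   sweedler2 g (f z) = sweedler2 (fun u v => g (f u) (f v)) z.
  move=> fL gB fD; rewrite /sweedler2 fD /tens_map.
  rewrite (tens_lift_comp _ _ (tens_lift_lin gB)); apply: eq_tens_lift => u v.
  by apply: tens_lift_pure; apply: bil_balanced.
rewrite (sm _ i) //; last by lin.
apply: eq_sw2 => a1 a2; rewrite (sm _ j) //; last by lin.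
by rewrite (sw2_comp _ _ TL); apply: eq_sw2 => b1 b2; rewrite tens_mapE // !dmapE.
Qed.

Lemma dmap_counit x :
  bcounit (dmap x) = tens_lift (fun a b => bcounit a * bcounit b) x.
Proof.
rewrite /dmap [LHS](sca_suml (sca_bcounit UB)); apply: eq_bigr => q _.
by rewrite bcounitM // ie je.
Qed.

End Embedding.
End Pairing.

#[local] Hint Resolve pair_scal pair_scar bil_hitl bil_hitr : lin.

(** * The action of a double on itself *)

Lemma antip_counit (K : fieldType) (H : bialg_data K) (HB : is_bialgebra H)
  (S : H -> H) x : is_antipode S -> bcounit (S x) = bcounit x.
Proof.
move=> HS; have SL := antip_lin HS.
have E := sw2_counitr HB x SL; rewrite -[in LHS]E.
have := antip_l HS x (@lin_id _ _) => /(congr1 (@bcounit K H)).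
rewrite (scaZ (sca_bcounit HB)) bcounit1 // mulr1 => <-.
rewrite !(sca_suml (sca_bcounit HB)); apply: eq_bigr => q _.
by rewrite (scaZ (sca_bcounit HB)) bcounitM // mulrC.
Qed.

Section DoubleModule.
Variables (K : fieldType) (H Hc : bialg_data K).
Hypotheses (HB : is_bialgebra H) (HcB : is_bialgebra Hc).
Variable p : Hc -> H -> K.
Hypothesis Hp : @is_hopf_pairing K (coop Hc) H p.
Variable S : Hc -> Hc.
Hypothesis HS : is_antipode S.

Local Notation V := (tensor H Hc).

(** Expanding the two actions gives (S(b_1), a_1) (b_3, a_3) a_2 (x) b_2 c, which is the product of
    1 (x) b and a (x) c prescribed by [double_mul]. *)
Definition lop_pure (b : Hc) (a : H) (c : Hc) : V :=
  sweedler2 (fun b1 y => sweedler2 (fun b2 b3 =>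
    hitl p b3 (hitr p (S b1) a) ⊗ (b2 ** c)) y) b.

(* The action of 1 ⊗ b on the double by left multiplication. *)
Definition lop (b : Hc) : V -> V := tens_lift (lop_pure b).

Lemma bil_lop_pure b : Bil (lop_pure b).
Proof. by rewrite /lop_pure; split=> z; lin. Qed.
Lemma lop_lin b : Lin (lop b).
Proof. exact: tens_lift_lin (bil_lop_pure b). Qed.
Lemma lopE b a c : lop b (a ⊗ c) = lop_pure b a c.
Proof. by apply: tens_lift_pure; apply: bil_balanced (bil_lop_pure b). Qed.
Lemma lop_linl v : Lin (lop^~ v).
Proof. rewrite /lop /lop_pure; lin. Qed.
Lemma bil_lop : Bil lop.
Proof. by split; [exact: lop_lin|exact: lop_linl]. Qed.
#[local] Hint Resolve bil_lop lop_lin : lin.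
Let bmL x : Lin (fun y : H => y ** x) := (bil_bmul HB).2 x.
Let hlL b : Lin (hitl p b) := (bil_hitl HB Hp).1 b.
Let hrL b : Lin (hitr p b) := (bil_hitr HB Hp).1 b.

(** [S] reverses products and [hitr] is a right action, so [hitr p (S b)] is a left action in b; it
    commutes with [hitl], and the outer and inner factors of b can be regrouped. *)
Lemma lopM b b' v : lop (b ** b') v = lop b (lop b' v).
Proof.
move: v; apply: tens_ext; [by lin|by lin|] => a c.
rewrite !lopE [in RHS]/lop_pure (sw2_comp _ _ (lop_lin b)).
rewrite /lop_pure sw2_mul //; last by lin.
rewrite sw2_exch; apply: eq_sw2 => b1' y'.
transitivity (sweedler2 (fun b1 y => sweedler2 (fun b2' b3' => sweedler2 (fun b2 b3 =>
    hitl p b3 (hitr p (S b1) (hitl p b3' (hitr p (S b1') a))) ⊗ (b2 ** (b2' ** c))) y) y') b).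
  apply: eq_sw2 => b1 y; rewrite sw2_mul //; last by lin.
  rewrite sw2_exch; apply: eq_sw2 => b2' b3'; apply: eq_sw2 => b2 b3.
  rewrite (antipM HcB HS) (hitlM HB Hp) (hitrM HB Hp) (hitlr HB Hp) bmulA //.
rewrite sw2_exch (sw2_comp _ _ (lop_lin b)).
by apply: eq_sw2 => b2' b3'; rewrite lopE.
Qed.

Lemma lop1 v : lop (bone Hc) v = v.
Proof.
move: v; apply: tens_ext; [by lin|by lin|] => a c.
rewrite lopE /lop_pure (sw2_pure _ (bcomul1 HcB)); last by apply: bil_balanced; lin.
rewrite (sw2_pure _ (bcomul1 HcB)); last by apply: bil_balanced; lin.
by rewrite (antip1 HcB HS) (hitl1 HB Hp) (hitr1 HB Hp) bmul1.
Qed.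

(** On the unit both transposed actions reduce to the counit. This is what makes evaluation at 1 (x)
    1 recover the second tensor factor. *)
Lemma lop_one b : lop b (bone H ⊗ bone Hc) = bone H ⊗ b.
Proof.
rewrite lopE /lop_pure.
transitivity (sweedler2 (fun b1 y => bcounit b1 *:
   sweedler2 (fun b2 b3 => bcounit b3 *: (bone H ⊗ b2)) y) b).
  apply: eq_sw2 => b1 y; rewrite sw2_scaler; apply: eq_sw2 => b2 b3.
  rewrite (hitr_one HB Hp) (linZ ((bil_hitl HB Hp).1 _)) (hitl_one HB Hp) bmulr1 //.
  by rewrite (antip_counit HcB _ HS) !pureZl.
rewrite (sw2_counitl HcB (f := fun y => sweedler2 (fun b2 b3 => bcounit b3 *: (bone H ⊗ b2)) y)).
  by rewrite (sw2_counitr HcB (f := fun b2 => bone H ⊗ b2)) //; lin.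
by apply: lin_sw2 => //; lin.
Qed.

Definition lmulT (g : H) : V -> V := tens_map (fun a => g ** a) id.
Lemma lmulT_lin g : Lin (lmulT g).
Proof. by rewrite /lmulT; apply: tens_map_lin; lin. Qed.
Lemma lmulTE g a c : lmulT g (a ⊗ c) = (g ** a) ⊗ c.
Proof. by rewrite /lmulT tens_mapE //; lin. Qed.
Lemma lmulT_linl v : Lin (lmulT^~ v).
Proof. rewrite /lmulT /tens_map; lin. Qed.
Lemma bil_lmulT : Bil lmulT.
Proof. by split; [exact: lmulT_lin|exact: lmulT_linl]. Qed.
#[local] Hint Resolve bil_lmulT lmulT_lin : lin.
Lemma lmulTM g g' v : lmulT (g ** g') v = lmulT g (lmulT g' v).
Proof.
by move: v; apply: tens_ext; [lin|lin|] => a c; rewrite !lmulTE bmulA.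
Qed.
Lemma lmulT1 v : lmulT (bone H) v = v.
Proof.
by move: v; apply: tens_ext; [lin|lin|] => a c; rewrite !lmulTE bmul1.
Qed.

Definition grouplike (B : bialg_data K) (g : B) := bcomul g = g ⊗ g /\ bcounit g = 1.

Lemma hitl_group b g : grouplike g -> hitl p b g = p b g *: g.
Proof.
by move=> [Dg _]; rewrite /hitl (sw2_pure _ Dg) //; apply: bil_balanced; lin.
Qed.
Lemma hitr_group b g : grouplike g -> hitr p b g = p b g *: g.
Proof.
by move=> [Dg _]; rewrite /hitr (sw2_pure _ Dg) //; apply: bil_balanced; lin.
Qed.

Section GroupLike.
Variable c c' : Hc.
Hypotheses (cG : grouplike c) (cG' : grouplike c').
Hypotheses (cc' : c ** c' = bone Hc).

Lemma hitl_grouplM a a' : hitl p c (a ** a') = hitl p c a ** hitl p c a'.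
Proof.
by case: cG => D _; rewrite (hitl_mul HB Hp) (sw2_pure _ D) //; apply: bil_balanced; lin.
Qed.
Lemma hitr_grouplM a a' : hitr p c (a ** a') = hitr p c a ** hitr p c a'.
Proof.
by case: cG => D _; rewrite (hitr_mul HB Hp) (sw2_pure _ D) //; apply: bil_balanced; lin.
Qed.

Lemma lop_group a d : lop c (a ⊗ d) = hitl p c (hitr p c' a) ⊗ (c ** d).
Proof.
case: (cG) => D e.
rewrite lopE /lop_pure (sw2_pure _ D); last by apply: bil_balanced; lin.
rewrite (sw2_pure _ D); last by apply: bil_balanced; lin.
by rewrite (antip_group HcB HS D e cc').
Qed.
End GroupLike.

Section GroupLike2.
Variable c c' : Hc.
Hypotheses (cG : grouplike c) (cG' : grouplike c').
Hypotheses (cc' : c ** c' = bone Hc).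

Lemma pair_groupV g : grouplike g -> p c g * p c' g = 1.
Proof.
move=> [Dg eg]; rewrite -eg -(pair1 Hp) -cc' (pairM Hp) /sweedler2 Dg tens_lift_pure //.
split=> [u v w|u v w|k u v].
- by rewrite (scaD (pair_scal Hp c)) mulrDl.
- by rewrite (scaD (pair_scal Hp c')) mulrDr.
- by rewrite (scaZ (pair_scal Hp c)) (scaZ (pair_scal Hp c')) mulrCA mulrA.
Qed.

(** The left action of c multiplies g by (c, g) and the right action of S(c) = c' multiplies it by
    (c', g); the two scalars are inverse to each other. *)
Lemma lop_group_group g v : grouplike g ->
  lop c (lmulT g v) = lmulT g (lop c v).
Proof.
move=> gG; move: v; apply: tens_ext; [by lin|by lin|] => a d.
rewrite lmulTE !(lop_group cG cc') lmulTE (hitr_grouplM cG') (hitl_grouplM cG).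
rewrite hitr_group // (linZ ((bil_hitl HB Hp).1 _)) hitl_group // scalerA mulrC.
by rewrite pair_groupV // scale1r.
Qed.

(** Of the coproduct of e, the left action of c keeps only e (x) 1, with coefficient 1, and the
    right action of c' only h (x) e, with coefficient (c', h). *)
Lemma lop_group_prim e h v : bcomul e = e ⊗ bone H + h ⊗ e ->
  p c e = 0 -> p c' e = 0 ->
  lop c (lmulT e v) = p c' h *: lmulT e (lop c v).
Proof.
move=> De ce ce'; move: v; apply: tens_ext; [by lin|by lin|] => a d.
rewrite lmulTE !(lop_group cG cc') lmulTE (hitr_grouplM cG') (hitl_grouplM cG).
rewrite [hitr p c' e]/hitr (sw2_pure2 _ De); last by lin.
rewrite ce' scale0r add0r (linZ ((bil_hitl HB Hp).1 _)).
rewrite [hitl p c e]/hitl (sw2_pure2 _ De); last by lin.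
rewrite ce scale0r addr0 (pairr1 Hp) (proj2 cG) scale1r.
by rewrite (linZ ((bil_bmul HB).2 _)) pureZl.
Qed.
End GroupLike2.

Section Skew.
Variables (f w w' : Hc).
Hypotheses (wG : grouplike w) (wG' : grouplike w') (ww' : w ** w' = bone Hc).
Hypotheses (Df : bcomul f = bone Hc ⊗ f + f ⊗ w) (ef : bcounit f = 0).

Lemma antip_skew : S f = - (f ** w').
Proof.
have SL := antip_lin HS; have := antip_l HS f (@lin_id _ _).
rewrite ef scale0r (sw2_pure2 _ Df); last by lin.
rewrite (antip1 HcB HS) bmul1 // => /eqP; rewrite addr_eq0 => /eqP E.
by rewrite [X in X ** w']E (linN ((bil_bmul HcB).2 _)) -bmulA // ww' bmulr1 // opprK.
Qed.

Lemma hitl_skewM a a' : hitl p f (a ** a') = hitl p f a ** a' + hitl p w a ** hitl p f a'.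
Proof.
rewrite (hitl_mul HB Hp) (sw2_pure2 _ Df); last by lin.
by rewrite (hitl1 HB Hp).
Qed.
Lemma hitr_skewM a a' : hitr p f (a ** a') = hitr p f a ** a' + hitr p w a ** hitr p f a'.
Proof.
rewrite (hitr_mul HB Hp) (sw2_pure2 _ Df); last by lin.
by rewrite (hitr1 HB Hp).
Qed.

(** The three terms come from the iterated coproduct 1 (x) 1 (x) f + 1 (x) f (x) w + f (x) w (x) w,
    the last one with S(f) = - f w'. *)
Lemma lop_skew a d : lop f (a ⊗ d) = hitl p f a ⊗ d + hitl p w a ⊗ (f ** d)
  - hitl p w (hitr p w' (hitr p f a)) ⊗ (w ** d).
Proof.
have SL := antip_lin HS; case: wG => Dw _.
rewrite lopE /lop_pure (sw2_pure2 _ Df); last by lin.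
rewrite (sw2_pure2 _ Df); last by lin.
rewrite (sw2_pure _ Dw); last by apply: bil_balanced; lin.
rewrite (antip1 HcB HS) (hitr1 HB Hp) bmul1 // antip_skew.
rewrite (linN ((bil_hitr HB Hp).2 _)) (hitrM HB Hp) (linN ((bil_hitl HB Hp).1 _)).
by rewrite (linN ((@bil_pure _ _ _).2 _)).
Qed.

Lemma lop_skew_group g v : grouplike g -> p f g = 0 ->
  lop f (lmulT g v) = p w g *: lmulT g (lop f v).
Proof.
move=> gG fg; move: v; apply: tens_ext; [by lin|by lin|] => a d.
rewrite lmulTE !lop_skew hitl_skewM hitr_skewM hitl_grouplM //.
rewrite !(hitl_group _ gG) !(hitr_group _ gG) fg !scale0r.
rewrite !(lin0 (bmL _)) !add0r !(linZ (bmL _)).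
rewrite !(linZ (hrL _)) !(linZ (hlL _)) (hitr_grouplM wG') (hitl_grouplM wG).
rewrite (hitr_group _ gG) (linZ (hlL _)) (hitl_group _ gG) scalerA mulrC.
rewrite (pair_groupV ww' gG) scale1r.
rewrite (linD (lmulT_lin _)) (linN (lmulT_lin _)) (linD (lmulT_lin _)) !lmulTE.
by rewrite !pureZl !(scalerDr, scalerN).
Qed.

(** This is relation (R4) for the operators. [hitl p f e] and [hitr p f e] are (f, e) times h and
    times 1; the first produces the term in h, the second, through the last term of [lop_skew], the
    term in w. *)
Lemma lop_skew_prim e h v : grouplike h -> bcomul e = e ⊗ bone H + h ⊗ e ->
  p f h = 0 -> p w e = 0 -> p w' e = 0 ->
  lop f (lmulT e v) = lmulT e (lop f v) + p f e *: (lmulT h v - lop w v).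
Proof.
move=> hG De fh we we'; move: v; apply: tens_ext; [by lin|by lin|] => a d.
have E1 : hitl p f e = p f e *: h.
  rewrite /hitl (sw2_pure2 _ De); last by lin.
  by rewrite (pairr1 Hp) ef scale0r add0r.
have E2 : hitr p f e = p f e *: bone H.
  rewrite /hitr (sw2_pure2 _ De); last by lin.
  by rewrite fh scale0r addr0.
have E3 : hitl p w e = e.
  rewrite /hitl (sw2_pure2 _ De); last by lin.
  by rewrite (pairr1 Hp) we (proj2 wG) scale0r addr0 scale1r.
have E4 : hitr p w e = p w h *: e.
  rewrite /hitr (sw2_pure2 _ De); last by lin.
  by rewrite we scale0r add0r.
have E5 : hitr p w' e = p w' h *: e.
  rewrite /hitr (sw2_pure2 _ De); last by lin.
  by rewrite we' scale0r add0r.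
rewrite lmulTE !lop_skew (lop_group wG ww') hitl_skewM hitr_skewM (hitl_grouplM wG) E1 E2 E3 E4.
rewrite !(linZ (bmL _)) bmul1 // !(linD (hrL _)) !(linZ (hrL _)) (hitr_grouplM wG') E5.
rewrite !(linZ (bmL _)) !(linD (hlL _)) !(linZ (hlL _)) (hitl_grouplM wG) E3 scalerA.
rewrite (pair_groupV ww' hG) scale1r.
rewrite (linD (lmulT_lin _)) (linN (lmulT_lin _)) (linD (lmulT_lin _)) !lmulTE.
rewrite !pureDl !pureZl scalerBr.
by rewrite opprD !addrA addrAC; congr (_ - _); rewrite [RHS]addrC !addrA.
Qed.

End Skew.
End DoubleModule.

(** * The cross relation at group-like and skew-primitive elements *)

Section CrossGen.
Variables (K : fieldType) (H Hc U : bialg_data K).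
Hypotheses (HB : is_bialgebra H) (UB : is_bialgebra U).
Variable p : Hc -> H -> K.
Hypothesis Hp : @is_hopf_pairing K (coop Hc) H p.
Variables (i : H -> U) (j : Hc -> U).
Hypotheses (iL : Lin i) (jL : Lin j).
#[local] Hint Resolve iL jL : lin.

Lemma cross_group c a : grouplike c ->
  cross p i j c a <-> j c ** i (hitr p c a) = i (hitl p c a) ** j c.
Proof.
move=> [Dc _]; rewrite /cross (sw2_pure _ Dc); last by apply: bil_balanced; lin.
by rewrite (sw2_pure _ Dc) //; apply: bil_balanced; lin.
Qed.

Lemma cross_skew f w a : j (bone Hc) = bone U ->
  bcomul f = bone Hc ⊗ f + f ⊗ w ->
  cross p i j f a <-> j f ** i a + j w ** i (hitr p f a) =
                      i (hitl p f a) + i (hitl p w a) ** j f.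
Proof.
move=> j1 Df; rewrite /cross (sw2_pure2 _ Df); last by lin.
rewrite (sw2_pure2 _ Df); last by lin.
by rewrite (hitr1 HB Hp) j1 bmulr1.
Qed.
End CrossGen.

(** * Bialgebra morphisms and sub-bialgebras *)

Definition is_bhom (K : fieldType) (H U : bialg_data K) (i : H -> U) :=
  [/\ Lin i, forall x y, i (x ** y) = i x ** i y, i (bone H) = bone U,
      forall x, bcomul (i x) = tens_map i i (bcomul x)
    & forall x, bcounit (i x) = bcounit x].

Section TensMap.
Variable K : fieldType.
Implicit Types V W : lmodType K.

Lemma tens_map_comp V V' V'' W W' W'' (f : V -> V') (f' : V' -> V'')
    (g : W -> W') (g' : W' -> W'') x : Lin f' -> Lin g' ->
  tens_map f' g' (tens_map f g x) = tens_map (f' \o f) (g' \o g) x.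
Proof.
move=> fL gL; rewrite {2 3}/tens_map (tens_lift_comp _ _ (tens_map_lin fL gL)).
by apply: eq_tens_lift => v w; rewrite tens_mapE.
Qed.

Lemma tens_mapK V V' W W' (f : V -> V') (f' : V' -> V) (g : W -> W') (g' : W' -> W) :
  Lin f' -> Lin g' -> cancel f f' -> cancel g g' ->
  cancel (tens_map f g) (tens_map f' g').
Proof.
move=> fL gL fK gK x; rewrite tens_map_comp // -[RHS]tens_lift_id.
by apply: eq_tens_lift => v w /=; rewrite fK gK.
Qed.

Lemma tens_map_inj V V' W W' (f : V -> V') (g : W -> W') :
  Lin f -> Lin g -> injective f -> injective g -> injective (tens_map f g).
Proof.
move=> fL gL /(lin_section fL) [f' fL' fK] /(lin_section gL) [g' gL' gK].
exact: can_inj (tens_mapK fL' gL' fK gK).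
Qed.

End TensMap.

Section BHom.
Variables (K : fieldType).

Lemma sw2_bhom (H U : bialg_data K) (i : H -> U) (M : lmodType K) (g : U -> U -> M) x :
    is_bhom i -> Bil g ->
  sweedler2 g (i x) = sweedler2 (fun u v => g (i u) (i v)) x.
Proof.
move=> [iL _ _ iD _] gB; rewrite /sweedler2 iD /tens_map.
rewrite (tens_lift_comp _ _ (tens_lift_lin gB)); apply: eq_tens_lift => u v.
by apply: tens_lift_pure; apply: bil_balanced.
Qed.

Lemma bhom_cancel (H U T : bialg_data K) (i : H -> U) (j : U -> T) :
  injective j -> is_bhom j -> is_bhom (fun x => j (i x)) -> is_bhom i.
Proof.
move=> jI [jL jM j1 jD je] [iL iM i1 iD ie].
have iL' : Lin i by move=> k u v; apply: jI; rewrite iL jL.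
split=> [//|x y||x|x].
- by apply: jI; rewrite iM jM.
- by apply: jI; rewrite i1 j1.
- apply: (tens_map_inj jL jL jI jI); rewrite -jD iD tens_map_comp //.
- by rewrite -je ie.
Qed.

Section Pull.
Variables (H U : bialg_data K) (i : H -> U).
Hypotheses (iH : is_bhom i) (iI : injective i) (UB : is_bialgebra U).

(** [is_bhom] presupposes no axiom of H. Each bialgebra axiom of H is an equation in H or in its
    second or third tensor power, and injectivity of i and of its tensor powers lets it be checked
    in U. Both the subalgebras and the doubles receive their axioms in this way. *)
Lemma bialg_pull : is_bialgebra H.
Proof.
have [iL iM i1 iD ie] := iH; have [r rL iK] := lin_section iL iI.
have bm := bil_bmul UB.
have bmH : Bil (@bmul K H).
  by split=> z k x y; apply: iI; rewrite iL !iM iL ?bm.1 ?bm.2.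
have DE x : bcomul x = tens_map r r (bcomul (i x)) by rewrite iD (tens_mapK rL rL).
have DL : Lin (@bcomul K H).
  move=> k x y; rewrite !DE iL (lin_bcomul UB).
  by rewrite (tens_map_lin rL rL).
have I2 := tens_map_inj iL iL iI iI.
have L2 := tens_map_lin iL iL.
have I3 := tens_map_inj iL L2 iI I2.
have L3 := tens_map_lin iL L2.
have [[_ _ uA u1 u1'] [_ ue uc uce uce'] [uDm uD1 uem ue1]] := UB.
split; [split|split|split].
- exact: bmH.1.
- exact: bmH.2.
- by move=> x y z; apply: iI; rewrite !iM uA.
- by move=> x; apply: iI; rewrite iM i1 u1.
- by move=> x; apply: iI; rewrite iM i1 u1'.
- exact: DL.
- by move=> k x y; rewrite -!ie iL ue.
- move=> x; apply: I3; rewrite (sw2_comp _ _ L3) (sw2_comp _ _ L3).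
  transitivity (sweedler2 (fun u v => tens_lift (fun u1 u2 => u1 ⊗ (u2 ⊗ v)) (bcomul u)) (i x)).
    rewrite (sw2_bhom _ iH); last by split=> z; lin.
    apply: eq_sw2 => u v; rewrite (tens_lift_comp _ _ L3).
    rewrite -[RHS]/(sweedler2 _ _) (sw2_bhom _ iH); last by lin.
    by apply: eq_tens_lift => w z; rewrite !tens_mapE.
  rewrite uc (sw2_bhom _ iH); last by split=> z; lin.
  by apply: eq_sw2 => u v; rewrite tens_mapE // -iD.
- move=> x; apply: iI; rewrite (sw2_comp _ _ iL) -[RHS]uce (sw2_bhom _ iH).
    by apply: eq_sw2 => u v; rewrite (linZ iL) ie.
  by split=> z; lin.
- move=> x; apply: iI; rewrite (sw2_comp _ _ iL) -[RHS]uce' (sw2_bhom _ iH).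
    by apply: eq_sw2 => u v; rewrite (linZ iL) ie.
  by split=> z; lin.
- move=> x y; apply: I2; rewrite -iD iM uDm (sw2_bhom _ iH); last by lin.
  rewrite (sw2_comp _ _ L2); apply: eq_sw2 => u v; rewrite (sw2_bhom _ iH); last by lin.
  by rewrite (sw2_comp _ _ L2); apply: eq_sw2 => w z; rewrite tens_mapE // !iM.
- by apply: I2; rewrite -iD i1 uD1 tens_mapE // i1.
- by move=> x y; rewrite -!ie iM uem.
- by rewrite -ie i1 ue1.
Qed.

Lemma antipode_pull (S : U -> U) (S' : H -> H) :
  is_antipode S -> (forall x, S (i x) = i (S' x)) -> is_antipode S'.
Proof.
move=> HS iS; have [iL iM i1 iD ie] := iH; have SL := antip_lin HS.
have [_ Sl Sr] := HS; split.
- by move=> k x y; apply: iI; rewrite iL -!iS iL SL.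
- move=> x; apply: iI; rewrite (sw2_comp _ _ iL) (linZ iL) i1 -ie -Sl.
  rewrite (sw2_bhom _ iH); last by lin.
  by apply: eq_sw2 => u v; rewrite iM iS.
- move=> x; apply: iI; rewrite (sw2_comp _ _ iL) (linZ iL) i1 -ie -Sr.
  rewrite (sw2_bhom _ iH); last by lin.
  by apply: eq_sw2 => u v; rewrite iM iS.
Qed.

End Pull.

(** H enters with bare operations; its antipode is that of U conjugated by i, and uniqueness
    identifies it with the chosen [antipode]. *)
Lemma hopf_iso_bij (H U : bialg_data K) (i : H -> U) :
  is_bhom i -> bijective i -> is_hopf U -> hopf_isomorphic H U.
Proof.
move=> iH iB [UB US]; have HS := antipodeP US.
have iI := bij_inj iB; case: (iB) => g iK gK.
have SH : is_antipode (fun x => g (antipode (i x))).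
  by apply: (antipode_pull iH iI UB HS) => x; rewrite gK.
have HB := bialg_pull iH iI UB.
split=> //; first by split=> //; exists (fun x => g (antipode (i x))).
exists i; have [iL iM i1 iD ie] := iH; split=> //.
split=> // x; rewrite (antipodeE HB SH) gK //.
Qed.

End BHom.

(** * Hopf algebra structure on the subalgebra generated by a set *)

Section SubBialg.
Variables (K : fieldType) (A : algType K) (D : A -> tensor A A) (eps : A -> K).
Local Notation U := (alg_bialg D eps).
Hypothesis UH : is_hopf U.
Local Notation S := (@antipode K U).
Variable X : set A.

Lemma val_lin : Lin (\val : subalg X -> A).
Proof. by move=> k u v; rewrite linearP. Qed.

Lemma subalgP x : reflect (generated X x) (x \in subalg_pred X).
Proof. exact: asboolP. Qed.

Definition sub_el x (gx : generated X x) : subalg X :=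
  exist _ x (introT (subalgP x) gx).

Lemma subalg_ind (P : subalg X -> Prop) :
    (forall a, X (\val a) -> P a) -> P 1 ->
    (forall k a b, P a -> P b -> P (k *: a + b)) ->
    (forall a b, P a -> P b -> P (a * b)) -> forall a, P a.
Proof.
move=> Pgen P1 Plin Pmul.
suff Pgx x : generated X x -> forall a, \val a = x -> P a.
  by move=> a; apply: Pgx (erefl _); apply: elimT (subalgP _) (valP a).
elim=> {x} [x Xx|||].
- by move=> a E; apply: Pgen; rewrite E.
- by move=> a E; rewrite (_ : a = 1) //; apply: val_inj.
- move=> k x y gx IHx gy IHy a E.
  have -> : a = k *: sub_el gx + sub_el gy by apply: val_inj.
  by apply: Plin; [apply: IHx|apply: IHy].
- move=> x y gx IHx gy IHy a E.
  have -> : a = sub_el gx * sub_el gy by apply: val_inj.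
  by apply: Pmul; [apply: IHx|apply: IHy].
Qed.

Definition Hopf_gens := forall x, X x ->
  (exists s : seq (subalg X * subalg X), D x = \sum_(q <- s) \val q.1 ⊗ \val q.2)
  /\ generated X (S x).

Hypothesis XH : Hopf_gens.

Let UB : is_bialgebra U := UH.1.
Let SP : is_antipode S := antipodeP UH.2.

Lemma subD (x : A) : generated X x ->
  exists s : seq (subalg X * subalg X), D x = \sum_(q <- s) \val q.1 ⊗ \val q.2.
Proof.
have DL : Lin D := lin_bcomul UB.
elim=> {x}.
- by move=> x /XH [].
- exists [:: (1, 1)]; rewrite big_seq1; exact: (bcomul1 UB).
- move=> k x y _ [s Ds] _ [t Dt].
  exists ([seq (k *: q.1, q.2) | q <- s] ++ t).
  rewrite DL Ds Dt big_cat big_map scaler_sumr; congr (_ + _).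
  by apply: eq_bigr => q _ /=; rewrite -pureZl.
- move=> x y _ [s Ds] _ [t Dt].
  exists [seq (q.1 * q'.1, q.2 * q'.2) | q <- s, q' <- t].
  have [_ _ [Dm _ _ _]] := UB; rewrite [LHS]Dm.
  rewrite (@sw2_sumE K U _ _ _ [seq (\val q.1, \val q.2) | q <- s]); last by rewrite big_map.
    rewrite big_map big_allpairs_dep /=; apply: eq_bigr => q _.
    rewrite (@sw2_sumE K U _ _ _ [seq (\val q.1, \val q.2) | q <- t]); last by rewrite big_map.
      by rewrite big_map.
    by apply: bil_balanced; have bm := bil_bmul UB; lin.
  by apply: bil_balanced; have bm := bil_bmul UB; lin.
Qed.

Lemma subS (x : A) : generated X x -> generated X (S x).
Proof.
have SL : Lin S := antip_lin SP.
elim=> {x}.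
- by move=> x /XH [].
- rewrite (antip1 UB SP); exact: gen_one.
- by move=> k x y _ gx _ gy; rewrite SL; apply: gen_lin.
- move=> x y _ gx _ gy; rewrite -[x * y]/(bmul (x : U) y) (antipM UB SP).
  exact: gen_mul.
Qed.

(** The coproduct of [sub_bialg] is a chosen preimage; [subD] exhibits one, so the default value 0
    of [xget] never occurs. *)
Lemma sub_comul (x : subalg X) :
  tens_map \val \val (@bcomul K (sub_bialg D eps X) x) = D (\val x).
Proof.
rewrite /=; case: xgetP => [t _ //|no].
have [s Ds] := subD (elimT (subalgP _) (valP x)).
case: (no (\sum_(q <- s) q.1 ⊗ q.2)); rewrite /= Ds.
rewrite (lin_suml (tens_map_lin val_lin val_lin)); apply: eq_bigr => q _.
by rewrite tens_mapE //; apply: val_lin.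
Qed.

Lemma val_bhom : @is_bhom K (sub_bialg D eps X) U \val.
Proof.
by split=> // x; rewrite sub_comul.
Qed.

Lemma sub_bialgB : is_bialgebra (sub_bialg D eps X).
Proof. exact: bialg_pull val_bhom val_inj UB. Qed.

Lemma sub_hopf : is_hopf (sub_bialg D eps X).
Proof.
split; first exact: sub_bialgB.
exists (fun x => sub_el (subS (elimT (subalgP _) (valP x)))).
by apply: (antipode_pull val_bhom val_inj UB SP).
Qed.

(** Injectivity of [\val] (x) [\val] leaves only one possible preimage. Coproducts of generators of
    the subalgebras can thus be read off in U. *)
Lemma sub_comulE (x : subalg X) (s : seq (subalg X * subalg X)) :
  D (\val x) = \sum_(q <- s) \val q.1 ⊗ \val q.2 ->
  @bcomul K (sub_bialg D eps X) x = \sum_(q <- s) q.1 ⊗ q.2.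
Proof.
move=> Ds; apply: (tens_map_inj val_lin val_lin val_inj val_inj).
rewrite sub_comul Ds (lin_suml (tens_map_lin val_lin val_lin)); apply: eq_bigr => q _.
by rewrite tens_mapE //; apply: val_lin.
Qed.

End SubBialg.

(** * The relations of U_{r,s}(gl_n) *)

(** Descending induction along the indices, adapted to a_i = omega_i / b_(i+1) and b_i = omega'_i /
    a_(i+1), which start from a_n and b_n. *)
Lemma hi_lo_ind N (P : 'I_N.+1 -> Prop) :
  P ord_max -> (forall i : 'I_N, P (hi i) -> P (lo i)) -> forall k, P k.
Proof.
move=> P0 PS k; have [d] := ubnP (N - k)%N; elim: d k => // d IH k kd.
have [->//|kN] := eqVneq k ord_max.
have k_lt : (k < N)%N.
  rewrite ltn_neqAle -ltnS ltn_ord andbT; apply: contraNneq kN => kN.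
  exact/eqP/val_inj.
have -> : k = lo (Ordinal k_lt) by apply: val_inj.
apply: PS; apply: IH; rewrite /= /bump leq0n add1n subnS.
by rewrite -ltnS prednK // subn_gt0.
Qed.

Lemma inner_epsilon N (i k : 'I_N) : inner (epsilon i) (epsilon k) = (i == k)%:R.
Proof.
by rewrite /inner /epsilon trmx_delta mul_delta_mx_cond mulmxnE mxE !eqxx.
Qed.

Lemma inner_alpha N i (j : 'I_N) :
  inner (epsilon i) (alpha j) = (i == lo j)%:R - (i == hi j)%:R.
Proof.
rewrite -!inner_epsilon /alpha /inner [(_ - _)^T]raddfB mulmxBr.
by rewrite [LHS]mxE [X in _ + X]mxE.
Qed.

(** Both sides are 1 for j = i + 1 and -1 for j = i. Through [wt_swap] this symmetry lets the single
    scalar (omega'_i, omega_j) govern the commutation of omega_j with e_i and of omega'_i with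
    e_j. *)
Lemma inner_hi_lo N (i j : 'I_N) :
  inner (epsilon (hi i)) (alpha j) = - inner (epsilon (lo j)) (alpha i).
Proof.
rewrite !inner_alpha opprB eq_sym; congr (_%:R - _%:R).
by rewrite -!val_eqE /= /bump !leq0n !add1n eqSS eq_sym.
Qed.

Section URel.
Variables (K : fieldType) (N : nat) (r s : K).
Local Notation U := (Ugl N r s).
Local Notation T := (term K (ugen N)).
Local Notation cls := (pcls (@ugl_rel K N r s)).

Lemma pclsD (t u : T) : cls (TAdd t u) = cls t + cls u :> U.
Proof. by rewrite -pres_addE. Qed.
Lemma pclsM (t u : T) : cls (TMul t u) = cls t * cls u :> U.
Proof. by rewrite -pres_mulE. Qed.
Lemma pclsZ k (t : T) : cls (TMul (TConst k) t) = k *: cls t :> U.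
Proof. by rewrite -pres_mulE. Qed.
Lemma pcls1 : cls (TConst 1) = 1 :> U.
Proof. by []. Qed.
Definition pclsE := (pclsD, pclsZ, pclsM).

Lemma rel_cls t u : ugl_rel r s t u -> cls t = cls u.
Proof. by move=> tu; apply/pclsP/pe_rel. Qed.

(** [A] selects a_k, which goes with the parameter r, or b_k, which goes with s; negating it
    exchanges the two, so that each computation is made once for both Borel subalgebras. *)
Definition tor (A : bool) (k : 'I_N.+1) (u : bool) : U := if A then ua r s k u else ub r s k u.
Arguments tor : simpl never.
Definition rs_param (A : bool) := if A then r else s.
Definition invb (u : bool) (c : K) := if u then c^-1 else c.

Lemma invbM u c d : invb u (c * d) = invb u c * invb u d.
Proof. by case: u => //=; rewrite invfM. Qed.

Lemma torC A k u B l v : tor A k u * tor B l v = tor B l v * tor A k u.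
Proof.
case: A; case: B; rewrite /tor /ua /ub -!pclsM.
- by apply: rel_cls; constructor.
- by apply: rel_cls; constructor.
- by apply/esym/rel_cls; constructor.
- by apply: rel_cls; constructor.
Qed.

Lemma torV A k u : tor A k u * tor A k (~~ u) = 1.
Proof.
suff E : tor A k false * tor A k true = 1 by case: u => //=; rewrite torC.
by case: A; rewrite /tor /ua /ub -!pclsM -pcls1; apply: rel_cls; constructor.
Qed.

Lemma qcomm_inv (c : K) (x y z : U) : c != 0 -> x * y = 1 -> y * x = 1 ->
  x * z = c *: (z * x) -> y * z = c^-1 *: (z * y).
Proof.
move=> c0 xy yx xz; rewrite -[y * z]mulr1 -xy mulrA -[y * z * x]mulrA.
have -> : z * x = c^-1 *: (x * z) by rewrite xz scalerA mulVf // scale1r.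
by rewrite -scalerAr mulrA yx mul1r scalerAl.
Qed.

Hypotheses (r0 : r != 0) (s0 : s != 0).

Lemma rs_param_neq0 A n : rs_param A ^ n != 0.
Proof. by rewrite expfz_neq0 //; case: A. Qed.

Lemma tor_e A k u j : tor A k u * ue r s j =
  invb u (rs_param A ^ inner (epsilon k) (alpha j)) *: (ue r s j * tor A k u).
Proof.
suff E : tor A k false * ue r s j =
    rs_param A ^ inner (epsilon k) (alpha j) *: (ue r s j * tor A k false).
  case: u => //=; apply: qcomm_inv E; first exact: rs_param_neq0.
    exact: torV.
  by rewrite torC torV.
case: A.
- by have := rel_cls (rel_ae r s k j); rewrite !pclsE.
- by have := rel_cls (rel_be r s k j); rewrite !pclsE.
Qed.

Lemma tor_f A k u j : tor A k u * uf r s j =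
  invb u (rs_param A ^ inner (epsilon k) (alpha j))^-1 *: (uf r s j * tor A k u).
Proof.
suff E : tor A k false * uf r s j =
    (rs_param A ^ inner (epsilon k) (alpha j))^-1 *: (uf r s j * tor A k false).
  case: u => //=; apply: qcomm_inv E; first by rewrite invr_eq0 rs_param_neq0.
    exact: torV.
  by rewrite torC torV.
case: A; rewrite invr_expz.
- by have := rel_cls (rel_af r s k j); rewrite !pclsE.
- by have := rel_cls (rel_bf r s k j); rewrite !pclsE.
Qed.

(* [gl true] and [gl false] are the group-like generators of the two Borel
   subalgebras. *)
Definition gl (A : bool) (g : option 'I_N) (u : bool) : U :=
  if A then grp r s g u else grp' r s g u.

Arguments gl : simpl never.

Lemma glE A g u : gl A g u =
  if g is Some i then tor A (lo i) u * tor (~~ A) (hi i) u else tor A ord_max u.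
Proof.
case: A; case: g => [i|] //; rewrite /gl /= /omega'.
exact: (torC true _ _ false).
Qed.

(** The scalar c with g e_j = c e_j g for the group-like g; moving g past f_j costs the inverse of
    c. *)
Definition gl_wt (A : bool) (g : option 'I_N) (j : 'I_N) : K :=
  if g is Some i then rs_param A ^ inner (epsilon (lo i)) (alpha j)
                      * rs_param (~~ A) ^ inner (epsilon (hi i)) (alpha j)
  else rs_param A ^ inner (epsilon ord_max) (alpha j).

Lemma wt0 A g j : gl_wt A g j != 0.
Proof. by case: g => [i|] /=; rewrite ?mulf_neq0 ?rs_param_neq0. Qed.

Lemma gl_tor A g u B k v : gl A g u * tor B k v = tor B k v * gl A g u.
Proof.
rewrite glE; case: g => [i|]; last exact: torC.
by rewrite -mulrA [tor (~~ A) _ _ * _]torC !mulrA [tor A _ _ * tor B _ _]torC.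
Qed.

Lemma glC A g u B g' v : gl A g u * gl B g' v = gl B g' v * gl A g u.
Proof.
rewrite [gl B g' v]glE; case: g' => [i|]; last exact: gl_tor.
by rewrite mulrA gl_tor -mulrA gl_tor mulrA.
Qed.

Lemma glV A g u : gl A g u * gl A g (~~ u) = 1.
Proof.
rewrite !glE; case: g => [i|]; last exact: torV.
rewrite -mulrA [tor (~~ A) _ _ * _]mulrA [tor (~~ A) _ _ * _]torC.
by rewrite -mulrA torV mulr1 torV.
Qed.

Lemma gl_e A g u j : gl A g u * ue r s j = invb u (gl_wt A g j) *: (ue r s j * gl A g u).
Proof.
rewrite !glE; case: g => [i|] /=; last exact: tor_e.
rewrite -mulrA tor_e -scalerAr [tor A _ _ * (_ * _)]mulrA tor_e -scalerAl scalerA invbM mulrC.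
by rewrite -mulrA.
Qed.

Lemma gl_f A g u j :
  gl A g u * uf r s j = invb u (gl_wt A g j)^-1 *: (uf r s j * gl A g u).
Proof.
rewrite !glE; case: g => [i|] /=; last exact: tor_f.
rewrite -mulrA tor_f -scalerAr [tor A _ _ * (_ * _)]mulrA tor_f -scalerAl scalerA invfM invbM mulrC.
by rewrite -mulrA.
Qed.

Lemma ue_uf i j : ue r s i * uf r s j - uf r s j * ue r s i =
  ((i == j)%:R / (r - s)) *: (gl true (Some i) false - gl false (Some i) false).
Proof.
have := rel_cls (rel_ef r s i j); rewrite !pclsE scaleN1r => -> .
by rewrite scaleN1r.
Qed.

Lemma ueC (i j : 'I_N) : (i.+1 < j)%N || (j.+1 < i)%N ->
  ue r s i * ue r s j - ue r s j * ue r s i = 0.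
Proof. by move=> /(rel_ee r s)/rel_cls; rewrite !pclsE scaleN1r. Qed.
Lemma ufC (i j : 'I_N) : (i.+1 < j)%N || (j.+1 < i)%N ->
  uf r s i * uf r s j - uf r s j * uf r s i = 0.
Proof. by move=> /(rel_ff r s)/rel_cls; rewrite !pclsE scaleN1r. Qed.

Definition serreL (A : algType K) (c d : K) (x y : A) :=
  x * x * y - c *: (x * y * x) + d *: (y * x * x).
Definition serreR (A : algType K) (c d : K) (x y : A) :=
  x * y * y - c *: (y * x * y) + d *: (y * y * x).

Lemma ue_serreL (i j : 'I_N) : j = i.+1 :> nat ->
  serreL (r + s) (r * s) (ue r s i) (ue r s j) = 0.
Proof. by move=> /(rel_eel r s)/rel_cls; rewrite !pclsE scaleN1r. Qed.
Lemma ue_serreR (i j : 'I_N) : j = i.+1 :> nat ->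
  serreR (r + s) (r * s) (ue r s i) (ue r s j) = 0.
Proof. by move=> /(rel_eer r s)/rel_cls; rewrite !pclsE scaleN1r. Qed.
Lemma uf_serreL (i j : 'I_N) : j = i.+1 :> nat ->
  serreL (r^-1 + s^-1) (r^-1 * s^-1) (uf r s i) (uf r s j) = 0.
Proof. by move=> /(rel_ffl r s)/rel_cls; rewrite !pclsE scaleN1r. Qed.
Lemma uf_serreR (i j : 'I_N) : j = i.+1 :> nat ->
  serreR (r^-1 + s^-1) (r^-1 * s^-1) (uf r s i) (uf r s j) = 0.
Proof. by move=> /(rel_ffr r s)/rel_cls; rewrite !pclsE scaleN1r. Qed.

Lemma wt_swap (i j : 'I_N) :
  gl_wt false (Some i) j = (gl_wt true (Some j) i)^-1.
Proof.
by rewrite /gl_wt /= invfM !inner_hi_lo !invr_expz opprK mulrC.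
Qed.

(* The group-likes of the two Borel subalgebras pair through the commutation
   factors of gl_e and gl_f. *)
Lemma grp_pairing_some i g : grp_pairing r s (Some i) g = gl_wt true g i.
Proof. by case: g => [j|]. Qed.

Lemma grp_pairing_none j : grp_pairing r s None (Some j) = (gl_wt false None j)^-1.
Proof. by rewrite /= invr_expz. Qed.

Lemma grp_pairing_omega g j : grp_pairing r s g (Some j) = (gl_wt false g j)^-1.
Proof.
case: g => [i|]; last exact: grp_pairing_none.
by rewrite grp_pairing_some wt_swap invrK.
Qed.

End URel.
Arguments tor : simpl never.
Arguments gl : simpl never.
Arguments gl_wt : simpl never.

(** * Actions of presented algebras *)

Section TermAct.
Variables (K : fieldType) (G : Type) (V : lmodType K) (ev : G -> V -> V).
Hypothesis evL : forall g, Lin (ev g).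

Fixpoint term_act (t : term K G) : V -> V :=
  match t with
  | TGen g => ev g
  | TConst k => *:%R k
  | TAdd t u => fun v => term_act t v + term_act u v
  | TMul t u => fun v => term_act t (term_act u v)
  end.

Lemma term_act_lin t : Lin (term_act t).
Proof.
elim: t => //= [k|t IHt u IHu|t IHt u IHu]; first exact: (lin_scale k (@lin_id _ _)).
  exact: lin_add.
exact: lin_comp.
Qed.

(** The universal property of a presentation, for operators: linear operators that satisfy the
    relations satisfy their congruence closure, linearity accounting for distributivity and for
    central constants. *)
Lemma pres_eq_act (R : term K G -> term K G -> Prop) :
    (forall t u, R t u -> term_act t =1 term_act u) ->
  forall t u, pres_eq R t u -> term_act t =1 term_act u.
Proof.
move=> evR t u; elim=> //= {t u}.
- by move=> t u _ tu v; rewrite tu.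
- by move=> t u v _ tu _ uv w; rewrite tu.
- by move=> t t' u u' _ tt' _ uu' v; rewrite tt' uu'.
- by move=> t t' u u' _ tt' _ uu' v; rewrite uu' tt'.
- by move=> t u v w; rewrite addrA.
- by move=> t u v; rewrite addrC.
- by move=> t v; rewrite scale0r add0r.
- by move=> t v; rewrite scale1r.
- by move=> t v; rewrite !scale0r.
- by move=> t u v w; rewrite (linD (term_act_lin t)).
- by move=> k t v; rewrite (linZ (term_act_lin t)).
- by move=> k l v; rewrite scalerDl.
- by move=> k l v; rewrite scalerA.
Qed.

End TermAct.

Section GeneratedAct.
Variables (K : fieldType) (A : algType K) (X : set A) (V : lmodType K).
Variables (f : A -> V -> V) (g : subalg X -> V -> V).
Hypotheses (f1 : forall v, f 1 v = v) (g1 : forall v, g 1 v = v).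
Hypotheses (fM : forall x y v, f (x * y) v = f x (f y v))
           (gM : forall x y v, g (x * y) v = g x (g y v)).
Hypotheses (fL : forall v, Lin (f^~ v)) (gL : forall v, Lin (g^~ v)).

Lemma generated_act_eq : (forall a, X (\val a) -> forall v, f (\val a) v = g a v) ->
  forall a v, f (\val a) v = g a v.
Proof.
move=> fg.
elim/subalg_ind=> [a Xa v||k a b IHa IHb v|a b IHa IHb v]; first exact: fg.
- by move=> v; rewrite f1 g1.
- by rewrite [LHS](fL v) (gL v) IHa IHb.
- by rewrite fM gM IHa IHb.
Qed.
End GeneratedAct.

(** * The Borel subalgebras *)

Section UHopf.
Variables (K : fieldType) (N : nat) (r s : K).
Local Notation U := (Ugl N r s).
Variables (D : U -> tensor U U) (eps : U -> K).
Hypothesis HU : is_ugl_hopf D eps.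
Local Notation UB := (alg_bialg D eps).
Local Notation S := (@antipode K UB).

Lemma ugl_hopf : is_hopf UB. Proof. by case: HU. Qed.
Let hB : is_bialgebra UB := ugl_hopf.1.
Let SP : is_antipode S := antipodeP ugl_hopf.2.

Lemma D_tor A k u : D (tor r s A k u) = tor r s A k u ⊗ tor r s A k u.
Proof. by case: HU => _ h _ _ _; have [] := h k u; case: A. Qed.
Lemma eps_tor A k u : eps (tor r s A k u) = 1.
Proof. by case: HU => _ _ _ [h _] _; have [] := h k u; case: A. Qed.

Lemma grouplikeM (x y : UB) : D x = x ⊗ x -> D y = y ⊗ y ->
  D (x * y) = (x * y) ⊗ (x * y).
Proof.
move=> Dx Dy; have [_ _ [Dm _ _ _]] := hB; rewrite [LHS]Dm.
have bm := bil_bmul hB.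
rewrite (@sw2_pure K UB _ _ x x x _ Dx); last by apply: bil_balanced; lin.
by rewrite (@sw2_pure K UB _ _ y y y _ Dy) //; apply: bil_balanced; lin.
Qed.

Lemma D_gl A g u : D (gl r s A g u) = gl r s A g u ⊗ gl r s A g u.
Proof.
by rewrite !glE; case: g => [i|]; [apply: grouplikeM|]; apply: D_tor.
Qed.
Lemma eps_gl A g u : eps (gl r s A g u) = 1.
Proof.
rewrite glE; case: g => [i|]; last exact: eps_tor.
by rewrite [LHS](bcounitM hB) /= !eps_tor mulr1.
Qed.
Lemma S_gl A g u : S (gl r s A g u) = gl r s A g (~~ u).
Proof. by apply: (antip_group hB SP); [exact: D_gl|exact: eps_gl|exact: glV]. Qed.
Lemma D_ue j : D (ue r s j) = ue r s j ⊗ 1 + gl r s true (Some j) false ⊗ ue r s j.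
Proof. by case: HU => _ _ h _ _; have [] := h j. Qed.
Lemma D_uf j : D (uf r s j) = 1 ⊗ uf r s j + uf r s j ⊗ gl r s false (Some j) false.
Proof. by case: HU => _ _ h _ _; have [] := h j. Qed.
Lemma eps_uf j : eps (uf r s j) = 0.
Proof. by case: HU => _ _ _ [_ h] _; have [] := h j. Qed.
Lemma S_ue j : S (ue r s j) = - (gl r s true (Some j) true * ue r s j).
Proof. by case: HU => _ _ _ _ h; have [] := h j. Qed.
Lemma S_uf j : S (uf r s j) = - (uf r s j * gl r s false (Some j) true).
Proof. by case: HU => _ _ _ _ h; have [] := h j. Qed.

Lemma generatedN (X : set U) x : generated X x -> generated X (- x).
Proof.
move=> gx; have g0 : generated X 0.
  by rewrite -(addNr (1 : U)) -scaleN1r; apply: gen_lin; apply: gen_one.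
by rewrite -[- x]addr0 -scaleN1r; apply: gen_lin.
Qed.

(** With a generator e_j or f_j its group-like must be generated for both values of [u]: the element
    itself occurs in the coproduct, its inverse in the antipode. *)
Lemma ugl_Hopf_gens (X : set U) :
    (forall x, X x ->
      [\/ exists2 j, x = ue r s j & forall u, generated X (gl r s true (Some j) u),
          exists2 j, x = uf r s j & forall u, generated X (gl r s false (Some j) u)
        | exists A g, exists2 u, x = gl r s A g u & generated X (gl r s A g (~~ u))]) ->
  Hopf_gens D eps X.
Proof.
move=> HX x Xx; have gx : generated X x := gen_in Xx.
pose X1 : subalg X := 1.
case: (HX x Xx) => [[j xE gj]|[j xE gj]|[A [g [u xE gg]]]]; subst x.
- split; last by rewrite S_ue; apply/generatedN/gen_mul.
  exists [:: (sub_el gx, X1); (sub_el (gj false), sub_el gx)].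
  by rewrite big_cons big_seq1 D_ue.
- split; last by rewrite S_uf; apply/generatedN/gen_mul.
  exists [:: (X1, sub_el gx); (sub_el gx, sub_el (gj false))].
  by rewrite big_cons big_seq1 D_uf.
- split; last by rewrite S_gl.
  by exists [:: (sub_el gx, sub_el gx)]; rewrite big_seq1 D_gl.
Qed.

Lemma borel_glP x : borel_gl_gens N r s x <->
  (exists j, x = ue r s j) \/ (exists g u, x = gl r s true g u).
Proof.
split=> [[[j [->|[u ->]]]|[u ->]]|[[j ->]|[[j|] [u ->]]]].
- by left; exists j.
- by right; exists (Some j), u.
- by right; exists None, u.
- by left; exists j; left.
- by left; exists j; right; exists u.
- by right; exists u.
Qed.

Lemma borel_glP' x : borel_gl_gens' N r s x <->
  (exists j, x = uf r s j) \/ (exists g u, x = gl r s false g u).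
Proof.
split=> [[[j [->|[u ->]]]|[u ->]]|[[j ->]|[[j|] [u ->]]]].
- by left; exists j.
- by right; exists (Some j), u.
- by right; exists None, u.
- by left; exists j; left.
- by left; exists j; right; exists u.
- by right; exists u.
Qed.

Lemma Hopf_gens_gl : Hopf_gens D eps (borel_gl_gens N r s).
Proof.
apply: ugl_Hopf_gens => x /borel_glP [[j ->]|[g [u ->]]].
  constructor 1; exists j => // u; apply/gen_in/borel_glP.
  by right; exists (Some j), u.
constructor 3; exists true, g, u => //; apply/gen_in/borel_glP.
by right; exists g, (~~ u).
Qed.

Lemma Hopf_gens_gl' : Hopf_gens D eps (borel_gl_gens' N r s).
Proof.
apply: ugl_Hopf_gens => x /borel_glP' [[j ->]|[g [u ->]]].
  constructor 2; exists j => // u; apply/gen_in/borel_glP'.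
  by right; exists (Some j), u.
constructor 3; exists false, g, u => //; apply/gen_in/borel_glP'.
by right; exists g, (~~ u).
Qed.

Lemma Hopf_gens_bsl : Hopf_gens D eps (borel_sl_gens N r s).
Proof.
have gj j u : generated (borel_sl_gens N r s) (gl r s true (Some j) u).
  by apply: gen_in; exists j; right; exists u.
apply: ugl_Hopf_gens => x [j [->|[u ->]]].
  by constructor 1; exists j.
by constructor 3; exists true, (Some j), u.
Qed.

Lemma Hopf_gens_bsl' : Hopf_gens D eps (borel_sl_gens' N r s).
Proof.
have gj j u : generated (borel_sl_gens' N r s) (gl r s false (Some j) u).
  by apply: gen_in; exists j; right; exists u.
apply: ugl_Hopf_gens => x [j [->|[u ->]]].
  by constructor 2; exists j.
by constructor 3; exists false, (Some j), u.
Qed.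

Lemma Hopf_gens_sl : Hopf_gens D eps (sl_gens N r s).
Proof.
have gj A j u : generated (sl_gens N r s) (gl r s A (Some j) u).
  apply: gen_in; exists j; right; right; exists u.
  by case: A; [left|right].
apply: ugl_Hopf_gens => x [j [->|[->|[u [->|->]]]]].
- by constructor 1; exists j.
- by constructor 2; exists j.
- by constructor 3; exists true, (Some j), u.
- by constructor 3; exists false, (Some j), u.
Qed.

End UHopf.

(** * The cross relation for the Borel subalgebras of U_{r,s}(gl_n) *)

Section GlDouble.
Variables (K : fieldType) (N : nat) (r s : K).
Hypotheses (r0 : r != 0) (s0 : s != 0).
Local Notation U := (Ugl N r s).
Variables (D : U -> tensor U U) (eps : U -> K).
Hypothesis HU : is_ugl_hopf D eps.
Local Notation UB := (alg_bialg D eps).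
Local Notation X := (borel_gl_gens N r s).
Local Notation X' := (borel_gl_gens' N r s).
Local Notation B := (sub_bialg D eps X).
Local Notation B' := (sub_bialg D eps X').
Variable p : B' -> B -> K.
Hypotheses (Hp : @is_hopf_pairing K (coop B') B p) (pV : pairing_values p).

Local Notation gl := (gl r s).
Local Notation wt := (gl_wt r s).
Let hU := ugl_hopf HU.
Let gX := Hopf_gens_gl HU.
Let gX' := Hopf_gens_gl' HU.
Let BB : is_bialgebra B := sub_bialgB hU gX.
Let BB' : is_bialgebra B' := sub_bialgB hU gX'.

Lemma gen_ue j : generated X (ue r s j).
Proof. by apply/gen_in/borel_glP; left; exists j. Qed.
Lemma gen_uf j : generated X' (uf r s j).
Proof. by apply/gen_in/borel_glP'; left; exists j. Qed.
Lemma gen_gl g u : generated X (gl true g u).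
Proof. by apply/gen_in/borel_glP; right; exists g, u. Qed.
Lemma gen_gl' g u : generated X' (gl false g u).
Proof. by apply/gen_in/borel_glP'; right; exists g, u. Qed.

Definition be j : B := sub_el (gen_ue j).
Definition bf j : B' := sub_el (gen_uf j).
Definition bg g u : B := sub_el (gen_gl g u).
Definition bg' g u : B' := sub_el (gen_gl' g u).

Lemma bg_grouplike g u : grouplike (bg g u).
Proof.
split; last exact: (eps_gl HU true).
rewrite (@sub_comulE _ _ D eps hU _ gX (bg g u) [:: (bg g u, bg g u)]) ?big_seq1 //.
exact: (D_gl HU true).
Qed.
Lemma bg'_grouplike g u : grouplike (bg' g u).
Proof.
split; last exact: (eps_gl HU false).
rewrite (@sub_comulE _ _ D eps hU _ gX' (bg' g u) [:: (bg' g u, bg' g u)]) ?big_seq1 //.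
exact: (D_gl HU false).
Qed.
Lemma be_prim j : bcomul (be j) = be j ⊗ bone B + bg (Some j) false ⊗ be j.
Proof.
rewrite (@sub_comulE _ _ D eps hU _ gX (be j)
  [:: (be j, bone B); (bg (Some j) false, be j)]) ?big_cons ?big_nil ?addr0 //.
exact: (D_ue HU).
Qed.
Lemma bf_prim j : bcomul (bf j) = bone B' ⊗ bf j + bf j ⊗ bg' (Some j) false.
Proof.
rewrite (@sub_comulE _ _ D eps hU _ gX' (bf j)
  [:: (bone B', bf j); (bf j, bg' (Some j) false)]) ?big_cons ?big_nil ?addr0 //.
exact: (D_uf HU).
Qed.
Lemma bf_eps j : bcounit (bf j) = 0.
Proof. exact: (eps_uf HU). Qed.
Lemma bg'V g u : bg' g u ** bg' g (~~ u) = bone B'.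
Proof. by apply: val_inj; apply: (glV r s false). Qed.

Lemma p_fe i j : p (bf i) (be j) = (i == j)%:R / (s - r).
Proof. by have [h _ _ _] := pV (bf i) (be j); apply: h. Qed.
Lemma p_fg i g u : p (bf i) (bg g u) = 0.
Proof. by have [_ _ h _] := pV (bf i) (bg g u); apply: h. Qed.
Lemma p_ge g u j : p (bg' g u) (be j) = 0.
Proof. by have [_ _ _ h] := pV (bg' g u) (be j); apply: h. Qed.
Lemma p_gg g u j : p (bg' g u) (bg (Some j) false) = invb u (wt false g j)^-1.
Proof.
have [_ h _ _] := pV (bg' g u) (bg (Some j) false).
by rewrite {h}(h g u (Some j) false) // grp_pairing_omega //; case: u.
Qed.
Lemma p_wg j g u : p (bg' (Some j) false) (bg g u) = invb u (wt true g j).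
Proof.
have [_ h _ _] := pV (bg' (Some j) false) (bg g u).
by rewrite {h}(h (Some j) false g u) // grp_pairing_some //; case: u.
Qed.

Let vL : Lin (\val : B -> UB) := val_lin (X := X).
Let vL' : Lin (\val : B' -> UB) := val_lin (X := X').
Local Notation cr := (@cross K B B' p UB \val \val).
#[local] Hint Resolve vL vL' : lin.

Lemma hitr_ge g u j : hitr p (bg' g u) (be j) = invb u (wt false g j)^-1 *: be j.
Proof.
rewrite /hitr (sw2_pure2 _ (be_prim j)); last by lin.
by rewrite p_ge p_gg scale0r add0r.
Qed.
Lemma hitl_ge g u j : hitl p (bg' g u) (be j) = be j.
Proof.
rewrite /hitl (sw2_pure2 _ (be_prim j)); last by lin.
by rewrite p_ge (pairr1 Hp) (bg'_grouplike g u).2 scale1r scale0r addr0.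
Qed.
Lemma hitr_fe i j : hitr p (bf i) (be j) = ((i == j)%:R / (s - r)) *: bone B.
Proof.
rewrite /hitr (sw2_pure2 _ (be_prim j)); last by lin.
by rewrite p_fe p_fg scale0r addr0.
Qed.
Lemma hitl_fe i j : hitl p (bf i) (be j) = ((i == j)%:R / (s - r)) *: bg (Some j) false.
Proof.
rewrite /hitl (sw2_pure2 _ (be_prim j)); last by lin.
by rewrite p_fe (pairr1 Hp) bf_eps scale0r add0r.
Qed.

Lemma borel_ind (P : B -> Prop) :
    (forall j, P (be j)) -> (forall g u, P (bg g u)) -> P (bone B) ->
    (forall k a b, P a -> P b -> P (k *: a + b)) ->
    (forall a b, P a -> P b -> P (a ** b)) -> forall a, P a.
Proof.
move=> Pe Pg P1 Pl Pm; apply: subalg_ind => // a /borel_glP [[j aE]|[g [u aE]]].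
  by rewrite (_ : a = be j) //; apply: val_inj.
by rewrite (_ : a = bg g u) //; apply: val_inj.
Qed.

Lemma borel_ind' (P : B' -> Prop) :
    (forall j, P (bf j)) -> (forall g u, P (bg' g u)) -> P (bone B') ->
    (forall k a b, P a -> P b -> P (k *: a + b)) ->
    (forall a b, P a -> P b -> P (a ** b)) -> forall a, P a.
Proof.
move=> Pe Pg P1 Pl Pm; apply: subalg_ind => // a /borel_glP' [[j aE]|[g [u aE]]].
  by rewrite (_ : a = bf j) //; apply: val_inj.
by rewrite (_ : a = bg' g u) //; apply: val_inj.
Qed.

Lemma cross_glE g u a : cr (bg' g u) a <->
  gl false g u * \val (hitr p (bg' g u) a) = \val (hitl p (bg' g u) a) * gl false g u.
Proof.
exact: (cross_group BB hU.1 Hp vL vL' a (bg'_grouplike g u)).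
Qed.

(** A group-like of B' acts on B by algebra maps on either side, so the relation passes to products.
    At e_j it is the commutation [gl_e], because the pairing with omega_j is the inverse of the
    weight at e_j. *)
Lemma cross_gl g u a : cr (bg' g u) a.
Proof.
elim/borel_ind: a => [j|g' u'||k a a' IH IH'|a a'].
- apply/cross_glE; rewrite hitr_ge hitl_ge /= -scalerAr gl_e // scalerA -invbM.
  by rewrite mulVf ?wt0 // /invb invr1 if_same scale1r.
- apply/(cross_glE g u (bg g' u')); rewrite !(hitl_group, hitr_group) //; try exact: bg_grouplike.
  by rewrite /= -scalerAr -scalerAl glC.
- apply/cross_glE; rewrite (hitl_one BB Hp) (hitr_one BB Hp) /= -scalerAr -scalerAl.
  by rewrite mulr1 mul1r.
- apply/cross_glE; move/cross_glE: IH; move/cross_glE: IH'.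
  rewrite ((bil_hitl BB Hp).1 _ k) ((bil_hitr BB Hp).1 _ k) /=.
  by rewrite mulrDr mulrDl -scalerAr -scalerAl => -> ->.
- move=> /cross_glE IH /cross_glE IH'; apply/cross_glE.
  rewrite (hitl_grouplM BB Hp (bg'_grouplike g u)) (hitr_grouplM BB Hp (bg'_grouplike g u)).
  by rewrite /= mulrA IH -mulrA IH' mulrA.
Qed.

Lemma cross_fE i a : cr (bf i) a <->
  uf r s i * \val a + gl false (Some i) false * \val (hitr p (bf i) a) =
  \val (hitl p (bf i) a) + \val (hitl p (bg' (Some i) false) a) * uf r s i.
Proof.
exact: (cross_skew BB hU.1 Hp vL vL' a _ (bf_prim i)).
Qed.

(** At e_j the relation reads f_i e_j + c omega'_i = c omega_j + e_j f_i with c = (f_i, e_j); this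
    is (R4), and it explains why the pairing has s - r where (R4) has r - s. At a group-like it is
    [gl_f]. On a product the two skew derivations are matched by moving omega'_i past the first
    factor with [cross_gl]. *)
Lemma cross_f i a : cr (bf i) a.
Proof.
have wG := bg'_grouplike (Some i) false.
have fM := hitl_skewM BB Hp (bf_prim i).
have fM' := hitr_skewM BB Hp (bf_prim i).
elim/borel_ind: a => [j|g' u'||k a a' IH IH'|a a'].
- apply/cross_fE; rewrite hitl_fe hitr_fe hitl_ge /= -scalerAr mulr1.
  have /eqP := ue_uf r s j i; rewrite subr_eq => /eqP ->.
  rewrite [LHS]addrC [RHS]addrA; congr (_ + _); rewrite eq_sym.
  case: eqP => [->|_]; last by rewrite !mul0r !scale0r addr0.
  by rewrite -[s - r]opprB invrN mulrN !scaleNr scalerBr addrA addNr add0r.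
- apply/cross_fE; rewrite !(hitl_group Hp _ (bg_grouplike _ _)).
  rewrite (hitr_group Hp _ (bg_grouplike _ _)).
  rewrite p_fg p_wg !scale0r /= mulr0 addr0 add0r -scalerAl gl_f // scalerA -invbM divff ?wt0 //.
  by rewrite /invb invr1 if_same scale1r.
- apply/cross_fE; rewrite !(hitl_one BB Hp) (hitr_one BB Hp) bf_eps wG.2 scale0r scale1r /=.
  by rewrite mulr0 mulr1 mul1r addr0 add0r.
- by apply: (cross_lin2 BB Hp hU.1 vL k IH IH').
- move=> /cross_fE IH /cross_fE IH'; apply/cross_fE.
  have := proj1 (cross_glE (Some i) false a) (cross_gl (Some i) false a).
  rewrite fM fM' (hitl_grouplM BB Hp wG) /= => W.
  rewrite mulrDr !mulrA addrA -mulrDl IH W mulrDl -!addrA; congr (_ + _).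
  by rewrite -[_ * gl _ _ _ * _]mulrA -[_ * uf r s i * _]mulrA -[LHS]mulrDr IH' mulrDr mulrA.
Qed.

Lemma gl_cross b a : cr b a.
Proof.
move: a; elim/borel_ind': b => [j|g u||k b b' IH IH'|b b' IH IH'] a.
- exact: cross_f.
- exact: cross_gl.
(* The unit is handled as a group-like element, whose two actions are the identity. *)
- have D1 : grouplike (bone B') by split; [exact: bcomul1 BB'|exact: bcounit1 BB'].
  apply/(cross_group BB hU.1 Hp vL vL' a D1).
  by rewrite (hitl1 BB Hp) (hitr1 BB Hp) /= mul1r mulr1.
- by apply: (cross_lin BB BB' Hp hU.1 vL vL' k (IH a) (IH' a)).
- by apply: (crossM BB BB' Hp hU.1 vL vL' _ IH IH').
Qed.

End GlDouble.

(* A U_{r,s}(gl_n)-action built from the action of the group-likes omega_j,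
   omega'_j, a_n, b_n instead of the a_i, b_i, recovered by descending
   recursion from a_i = omega_i / b_(i+1) and b_i = omega'_i / a_(i+1). *)
Section UglAction.
Variables (K : fieldType) (N : nat) (r s : K) (V : lmodType K).
Hypotheses (r0 : r != 0) (s0 : s != 0).
Variables (M : bool -> option 'I_N -> bool -> V -> V) (E F : 'I_N -> V -> V).
Hypotheses (ML : forall A g u, Lin (M A g u)).
Hypotheses (EL : forall j, Lin (E j)) (FL : forall j, Lin (F j)).
Local Notation wt := (gl_wt r s).
Local Notation rs_param := (rs_param r s).
Hypothesis MC : forall A g u A' g' u' v, M A g u (M A' g' u' v) = M A' g' u' (M A g u v).
Hypothesis MV : forall A g u v, M A g u (M A g (~~ u) v) = v.
Hypothesis ME : forall A g u j v, M A g u (E j v) = invb u (wt A g j) *: E j (M A g u v).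
Hypothesis MF : forall A g u j v,
  M A g u (F j v) = invb u (wt A g j)^-1 *: F j (M A g u v).
Hypothesis EF : forall i j v, E i (F j v) - F j (E i v) =
  ((i == j)%:R / (r - s)) *: (M true (Some i) false v - M false (Some i) false v).
Hypothesis EE : forall i j : 'I_N, (i.+1 < j)%N || (j.+1 < i)%N ->
  forall v, E i (E j v) - E j (E i v) = 0.
Hypothesis FF : forall i j : 'I_N, (i.+1 < j)%N || (j.+1 < i)%N ->
  forall v, F i (F j v) - F j (F i v) = 0.
Hypothesis EEl : forall i j : 'I_N, j = i.+1 :> nat -> forall v,
  E i (E i (E j v)) - (r + s) *: E i (E j (E i v)) + (r * s) *: E j (E i (E i v)) = 0.
Hypothesis EEr : forall i j : 'I_N, j = i.+1 :> nat -> forall v,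
  E i (E j (E j v)) - (r + s) *: E j (E i (E j v)) + (r * s) *: E j (E j (E i v)) = 0.
Hypothesis FFl : forall i j : 'I_N, j = i.+1 :> nat -> forall v,
  F i (F i (F j v)) - (r^-1 + s^-1) *: F i (F j (F i v))
    + (r^-1 * s^-1) *: F j (F i (F i v)) = 0.
Hypothesis FFr : forall i j : 'I_N, j = i.+1 :> nat -> forall v,
  F i (F j (F j v)) - (r^-1 + s^-1) *: F j (F i (F j v))
    + (r^-1 * s^-1) *: F j (F j (F i v)) = 0.

(** Here d is the distance to the top index. For 0 < d <= N one has N - d < N, so [insub] yields
    [Some], never the [None] that stands for a_n or b_n. Negating [A] and [u] passes from a_i to the
    inverse of b_(i+1), and likewise with a and b exchanged. *)
Fixpoint tor_rec (d : nat) (A u : bool) : V -> V :=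
  if d is d'.+1 then fun v => M A (insub (N - d)%N) u (tor_rec d' (~~ A) (~~ u) v)
  else M A None u.

Definition tor_act A (k : 'I_N.+1) u := tor_rec (N - k) A u.

Lemma tor_act_max A u : tor_act A ord_max u = M A None u.
Proof. by rewrite /tor_act subnn. Qed.

Lemma tor_act_lo A i u v :
  tor_act A (lo i) u v = M A (Some i) u (tor_act (~~ A) (hi i) (~~ u) v).
Proof.
rewrite /tor_act; have -> : (N - hi i = (N - i).-1)%N.
  by rewrite /= /bump leq0n add1n subnS.
have dE : (N - i = (N - i).-1.+1)%N by rewrite prednK // subn_gt0.
rewrite [(N - lo i)%N]dE /= -dE subKn; last exact: ltnW.
by rewrite valK.
Qed.

Lemma tor_act_lin A k u : Lin (tor_act A k u).
Proof.
elim/hi_lo_ind: k A u => [|i IH] A u; first by rewrite tor_act_max.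
by move=> c x y; rewrite !tor_act_lo IH ML.
Qed.

Lemma M_tor A g u B k w v : M A g u (tor_act B k w v) = tor_act B k w (M A g u v).
Proof.
elim/hi_lo_ind: k B w v => [|i IH] B w v; first by rewrite tor_act_max MC.
by rewrite !tor_act_lo MC IH.
Qed.

Lemma tor_actC A k u B l w v :
  tor_act A k u (tor_act B l w v) = tor_act B l w (tor_act A k u v).
Proof.
elim/hi_lo_ind: k A u v => [|i IH] A u v; first by rewrite tor_act_max M_tor.
by rewrite !tor_act_lo IH M_tor.
Qed.

Lemma tor_actV A k u v : tor_act A k u (tor_act A k (~~ u) v) = v.
Proof.
elim/hi_lo_ind: k A u v => [|i IH] A u v; first by rewrite !tor_act_max MV.
by rewrite !tor_act_lo -M_tor IH MV.
Qed.

Lemma tor_act_e A k u j v : tor_act A k u (E j v) =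
  invb u (rs_param A ^ inner (epsilon k) (alpha j)) *: E j (tor_act A k u v).
Proof.
elim/hi_lo_ind: k A u v => [|i IH] A u v; first by rewrite !tor_act_max ME.
rewrite !tor_act_lo IH (linZ (ML _ _ _)) ME scalerA; congr (_ *: _).
(* The weight of [M A (Some i)] has one factor for [lo i] and one for [hi i]; the recursive call
   contributes the second one inverted, and the two cancel. *)
have q0 : rs_param (~~ A) ^ inner (epsilon (hi i)) (alpha j) != 0 by apply: rs_param_neq0.
rewrite mulrC /gl_wt; case: u; rewrite /invb /= ?invfM -mulrA.
  by rewrite mulVf // mulr1.
by rewrite divff // mulr1.
Qed.

Lemma tor_act_f A k u j v : tor_act A k u (F j v) =
  invb u (rs_param A ^ inner (epsilon k) (alpha j))^-1 *: F j (tor_act A k u v).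
Proof.
elim/hi_lo_ind: k A u v => [|i IH] A u v; first by rewrite !tor_act_max MF.
rewrite !tor_act_lo IH (linZ (ML _ _ _)) MF scalerA; congr (_ *: _).
have q0 : rs_param (~~ A) ^ inner (epsilon (hi i)) (alpha j) != 0 by apply: rs_param_neq0.
rewrite mulrC /gl_wt; case: u; rewrite /invb /= ?invrK ?invfM -mulrA.
  by rewrite divff // mulr1.
by rewrite mulVf // mulr1.
Qed.

Definition gen_act (g : ugen N) : V -> V :=
  match g with
  | GE j => E j
  | GF j => F j
  | GA i u => tor_act true i u
  | GB i u => tor_act false i u
  end.

Lemma gen_act_lin g : Lin (gen_act g).
Proof. by case: g => [j|j|k u|k u] //=; exact: tor_act_lin. Qed.

Lemma ugl_rel_act t u : ugl_rel r s t u -> term_act gen_act t =1 term_act gen_act u.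
Proof.
have m1 (x : V) : -1 *: x = - x by rewrite scaleN1r.
have z (x : V) : 0 *: x = 0 by rewrite scale0r.
case=> /= {t u}.
- by move=> i j u v w; apply: tor_actC.
- by move=> i j u v w; apply: tor_actC.
- by move=> i j u v w; apply: tor_actC.
- by move=> i w; rewrite (tor_actV _ _ false) scale1r.
- by move=> i w; rewrite (tor_actV _ _ false) scale1r.
- by move=> i j w; apply: (tor_act_e true).
- by move=> i j w; rewrite -invr_expz; apply: (tor_act_f true).
- by move=> i j w; apply: (tor_act_e false).
- by move=> i j w; rewrite -invr_expz; apply: (tor_act_f false).
(* By the recursion a_i b_(i+1) acts as omega_i followed by a cancelling pair; for a_(i+1) b_i the
   two operators are first interchanged. *)
- move=> i j w; rewrite !m1 EF tor_act_lo tor_actV; congr (_ *: (_ - _)).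
  by rewrite tor_actC tor_act_lo tor_actV.
- by move=> i j ij w; rewrite !m1 z EE.
- by move=> i j ij w; rewrite !m1 z FF.
- by move=> i j ij w; rewrite !m1 z EEl.
- by move=> i j ij w; rewrite !m1 z EEr.
- by move=> i j ij w; rewrite !m1 z FFl.
- by move=> i j ij w; rewrite !m1 z FFr.
Qed.

Definition ugl_act (x : Ugl N r s) : V -> V := term_act gen_act (prep x).

Lemma ugl_act_cls t : ugl_act (pcls _ t) =1 term_act gen_act t.
Proof. exact: (pres_eq_act gen_act_lin ugl_rel_act (prepP _ t)). Qed.

Lemma ugl_act1 v : ugl_act 1 v = v.
Proof. by rewrite -pcls1 ugl_act_cls /= scale1r. Qed.

Lemma ugl_actM x y v : ugl_act (x * y) v = ugl_act x (ugl_act y v).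
Proof.
elim/pres_ind: x => t; elim/pres_ind: y => u.
by rewrite -[_ * _]pclsM !ugl_act_cls.
Qed.

Lemma ugl_act_linl v : Lin (ugl_act^~ v).
Proof.
move=> k; elim/pres_ind=> t; elim/pres_ind=> u.
by rewrite -[k *: _]pclsZ -[_ + _]pclsD !ugl_act_cls.
Qed.

Lemma ugl_act_e j v : ugl_act (ue r s j) v = E j v.
Proof. exact: ugl_act_cls. Qed.
Lemma ugl_act_f j v : ugl_act (uf r s j) v = F j v.
Proof. exact: ugl_act_cls. Qed.

Lemma ugl_act_tor A k u v : ugl_act (tor r s A k u) v = tor_act A k u v.
Proof. by case: A; apply: ugl_act_cls. Qed.

Lemma ugl_act_gl A g u v : ugl_act (gl r s A g u) v = M A g u v.
Proof.
rewrite glE; case: g => [i|]; last by rewrite ugl_act_tor tor_act_max.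
rewrite ugl_actM !ugl_act_tor tor_act_lo.
by have := tor_actV (~~ A) (hi i) (~~ u) v; rewrite negbK => ->.
Qed.

End UglAction.

(** * The isomorphisms *)

Lemma double_hopf_iso (K : fieldType) (H Hc U : bialg_data K) (p : Hc -> H -> K)
    (i : H -> U) (j : Hc -> U) :
  is_bialgebra H -> is_hopf Hc -> is_hopf U -> @is_hopf_pairing K (coop Hc) H p ->
  is_bhom i -> is_bhom j -> (forall b a, cross p i j b a) ->
  injective (dmap i j) -> (forall u, exists x, dmap i j x = u) ->
  hopf_isomorphic (drinfeld_double H Hc p) U.
Proof.
move=> HB [HcB HcS] UH Hp iH jH Hcr dI dS; have UB := UH.1.
have [iL iM i1 iD ie] := iH; have [jL jM j1 jD je] := jH.
apply: (@hopf_iso_bij _ (drinfeld_double H Hc p) U (dmap i j)) => //.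
  split.
  - exact: dmap_lin.
  - exact: dmapM.
  - exact: dmap1.
  - exact: dmap_comul.
  - exact: dmap_counit.
have [g gP] := choice dS; exists g => // x; apply: dI; exact: gP.
Qed.

(** * Restriction of pairings, cross relations and multiplication maps along morphisms *)

Section PairingPull.
Variables (K : fieldType) (H Hc H0 Hc0 : bialg_data K).
Variables (i : H0 -> H) (j : Hc0 -> Hc).
Hypotheses (iH : is_bhom i) (jH : is_bhom j).
Variable p : Hc -> H -> K.
Hypothesis Hp : @is_hopf_pairing K (coop Hc) H p.
Local Notation p0 := (fun x y => p (j x) (i y)).

Lemma sw2_bhom_bal (A B : bialg_data K) (f : A -> B) (M : zmodType) (g : B -> B -> M) x :
  is_bhom f -> balanced g ->
  sweedler2 g (f x) = sweedler2 (fun u v => g (f u) (f v)) x.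
Proof.
move=> [_ _ _ fD _] gb.
rewrite (@sw2_sumE _ _ _ _ _ [seq (f q.1, f q.2) | q <- trep (bcomul x)]) ?big_map //.
Qed.

Lemma bhom_coop (A B : bialg_data K) (f : A -> B) :
  is_bhom f -> @is_bhom K (coop A) (coop B) f.
Proof.
move=> [fL fM f1 fD fe]; split=> // x; rewrite /= fD /tens_flip [tens_map f f (bcomul x)]/tens_map.
have bl (V W : lmodType K) : Bil (fun (v : V) (w : W) => w ⊗ v) by split=> z; lin.
rewrite (tens_lift_comp _ _ (tens_lift_lin (bl _ _))).
apply: etrans (esym (tens_lift_comp _ _ (tens_map_lin fL fL))).
apply: eq_tens_lift => u v; rewrite tens_mapE // tens_lift_pure //.
exact: bil_balanced.
Qed.

Lemma balanced_pair (A : bialg_data K) (f g : A -> K) : Sca f -> Sca g ->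
  balanced (fun u v => f u * g v).
Proof.
move=> fS gS; split=> [u v w|u v w|k u v].
- by rewrite (scaD fS) mulrDl.
- by rewrite (scaD gS) mulrDr.
- by rewrite (scaZ fS) (scaZ gS) mulrCA mulrA.
Qed.

Lemma pairing_pull : @is_hopf_pairing K (coop Hc0) H0 p0.
Proof.
have [iL iM i1 iD ie] := iH; have [jL jM j1 jD je] := jH.
have [[pl pr] p1 pr1 pm pm'] := Hp; have jH' := bhom_coop jH.
split.
- by split=> [x' k x y|x k x' y']; rewrite /= ?iL ?jL ?pl ?(pr (i x)).
- by move=> x; rewrite /= j1 -ie; apply: p1.
- by move=> x; rewrite /= i1 pr1 -je.
- move=> x' x y; rewrite /= iM pm (@sw2_bhom_bal (coop Hc0) (coop Hc) j) //.
  by apply: balanced_pair => k u v; apply: pr.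
- move=> x' y' x; rewrite /= jM [LHS]pm' sw2_bhom_bal //.
  by apply: balanced_pair => k u v; apply: pl.
Qed.

Hypotheses (HB : is_bialgebra H) (HcB : is_bialgebra Hc).

Lemma hitr_pull b a : i (hitr p0 b a) = hitr p (j b) (i a).
Proof.
have iL : Lin i by case: iH.
rewrite [in RHS]/hitr (sw2_bhom _ iH); last by split=> z; lin.
by rewrite (sw2_comp _ _ iL); apply: eq_sw2 => u v; rewrite (linZ iL).
Qed.
Lemma hitl_pull b a : i (hitl p0 b a) = hitl p (j b) (i a).
Proof.
have iL : Lin i by case: iH.
rewrite [in RHS]/hitl (sw2_bhom _ iH); last by split=> z; lin.
by rewrite (sw2_comp _ _ iL); apply: eq_sw2 => u v; rewrite (linZ iL).
Qed.

Variables (U U0 : bialg_data K) (k : U0 -> U).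
Hypotheses (UB : is_bialgebra U) (kH : is_bhom k) (kI : injective k).
Variables (I : H -> U) (J : Hc -> U) (I0 : H0 -> U0) (J0 : Hc0 -> U0).
Hypotheses (IL : Lin I) (JL : Lin J).
Hypotheses (kI0 : forall x, k (I0 x) = I (i x)) (kJ0 : forall x, k (J0 x) = J (j x)).
#[local] Hint Resolve IL JL : lin.

(** Morphisms carry the transposed actions of the restricted pairing to those of p, so both sides
    have the expected images in U, and injectivity of k brings the equality back. *)
Lemma cross_pull b a : cross p I J (j b) (i a) -> cross p0 I0 J0 b a.
Proof.
have [kL kM _ _ _] := kH.
rewrite /cross (sw2_bhom _ jH); last by lin.
rewrite (sw2_bhom _ jH); last by lin.
move=> E; apply: kI; rewrite !(sw2_comp _ _ kL).
transitivity (sweedler2 (fun u v => J (j v) ** I (hitr p (j u) (i a))) b).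
  by apply: eq_sw2 => u v; rewrite kM kJ0 kI0 hitr_pull.
rewrite E; apply: eq_sw2 => u v; by rewrite kM kJ0 kI0 hitl_pull.
Qed.

Lemma dmap_pull x : Lin i -> Lin j -> Lin I0 -> Lin J0 -> is_bialgebra U0 ->
  k (dmap I0 J0 x) = dmap I J (tens_map i j x).
Proof.
move=> iL jL I0L J0L U0B; have [kL kM _ _ _] := kH.
have dL := dmap_lin UB IL JL.
rewrite /tens_map (tens_lift_comp _ _ dL) /dmap (tens_lift_comp _ _ kL).
apply: eq_tens_lift => u v; rewrite -/(dmap I J) dmapE // kM kI0 kJ0 //.
Qed.

End PairingPull.

Section SubIncl.
Variables (K : fieldType) (A : algType K) (D : A -> tensor A A) (eps : A -> K).
Hypothesis UH : is_hopf (alg_bialg D eps).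

Lemma incl_bhom (X Y : set A) (XY : (X `<=` Y)%classic) :
  Hopf_gens D eps X -> Hopf_gens D eps Y ->
  @is_bhom K (sub_bialg D eps X) (sub_bialg D eps Y) (subalg_incl XY).
Proof.
move=> gX gY.
exact: (@bhom_cancel K (sub_bialg D eps X) (sub_bialg D eps Y) (alg_bialg D eps)
  (subalg_incl XY) \val val_inj (val_bhom UH gY) (val_bhom UH gX)).
Qed.

Lemma incl_inj (X Y : set A) (XY : (X `<=` Y)%classic) : injective (subalg_incl XY).
Proof. by move=> x y /(congr1 \val) /= xy; apply: val_inj. Qed.

End SubIncl.

Section AlgAction.
Variables (K : fieldType) (A : algType K) (V : lmodType K) (L : A -> V -> V).
Hypotheses (LL : forall v, Lin (L^~ v)) (LR : forall x, Lin (L x))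
           (LM : forall x y v, L (x * y) v = L x (L y v)).

Lemma act_comm x y v : x * y - y * x = 0 -> L x (L y v) - L y (L x v) = 0.
Proof. by move=> E; rewrite -!LM -(linN (LL v)) -(linD (LL v)) E (lin0 (LL v)). Qed.

Lemma act_serreL c d x y v : serreL c d x y = 0 ->
  L x (L x (L y v)) - c *: L x (L y (L x v)) + d *: L y (L x (L x v)) = 0.
Proof.
move=> E; rewrite -!LM -!(linZ (LL v)) -(linN (LL v)) -!(linD (LL v)) ?mulrA.
by rewrite [X in L X v]E (lin0 (LL v)).
Qed.

Lemma act_serreR c d x y v : serreR c d x y = 0 ->
  L x (L y (L y v)) - c *: L y (L x (L y v)) + d *: L y (L y (L x v)) = 0.
Proof.
move=> E; rewrite -!LM -!(linZ (LL v)) -(linN (LL v)) -!(linD (LL v)) ?mulrA.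
by rewrite [X in L X v]E (lin0 (LL v)).
Qed.
End AlgAction.

(** * The action of U_{r,s}(gl_n) on the double, and the isomorphism for gl_n *)

Section Main.
Variables (K : fieldType) (N : nat) (r s : K).
Hypotheses (r0 : r != 0) (s0 : s != 0).
Local Notation U := (Ugl N r s).
Variables (D : U -> tensor U U) (eps : U -> K).
Hypothesis HU : is_ugl_hopf D eps.
Local Notation UB := (alg_bialg D eps).
Local Notation X := (borel_gl_gens N r s).
Local Notation X' := (borel_gl_gens' N r s).
Local Notation B := (sub_bialg D eps X).
Local Notation B' := (sub_bialg D eps X').
Variable p : B' -> B -> K.
Hypotheses (Hp : @is_hopf_pairing K (coop B') B p) (pV : pairing_values p).

Local Notation gl := (gl r s).
Local Notation wt := (gl_wt r s).
Let hU := ugl_hopf HU.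
Let gX := Hopf_gens_gl HU.
Let gX' := Hopf_gens_gl' HU.
Let BB : is_bialgebra B := sub_bialgB hU gX.
Let BH' : is_hopf B' := sub_hopf hU gX'.
Let BB' : is_bialgebra B' := BH'.1.
Let SP : is_antipode (@antipode K B') := antipodeP BH'.2.
Let vL : Lin (\val : B -> UB) := val_lin (X := X).
Let vL' : Lin (\val : B' -> UB) := val_lin (X := X').

Local Notation V := (tensor B B').
Local Notation lm := (@lmulT K B B').
Local Notation lo := (@lop K B B' p (@antipode K B')).
Local Notation be := (be D eps).
Local Notation bf := (bf D eps).
Local Notation bg := (bg D eps).
Local Notation bg' := (bg' D eps).

Let lmL g : Lin (lm g) := lmulT_lin BB g.
Let loL b : Lin (lo b) := lop_lin BB BB' Hp _ b.
Let lmM g g' v : lm (g ** g') v = lm g (lm g' v) := lmulTM BB g g' v.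
Let loM b b' v : lo (b ** b') v = lo b (lo b' v) := lopM BB BB' Hp SP b b' v.
Let lmLl v : Lin (lm^~ v) := lmulT_linl BB v.
Let loLl v : Lin (lo^~ v) := lop_linl BB BB' Hp SP v.

Definition Mop (A : bool) g u : V -> V := if A then lm (bg g u) else lo (bg' g u).

Lemma Mop_lin A g u : Lin (Mop A g u).
Proof. by case: A; [exact: lmL|exact: loL]. Qed.

Let lo_lm g u g' u' v : lo (bg' g u) (lm (bg g' u') v) = lm (bg g' u') (lo (bg' g u) v).
Proof.
apply: (lop_group_group BB BB' Hp SP (bg'_grouplike HU g u) (bg'_grouplike HU g (~~ u))).
  exact: bg'V.
exact: bg_grouplike HU _ _.
Qed.

Lemma MopC A g u A' g' u' v : Mop A g u (Mop A' g' u' v) = Mop A' g' u' (Mop A g u v).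
Proof.
case: A; case: A' => /=.
- have bgC : bg g u ** bg g' u' = bg g' u' ** bg g u.
    by apply: val_inj; apply: (glC r s true _ _ true).
  by rewrite -lmM bgC lmM.
- by rewrite lo_lm.
- by rewrite lo_lm.
- have bgC : bg' g u ** bg' g' u' = bg' g' u' ** bg' g u.
    by apply: val_inj; apply: (glC r s false _ _ false).
  by rewrite -loM bgC loM.
Qed.

Lemma MopV A g u v : Mop A g u (Mop A g (~~ u) v) = v.
Proof.
case: A => /=.
  rewrite -lmM (_ : _ ** _ = bone B) ?lmulT1 //; apply: val_inj; exact: (glV r s true).
by rewrite -loM bg'V lop1.
Qed.

Lemma Mop_e A g u j v : Mop A g u (lm (be j) v) =
  invb u (wt A g j) *: lm (be j) (Mop A g u v).
Proof.
case: A => /=.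
  have E : bg g u ** be j = invb u (wt true g j) *: (be j ** bg g u).
    by apply: val_inj; apply: (gl_e r0 s0 true).
  by rewrite -!lmM E (linZ (lmLl v)).
rewrite (lop_group_prim BB BB' Hp SP (bg'_grouplike HU g u) (bg'_grouplike HU g (~~ u))
  (bg'V D eps g u) v (be_prim HU j) (p_ge pV _ _ _) (p_ge pV _ _ _)).
(* [p_gg] is taken at the inverse element [bg' g (~~ u)], whose inverted weight agrees with [invb u]
   of the weight itself. *)
by rewrite (p_gg pV); case: u; rewrite /invb /= ?invrK.
Qed.

Lemma Mop_f A g u j v : Mop A g u (lo (bf j) v) =
  invb u (wt A g j)^-1 *: lo (bf j) (Mop A g u v).
Proof.
case: A => /=; last first.
  have E : bg' g u ** bf j = invb u (wt false g j)^-1 *: (bf j ** bg' g u).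
    by apply: val_inj; apply: (gl_f r0 s0 false).
  by rewrite -!loM E (linZ (loLl v)).
rewrite (lop_skew_group BB BB' Hp SP (bg'_grouplike HU (Some j) false)
  (bg'_grouplike HU (Some j) true) (bg'V D eps (Some j) false) (bf_prim HU j)
  (bf_eps HU j) v (bg_grouplike HU g u) (p_fg pV _ _ _)).
rewrite (p_wg pV) scalerA -invbM mulVf; last exact: wt0.
by rewrite /invb invr1 if_same scale1r.
Qed.

(** [lop_skew_prim] expresses the commutator in the opposite order; the change of sign turns 1/(s -
    r) into 1/(r - s). The group-likes carry the indices i and j, which agree whenever the
    coefficient is nonzero. *)
Lemma op_ef i j v : lm (be i) (lo (bf j) v) - lo (bf j) (lm (be i) v) =
  ((i == j)%:R / (r - s)) *: (Mop true (Some i) false v - Mop false (Some i) false v).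
Proof.
have subDr (W : zmodType) (x y : W) : x - (x + y) = - y.
  by rewrite opprD addrA subrr add0r.
rewrite (lop_skew_prim BB BB' Hp SP (bg'_grouplike HU (Some j) false)
  (bg'_grouplike HU (Some j) true) (bg'V D eps (Some j) false) (bf_prim HU j)
  (bf_eps HU j) v (bg_grouplike HU (Some i) false) (be_prim HU i)
  (p_fg pV _ _ _) (p_ge pV _ _ _) (p_ge pV _ _ _)).
apply: etrans (subDr _ _ _) _.
rewrite (p_fe pV).
rewrite [j == i]eq_sym.
case: eqP => [->|_].
  by rewrite -scaleNr -mulrN -invrN opprB.
by rewrite !mul0r !scale0r oppr0.
Qed.

Let AB : algType K := subalg X.
Let AB' : algType K := subalg X'.

Lemma be_comm (i j : 'I_N) : (i.+1 < j)%N || (j.+1 < i)%N ->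
  forall v, lm (be i) (lm (be j) v) - lm (be j) (lm (be i) v) = 0.
Proof.
move=> ij v; apply: (@act_comm K AB V (@lmulT K B B') lmLl lmM).
by apply: val_inj; apply: ueC.
Qed.
Lemma bf_comm (i j : 'I_N) : (i.+1 < j)%N || (j.+1 < i)%N ->
  forall v, lo (bf i) (lo (bf j) v) - lo (bf j) (lo (bf i) v) = 0.
Proof.
move=> ij v; apply: (@act_comm K AB' V lo loLl loM).
by apply: val_inj; apply: ufC.
Qed.
Lemma be_serreL (i j : 'I_N) : j = i.+1 :> nat -> forall v,
  lm (be i) (lm (be i) (lm (be j) v)) - (r + s) *: lm (be i) (lm (be j) (lm (be i) v))
  + (r * s) *: lm (be j) (lm (be i) (lm (be i) v)) = 0.
Proof.
move=> ij v; apply: (@act_serreL K AB V (@lmulT K B B') lmLl lmM).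
by apply: val_inj; apply: ue_serreL.
Qed.
Lemma be_serreR (i j : 'I_N) : j = i.+1 :> nat -> forall v,
  lm (be i) (lm (be j) (lm (be j) v)) - (r + s) *: lm (be j) (lm (be i) (lm (be j) v))
  + (r * s) *: lm (be j) (lm (be j) (lm (be i) v)) = 0.
Proof.
move=> ij v; apply: (@act_serreR K AB V (@lmulT K B B') lmLl lmM).
by apply: val_inj; apply: ue_serreR.
Qed.
Lemma bf_serreL (i j : 'I_N) : j = i.+1 :> nat -> forall v,
  lo (bf i) (lo (bf i) (lo (bf j) v)) - (r^-1 + s^-1) *: lo (bf i) (lo (bf j) (lo (bf i) v))
  + (r^-1 * s^-1) *: lo (bf j) (lo (bf i) (lo (bf i) v)) = 0.
Proof.
move=> ij v; apply: (@act_serreL K AB' V lo loLl loM).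
by apply: val_inj; apply: uf_serreL.
Qed.
Lemma bf_serreR (i j : 'I_N) : j = i.+1 :> nat -> forall v,
  lo (bf i) (lo (bf j) (lo (bf j) v)) - (r^-1 + s^-1) *: lo (bf j) (lo (bf i) (lo (bf j) v))
  + (r^-1 * s^-1) *: lo (bf j) (lo (bf j) (lo (bf i) v)) = 0.
Proof.
move=> ij v; apply: (@act_serreR K AB' V lo loLl loM).
by apply: val_inj; apply: uf_serreR.
Qed.

Local Notation act := (@ugl_act K N r s V Mop (fun j => lm (be j)) (fun j => lo (bf j))).

Let actM x y v : act (x * y) v = act x (act y v) :=
  ugl_actM r0 s0 Mop_lin (fun j => lmL _) (fun j => loL _) MopC MopV Mop_e Mop_f op_ef
    be_comm bf_comm be_serreL be_serreR bf_serreL bf_serreR x y v.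
Let act1 v : act 1 v = v :=
  ugl_act1 r0 s0 Mop_lin (fun j => lmL _) (fun j => loL _) MopC MopV Mop_e Mop_f op_ef
    be_comm bf_comm be_serreL be_serreR bf_serreL bf_serreR v.
Let actL v : Lin (act^~ v) :=
  ugl_act_linl r0 s0 Mop_lin (fun j => lmL _) (fun j => loL _) MopC MopV Mop_e Mop_f op_ef
    be_comm bf_comm be_serreL be_serreR bf_serreL bf_serreR v.

Let act_e j v : act (ue r s j) v = lm (be j) v :=
  ugl_act_e r0 s0 Mop_lin (fun j => lmL _) (fun j => loL _) MopC MopV Mop_e Mop_f op_ef
    be_comm bf_comm be_serreL be_serreR bf_serreL bf_serreR j v.
Let act_f j v : act (uf r s j) v = lo (bf j) v :=
  ugl_act_f r0 s0 Mop_lin (fun j => lmL _) (fun j => loL _) MopC MopV Mop_e Mop_f op_ef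
    be_comm bf_comm be_serreL be_serreR bf_serreL bf_serreR j v.
Let act_gl A g u v : act (gl A g u) v = Mop A g u v :=
  ugl_act_gl r0 s0 Mop_lin (fun j => lmL _) (fun j => loL _) MopC MopV Mop_e Mop_f op_ef
    be_comm bf_comm be_serreL be_serreR bf_serreL bf_serreR A g u v.

Lemma act_borel (a : B) v : act (\val a) v = lm a v.
Proof.
apply: (@generated_act_eq K U X V (fun x => act x) (@lmulT K B B') act1 _ actM lmM actL lmLl).
  exact: lmulT1.
move=> {}a /borel_glP [[j aE]|[g [u aE]]] {}v; rewrite aE.
  by rewrite (_ : a = be j) ?act_e //; apply: val_inj.
by rewrite (_ : a = bg g u) ?act_gl //; apply: val_inj.
Qed.

Lemma act_borel' (b : B') v : act (\val b) v = lo b v.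
Proof.
apply: (@generated_act_eq K U X' V (fun x => act x) lo act1 _ actM loM actL loLl).
  exact: (lop1 BB BB' Hp SP).
move=> {}b /borel_glP' [[j bE]|[g [u bE]]] {}v; rewrite bE.
  by rewrite (_ : b = bf j) ?act_f //; apply: val_inj.
by rewrite (_ : b = bg' g u) ?act_gl //; apply: val_inj.
Qed.

Local Notation phi := (@dmap K B B' UB \val \val).

Let hB : is_bialgebra UB := hU.1.

(** In the product ab the factor b acts first and turns 1 (x) 1 into 1 (x) b; left multiplication by
    a then gives a (x) b. *)
Lemma act_phi x : act (phi x) (bone B ⊗ bone B') = x.
Proof.
move: x; apply: tens_ext; [|exact: lin_id|] => [|a b].
  exact: (lin_comp (actL _) (dmap_lin hB vL vL')).
rewrite (dmapE hB vL vL') [_ ** _]/(_ * _) actM act_borel' act_borel.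
by rewrite (lop_one BB BB' Hp SP) lmulTE // bmulr1.
Qed.

Lemma gl_phi_inj : injective phi.
Proof. by move=> x y xy; rewrite -[x]act_phi xy act_phi. Qed.

Let phiM x y : phi (double_mul p x y) = phi x * phi y.
Proof.
by apply: (dmapM BB BB' Hp hB vL vL' _ _ (gl_cross r0 s0 HU Hp pV) BH'.2).
Qed.
Let phiL : Lin phi := dmap_lin hB vL vL'.
Let phi1 : phi (bone B ⊗ bone B') = 1.
Proof. by rewrite (dmapE hB vL vL'); apply: mulr1. Qed.
Let phi_l a : phi (a ⊗ bone B') = \val a.
Proof. by rewrite (dmapE hB vL vL'); apply: mulr1. Qed.
Let phi_r b : phi (bone B ⊗ b) = \val b.
Proof. by rewrite (dmapE hB vL vL'); apply: mul1r. Qed.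

(** The multiplication map turns the product of the double into that of U, so its image is closed
    under products and only the generators call for preimages. *)
Lemma gl_phi_surj (x : U) : exists y, phi y = x.
Proof.
have mulP (y z : U) : (exists t, phi t = y) -> (exists t, phi t = z) -> exists t, phi t = y * z.
  by move=> [t <-] [t' <-]; exists (double_mul p t t'); apply: phiM.
have glP A g u : exists t, phi t = gl A g u.
  case: A; first by exists (bg g u ⊗ bone B'); apply: phi_l.
  by exists (bone B ⊗ bg' g u); apply: phi_r.
(* Apart from a_n and b_n, the a_k and b_k are not among the generators of the Borel subalgebras;
   they are reached downwards from n as products of elements of the image. *)
have torP A k u : exists t, phi t = tor r s A k u.
  elim/hi_lo_ind: k A u => [|i IH] A u.
    by have [t tE] := glP A None u; exists t; rewrite tE glE.
  have E : tor r s A (Defs.lo i) u = gl A (Some i) u * tor r s (~~ A) (hi i) (~~ u).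
    by rewrite glE -mulrA torV mulr1.
  by rewrite E; apply: mulP.
elim/pres_ind: x => t; elim: t => [[j|j|k u|k u]|c|t IHt u IHu|t IHt u IHu].
- by exists (be j ⊗ bone B'); apply: phi_l.
- by exists (bone B ⊗ bf j); apply: phi_r.
- exact: (torP true).
- exact: (torP false).
- exists (c *: (bone B ⊗ bone B')); rewrite (linZ phiL) phi1.
  by rewrite -[RHS]mulr1 -pcls1 -pclsM pclsZ.
- rewrite [pcls _ _]pclsD; case: IHt => y <-; case: IHu => z <-.
  by exists (y + z); apply: (linD phiL).
- by rewrite [pcls _ _]pclsM; apply: mulP.
Qed.

Lemma gl_iso : hopf_isomorphic (drinfeld_double B B' p) UB.
Proof.
apply: (double_hopf_iso BB BH' hU Hp (val_bhom hU gX) (val_bhom hU gX')).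
- exact: (gl_cross r0 s0 HU Hp pV).
- exact: gl_phi_inj.
- exact: gl_phi_surj.
Qed.

(** * Restriction to U_{r,s}(sl_n) *)

Local Notation Y := (borel_sl_gens N r s).
Local Notation Y' := (borel_sl_gens' N r s).
Local Notation Z := (sl_gens N r s).
Local Notation Bsl := (sub_bialg D eps Y).
Local Notation Bsl' := (sub_bialg D eps Y').
Local Notation Usl := (sub_bialg D eps Z).

Let gY := Hopf_gens_bsl HU.
Let gY' := Hopf_gens_bsl' HU.
Let gZ := Hopf_gens_sl HU.

Lemma borel_sl_sub : (Y `<=` Z)%classic.
Proof.
by move=> x [j [->|[u ->]]]; exists j; [left|right; right; exists u; left].
Qed.
Lemma borel_sl_sub' : (Y' `<=` Z)%classic.
Proof.
by move=> x [j [->|[u ->]]]; exists j; [right; left|right; right; exists u; right].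
Qed.

Let iota : Bsl -> Usl := subalg_incl borel_sl_sub.
Let iota' : Bsl' -> Usl := subalg_incl borel_sl_sub'.
Let kap : Bsl -> B := borel_incl.
Let kap' : Bsl' -> B' := borel_incl'.
Let iotaH : is_bhom iota := incl_bhom hU _ gY gZ.
Let iotaH' : is_bhom iota' := incl_bhom hU _ gY' gZ.
Let kapH : is_bhom kap := incl_bhom hU _ gY gX.
Let kapH' : is_bhom kap' := incl_bhom hU _ gY' gX'.
Let kL : Lin kap. Proof. by case: kapH. Qed.
Let kL' : Lin kap'. Proof. by case: kapH'. Qed.
Let ioL : Lin iota. Proof. by case: iotaH. Qed.
Let ioL' : Lin iota'. Proof. by case: iotaH'. Qed.
Let BZ : is_bialgebra Usl := sub_bialgB hU gZ.
Let BY : is_bialgebra Bsl := sub_bialgB hU gY.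
Let BY' : is_hopf Bsl' := sub_hopf hU gY'.
Let valZ : @is_bhom K Usl UB \val := val_bhom hU gZ.

Local Notation p0 := (fun (x : Bsl') (y : Bsl) => p (kap' x) (kap y)).
Local Notation phi0 := (@dmap K Bsl Bsl' Usl iota iota').

Let Hp0 : @is_hopf_pairing K (coop Bsl') Bsl p0 := pairing_pull kapH kapH' Hp.

Lemma sl_cross b a : cross p0 iota iota' b a.
Proof.
apply: (@cross_pull K B B' Bsl Bsl' kap kap' kapH kapH' p Hp BB UB Usl \val hB
  valZ val_inj \val \val iota iota' vL vL' _ _ b a) => //.
exact: (gl_cross r0 s0 HU Hp pV).
Qed.

Let phi0E x : \val (phi0 x) = phi (tens_map kap kap' x).
Proof.
apply: (@dmap_pull K B B' Bsl Bsl' kap kap' UB Usl \val hB valZ \val \val iota iota'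
  vL vL' (fun=> erefl) (fun=> erefl) x kL kL' ioL ioL' BZ).
Qed.

Lemma sl_phi_inj : injective phi0.
Proof.
move=> x y /(congr1 \val); rewrite !phi0E => /gl_phi_inj.
by apply: (tens_map_inj kL kL'); apply: incl_inj.
Qed.

(** Each generator e_j, f_j, omega_j, omega'_j, or inverse, lies in one of the two Borel subalgebras
    and is the image of a tensor with 1; multiplicativity of the map does the rest. *)
Lemma sl_phi_surj (x : Usl) : exists y, phi0 y = x.
Proof.
have phi0L : Lin phi0 := dmap_lin BZ ioL ioL'.
have phi0_l a : phi0 (a ⊗ bone Bsl') = iota a.
  by rewrite (dmapE BZ ioL ioL'); apply: val_inj; apply: mulr1.
have phi0_r b : phi0 (bone Bsl ⊗ b) = iota' b.
  by rewrite (dmapE BZ ioL ioL'); apply: val_inj; apply: mul1r.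
have phi0M y z : phi0 (double_mul p0 y z) = phi0 y ** phi0 z.
  have [_ iM _ _ _] := iotaH; have [_ iM' _ _ _] := iotaH'.
  exact: (dmapM BY BY'.1 Hp0 BZ ioL ioL' iM iM' sl_cross BY'.2).
move: x; apply: subalg_ind => [x [j [xE|[xE|[u [xE|xE]]]]]||k a b [y <-] [z <-]|a b [y <-] [z <-]].
- have gx : generated Y (ue r s j) by apply: gen_in; exists j; left.
  by exists (sub_el gx ⊗ bone Bsl'); rewrite phi0_l; apply: val_inj; rewrite xE.
- have gx : generated Y' (uf r s j) by apply: gen_in; exists j; left.
  by exists (bone Bsl ⊗ sub_el gx); rewrite phi0_r; apply: val_inj; rewrite xE.
- have gx : generated Y (omega r s j u) by apply: gen_in; exists j; right; exists u.
  by exists (sub_el gx ⊗ bone Bsl'); rewrite phi0_l; apply: val_inj; rewrite xE.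
- have gx : generated Y' (omega' r s j u) by apply: gen_in; exists j; right; exists u.
  by exists (bone Bsl ⊗ sub_el gx); rewrite phi0_r; apply: val_inj; rewrite xE.
- by exists (bone Bsl ⊗ bone Bsl'); rewrite phi0_l; apply: val_inj.
- by exists (k *: y + z); rewrite phi0L.
- by exists (double_mul p0 y z); apply: phi0M.
Qed.

Lemma sl_iso : hopf_isomorphic (drinfeld_double Bsl Bsl' p0) Usl.
Proof.
apply: (double_hopf_iso BY BY' (sub_hopf hU gZ) Hp0 iotaH iotaH').
- exact: sl_cross.
- exact: sl_phi_inj.
- exact: sl_phi_surj.
Qed.

End Main.

Theorem theorem2p7 (K : fieldType) (n : nat) (r s : K)
  (n_ge2 : (2 <= n)%N) (r_neq0 : r != 0) (s_neq0 : s != 0) (r_neq_s : r != s)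
  (* the Hopf algebra structure of U_{r,s}(gl_n) *)
  (D : Ugl n.-1 r s -> tensor (Ugl n.-1 r s) (Ugl n.-1 r s))
  (eps : Ugl n.-1 r s -> K)
  (HU : is_ugl_hopf D eps) :
  let Ugl_n := alg_bialg D eps in
  let Usl_n := sub_bialg D eps (sl_gens n.-1 r s) in
  (* B tilde, B, (B' tilde)^coop and (B')^coop *)
  let Bgl := sub_bialg D eps (borel_gl_gens n.-1 r s) in
  let Bsl := sub_bialg D eps (borel_sl_gens n.-1 r s) in
  let Bgl'_coop := sub_bialg D eps (borel_gl_gens' n.-1 r s) in
  let Bsl'_coop := sub_bialg D eps (borel_sl_gens' n.-1 r s) in
  forall p : coop Bgl'_coop -> Bgl -> K,
  is_hopf_pairing p -> pairing_values p ->
  hopf_isomorphic (drinfeld_double Bgl Bgl'_coop p) Ugl_n /\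
  hopf_isomorphic
    (drinfeld_double Bsl Bsl'_coop
       (fun x y => p (borel_incl' x) (borel_incl y)))
    Usl_n.
Proof.
move=> Ugl_n Usl_n Bgl Bsl Bgl'_coop Bsl'_coop p Hp pV; split.
  exact: (@gl_iso K n.-1 r s r_neq0 s_neq0 D eps HU p Hp pV).
exact: (@sl_iso K n.-1 r s r_neq0 s_neq0 D eps HU p Hp pV).
Qed.
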